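(* If $G$ is a convex body in $\mathbb{R}^2$, then there exist two linearly independent vectors $\xi_1,\xi_2\in\mathbb{S}^1$ such that for all $0<p\le\infty$ and $r\in\mathbb{N}$, $$w_r(G;\{\xi_1,\xi_2\})_p\le C(p,r)<\infty,$$ where $C(p,r)>0$ is a constant depending only on $p$ and $r$.
   Context: Notation (used with $d=2$). $\|\cdot\|$ is the Euclidean norm, $\mathbb{S}^{d-1}=\{x\in\mathbb{R}^d:\|x\|=1\}$, $\mathbb{N}=\{1,2,\dots\}$. A convex body in $\mathbb{R}^d$ is a compact convex subset with nonempty interior. For $0<p<\infty$, $L^p(\Omega)$ is the usual Lebesgue space; $L^\infty(\Omega):=C(\overline{\Omega})$ with the uniform norm. For a nonempty bounded measurable set $\Omega\subset\mathbb{R}^d$, $h\in\mathbb{R}^d\setminus\{0\}$ and $r\in\mathbb{N}$ put $\Omega_{r,h}:=\{x\in\Omega: x,x+h,\dots,x+rh\in\Omega\}$ and $\triangle_h^r f(x):=\sum_{j=0}^r(-1)^{r+j}\binom{r}{j}f(x+jh)$ for $x\in\Omega_{r,h}$. For $\xi\in\mathbb{S}^{d-1}$, $t>0$, $0<p\le\infty$ let $\omega_\xi^r(f,t)_{L^p(\Omega)}:=\sup_{|u|\le t}\|\triangle_{u\xi}^rf\|_{L^p(\Omega_{r,u\xi})}$ (the norm over an empty set is $0$). For a nonempty $\mathcal{E}\subset\mathbb{S}^{d-1}$ let $\omega^r_{\mathcal{E}}(f;\Omega)_p:=\sup_{\xi\in\mathcal{E}}\omega^r_\xi(f,\operatorname{diam}(\Omega))_{L^p(\Omega)}$.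 $\Pi^d_{r-1}(\mathcal{E})$ is the set of all real continuous functions $Q$ on $\mathbb{R}^d$ such that for every fixed $x\in\mathbb{R}^d$ and $\xi\in\mathcal{E}$ the function $t\mapsto Q(x+t\xi)$ is an algebraic polynomial of degree $<r$ in $t\in\mathbb{R}$. Set $E_r(f;\mathcal{E})_{L^p(\Omega)}:=\inf\{\|f-Q\|_{L^p(\Omega)}:Q\in\Pi^d_{r-1}(\mathcal{E})\}$. The directional Whitney constant is $w_r(\Omega;\mathcal{E})_p:=\sup\{E_r(f;\mathcal{E})_{L^p(\Omega)}: f\in L^p(\Omega),\ \omega^r_{\mathcal{E}}(f;\Omega)_p\le 1\}\in[0,\infty]$. *)

(* Defs.v *)
From HB Require Import structures.
From mathcomp Require Import all_boot all_order all_algebra.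
From mathcomp Require Import all_classical all_reals all_analysis.

Set Implicit Arguments.
Unset Strict Implicit.
Unset Printing Implicit Defensive.

Import Order.TTheory GRing.Theory Num.Theory.
Import numFieldNormedType.Exports.

Local Open Scope classical_set_scope.
Local Open Scope ring_scope.

(* The factors are [R^o] so that the product carries the module, vector space
   and topological structures over [R].  The library norm on this product is
   the maximum norm; [enorm] is the Euclidean one (same topology). *)
Notation plane R := (R^o * R^o)%type.

(* The same type with its product Borel sigma-algebra. *)
Notation mplane R := (measurableTypeR R * measurableTypeR R)%type.

Section directional_whitney.
Context {R : realType}.
Implicit Types (x y h xi : plane R) (A Omega : set (plane R)).
Implicit Types (E : set (plane R)) (f Q : plane R -> R) (p : \bar R).

Definition enorm x : R := Num.sqrt (x.1 ^+ 2 + x.2 ^+ 2).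

Definition sphere1 : set (plane R) := [set x | enorm x = 1].

Definition diam A : R := sup [set enorm (z.1 - z.2) | z in A `*` A].

Definition convex_body A := [/\ compact A, convex_set A & A° !=set0].

Definition leb2 : {measure set (mplane R) -> \bar R} :=
  (@lebesgue_measure R \x @lebesgue_measure R)%E.

(* For p = +oo this is the uniform norm, not an essential supremum; adding 0
   makes the norm over the empty set equal to 0.  Only p > 0 is relevant. *)
Definition Lpnorm A p f : \bar R :=
  if p == +oo%E then ereal_sup (0%E |` [set `|f x|%:E | x in A])
  else ('N[leb2]_p[EFin \o (f \_ A)])%E.

(* Functions on Omega are represented by total functions whose values off
   Omega (off its closure if p = +oo) are irrelevant, and classes modulo
   null sets by Borel representatives. *)
Definition Lpspace Omega p : set (plane R -> R) :=
  [set f | if p == +oo%E then {within closure Omega, continuous f}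
           else measurable_fun (Omega : set (mplane R)) (f : mplane R -> R)
                /\ (Lpnorm Omega p f < +oo)%E].

Definition diff_domain Omega r h : set (plane R) :=
  [set x | forall j, (j <= r)%N -> Omega (x + j%:R *: h)].

Definition fdiff r h f x : R :=
  \sum_(j < r.+1) (-1) ^+ (r + j) * 'C(r, j)%:R * f (x + j%:R *: h).

Definition dir_modulus Omega p r xi f (t : R) : \bar R :=
  ereal_sup [set Lpnorm (diff_domain Omega r (u *: xi)) p (fdiff r (u *: xi) f)
            | u in [set u : R | `|u| <= t]].

Definition set_modulus Omega p r E f : \bar R :=
  ereal_sup [set dir_modulus Omega p r xi f (diam Omega) | xi in E].

(* Degree < r is [size P <= r]. *)
Definition dir_poly r E : set (plane R -> R) :=
  [set Q | continuous Q /\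
     forall x xi, E xi -> exists P : {poly R},
       (size P <= r)%N /\ forall t : R, Q (x + t *: xi) = P.[t]].

Definition best_approx Omega p r E f : \bar R :=
  ereal_inf [set Lpnorm Omega p (f \- Q) | Q in dir_poly r E].

Definition whitney_const Omega p r E : \bar R :=
  ereal_sup [set best_approx Omega p r E f
            | f in [set f | Lpspace Omega p f
                            /\ (set_modulus Omega p r E f <= 1)%E]].

End directional_whitney.

(* Main.v *)
(* Choose a parallelogram of maximal area with vertices in the convex body [G], and let
   xi1, xi2 be the directions of its sides. In the affine coordinates in which it is the
   unit square, maximality forces [G] into the box [-3, 4]^2 and into the union of the
   horizontal and the vertical strip through the square. On the square, Marchaud's
   inequality bounds small translations of [f] by a small multiple of [f] plus a multiple
   of the modulus; comparing [f] with a tensor product Lagrange interpolant whose nodes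
   form a fine grid, translated by a typical vector, then yields a polynomial [L] for which
   the norm of [f - L] is at most half of that of [f] plus a constant, and iterating gives
   the Whitney inequality on the square. Since an r-th difference expresses a value through
   values at r equidistant points, the inequality propagates along the strips to [G]. *)

From HB Require Import structures.
Require Import Defs.
From mathcomp Require Import all_boot all_order all_algebra.
From mathcomp Require Import all_classical all_reals all_analysis.
From mathcomp Require Import measurable_realfun.
From mathcomp Require Import ring lra zify.

Set Implicit Arguments.
Unset Strict Implicit.
Unset Printing Implicit Defensive.

Import Order.TTheory GRing.Theory Num.Theory.
Import numFieldNormedType.Exports.
Local Open Scope classical_set_scope.
Local Open Scope ring_scope.

(** * Polynomials in a translation *)

(** The argument therefore works with e-th powers of norms, uses translations and finite linear
    combinations, and finds the base point of the interpolation grid by averaging. The order of the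
    choices is decisive. Close to a point the interpolation error carries a coefficient [a]
    independent of the grid size [K]; given [a], Marchaud's inequality yields a step length below
    which translations cost a small enough multiple of [f], and [K] is adapted to that length. The
    coefficient [b] of the grid differences may grow with [K], since those are bounded by the
    modulus. The contraction x -> x/2 + C needs some finite initial x, but leaves a bound that does
    not depend on it. Constants are quantified before the gauge, hence before the body, its frame
    and its measure: this is why C(p,r) depends on p and r alone. *)

Section shift_operators.
Context {R : realType}.
Implicit Types (p q : {poly R}) (v x : plane R) (f g : plane R -> R).

(* [q] applied to the translation operator [f |-> f (. + v)]. *)
Definition shift_op q v f x : R :=
  \sum_(i < size q) q`_i * f (x + i%:R *: v).

Lemma shift_op_widen n q v f x : (size q <= n)%N ->
  shift_op q v f x = \sum_(i < n) q`_i * f (x + i%:R *: v).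
Proof.
move=> sq; rewrite /shift_op (big_ord_widen n (fun i => q`_i * f (x + i%:R *: v))) //.
rewrite big_mkcond; apply: eq_bigr => i _.
by case: ltnP => // /(nth_default 0) ->; rewrite mul0r.
Qed.

Lemma shift_opD p q v f x :
  shift_op (p + q) v f x = shift_op p v f x + shift_op q v f x.
Proof.
rewrite !(@shift_op_widen (maxn (size p) (size q))) ?leq_maxl ?leq_maxr ?size_polyD //.
by rewrite -big_split; apply: eq_bigr => i _; rewrite coefD mulrDl.
Qed.

Lemma shift_opZ c q v f x : shift_op (c *: q) v f x = c * shift_op q v f x.
Proof.
rewrite (@shift_op_widen (size q)) ?size_scale_leq // big_distrr /=.
by apply: eq_bigr => i _; rewrite coefZ mulrA.
Qed.

Lemma shift_op0 v f x : shift_op 0 v f x = 0.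
Proof. by rewrite /shift_op size_poly0 big_ord0. Qed.

Lemma shift_opN q v f x : shift_op (- q) v f x = - shift_op q v f x.
Proof. by rewrite -scaleN1r shift_opZ mulN1r. Qed.

Lemma shift_opC c v f x : shift_op c%:P v f x = c * f x.
Proof.
rewrite (@shift_op_widen 1) ?size_polyC_leq1 // big_ord1 coefC eqxx.
by rewrite scale0r addr0.
Qed.

Lemma shift_opMX q v f x : shift_op (q * 'X) v f x = shift_op q v f (x + v).
Proof.
rewrite (@shift_op_widen (size q).+1); last first.
  by rewrite (leq_trans (size_polyMleq _ _)) // size_polyX addn2.
rewrite big_ord_recl coefMX eqxx mul0r add0r; apply: eq_bigr => i _.
rewrite coefMX /= /bump /= add1n; congr (_ * f _).
by rewrite -addrA -natr1 scalerDl scale1r [v + _]addrC.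
Qed.

(** With the additive rules this makes [q |-> shift_op q v] a ring morphism into operators, so that
    polynomial identities become identities between differences. *)
Lemma shift_opM p q v f x :
  shift_op (p * q) v f x = shift_op p v (shift_op q v f) x.
Proof.
elim/poly_ind: p x => [|p c IH] x; first by rewrite mul0r !shift_op0.
rewrite mulrDl !shift_opD -mulrA ['X * q]mulrC mulrA !shift_opMX IH.
by rewrite mul_polyC shift_opZ shift_opC.
Qed.

Lemma shift_opXn k v f x : shift_op 'X^k v f x = f (x + k%:R *: v).
Proof.
elim: k x => [|k IH] x.
  by rewrite expr0 -[1]/(1%:P) shift_opC mul1r scale0r addr0.
by rewrite exprSr shift_opMX IH -addrA -natr1 scalerDl scale1r [v + _]addrC.
Qed.

Lemma shift_op_sum n (F : 'I_n -> {poly R}) v f x :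
  shift_op (\sum_(i < n) F i) v f x = \sum_(i < n) shift_op (F i) v f x.
Proof.
by elim/big_ind2: _ => [|p1 s1 p2 s2 <- <-|//]; [exact: shift_op0|exact: shift_opD].
Qed.

(** Substituting X^m multiplies the step by [m]; this is how differences of two step lengths get
    compared. *)
Lemma shift_op_comp_Xn q m v f x :
  shift_op (q \Po 'X^m) v f x = shift_op q (m%:R *: v) f x.
Proof.
rewrite comp_polyE shift_op_sum; apply: eq_bigr => i _.
by rewrite shift_opZ -exprM shift_opXn scalerA -natrM mulnC.
Qed.

Lemma shift_op_fdiff r v f x : shift_op (('X - 1) ^+ r) v f x = fdiff r v f x.
Proof.
rewrite exprBn shift_op_sum /fdiff (reindex_inj rev_ord_inj).
apply: eq_bigr => i _ /=; rewrite subSS.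
have ir : (i <= r)%N by rewrite -ltnS.
rewrite -mulr_natr expr1n mulr1 subKn // -signr_odd oddB // -oddD signr_odd.
rewrite bin_sub // mulrAC -(rmorph_sign (@polyC R)) -(rmorph_nat (@polyC R)) -rmorphM /=.
by rewrite mul_polyC shift_opZ shift_opXn.
Qed.

Lemma fdiffB r v f g x :
  fdiff r v (fun z => f z - g z) x = fdiff r v f x - fdiff r v g x.
Proof.
by rewrite /fdiff -sumrB; apply: eq_bigr => i _; rewrite mulrBr.
Qed.

(** The nodes are read from the far end. This serves points from which a forward walk would leave
    the square. *)
Lemma fdiff_opp r v f x :
  fdiff r v f x = (-1) ^+ r * fdiff r (- v) f (x + r%:R *: v).
Proof.
rewrite /fdiff big_distrr /= (reindex_inj rev_ord_inj); apply: eq_bigr => i _ /=.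
have ir : (i <= r)%N by rewrite -ltnS.
rewrite subSS bin_sub // !mulrA -exprD; congr (_ * _ * f _).
  by rewrite -signr_odd -[in RHS]signr_odd !oddD oddB.
by rewrite natrB // scalerBl scalerN addrA.
Qed.

(** Euclidean division by (X - 1)^r. The size of [q] ensures that q (X - 1)^r looks at no translate
    beyond the k-th. *)
Lemma shift_expn_modXB1 r k : exists q rem : {poly R},
  (size rem <= r)%N /\ (size q <= k.+1 - r)%N /\ 'X^k = q * ('X - 1) ^+ r + rem :> {poly R}.
Proof.
exists ('X^k %/ ('X - 1) ^+ r), ('X^k %% ('X - 1) ^+ r); split; last split; last exact: divp_eq.
  rewrite -ltnS -[X in (_ < X)%N](size_exp_XsubC r (1 : R)) polyC1 ltn_modp.
  by rewrite expf_neq0 // -polyC1 polyXsubC_eq0.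
by rewrite -polyC1 size_divp ?expf_neq0 ?polyXsubC_eq0 // size_exp_XsubC size_polyXn.
Qed.

(** X^m - 1 = (X - 1) S with S = 1 + ... + X^(m-1) and S(1) = m, so S^k is m^k modulo X - 1. The
    size of [q] says that q (X - 1)^(k+1) has degree at most k m: no point beyond x + k m v is
    used. *)
Lemma powXB1 k m : exists q : {poly R},
  (('X - 1) ^+ k \Po 'X^m) = m%:R ^+ k *: ('X - 1) ^+ k + q * ('X - 1) ^+ k.+1
  /\ (0 < m -> 0 < k -> size q <= k * m.-1)%N.
Proof.
have [s Hs] : exists s : {poly R}, \sum_(i < m) 'X^i = m%:R%:P + s * ('X - 1).
  have /factor_theorem [s Hs] : root (\sum_(i < m) 'X^i - m%:R%:P : {poly R}) 1.
    rewrite /root !hornerE horner_sum (eq_bigr (fun=> 1)).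
      by rewrite sumr_const card_ord subrr.
    by move=> i _; rewrite hornerXn expr1n.
  by exists s; rewrite -[X in _ + s * ('X - X)]polyC1 -Hs addrC subrK.
set S := \sum_(i < m) _ in Hs.
have HX : ('X - 1) ^+ k \Po 'X^m = ('X - 1) ^+ k * S ^+ k :> {poly R}.
  rewrite rmorphXn /= rmorphB /= comp_polyX -[1 \Po _]/(1%:P \Po _) comp_polyC.
  by rewrite polyC1 subrX1 exprMn.
have [t Ht] : exists t : {poly R}, S ^+ k = (m%:R ^+ k)%:P + t * ('X - 1).
  elim: k {HX} => [|k [t Ht]]; first by exists 0; rewrite mul0r addr0 !expr0.
  exists (t * S + (m%:R ^+ k)%:P * s).
  rewrite exprSr Ht {1}Hs [in LHS]mulrDr exprSr polyCM.
  by rewrite {1}Hs; ring.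
exists t; split; first by rewrite HX Ht mulrDr [_ * _%:P]mulrC mul_polyC exprS; ring.
move=> m0 k0; have [->|t0] := eqVneq t 0; first by rewrite size_poly0.
have nz : ('X - 1 : {poly R}) != 0 by rewrite -polyC1 polyXsubC_eq0.
have szX : size ('X - 1 : {poly R}) = 2%N by rewrite -polyC1 size_XsubC.
have sS : (size S <= m)%N.
  apply: (leq_trans (size_sum _ _ _)); apply/bigmax_leqP => i _.
  by rewrite size_polyXn.
have := congr1 (fun z : {poly R} => size (z - (m%:R ^+ k)%:P)) Ht.
rewrite /= addrAC subrr add0r size_mul // szX addn2 /= => Hsz.
have : (size (S ^+ k - (m%:R ^+ k)%:P)%R <= maxn (k * m.-1).+1 1)%N.
  apply: (leq_trans (size_polyD _ _)); rewrite geq_max !leq_max size_polyN size_polyC_leq1 orbT andbT.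
  apply/orP; left.
  apply: (leq_trans (size_poly_exp_leq _ _)); rewrite ltnS mulnC leq_mul2l.
  by apply/orP; right; rewrite -!subn1 leq_sub2r.
by rewrite Hsz (maxn_idPl _) // ltnS.
Qed.

End shift_operators.

(** * Sets and axis directions in the square, and the axioms of a gauge *)

Definition shift_set {R : realType} (v : plane R) (A : set (plane R)) : set (plane R) :=
  [set z | A (z + v)].

(** Half-open, so that the K^2 cells partition it. *)
Definition usq {R : realType} : set (plane R) :=
  [set x | 0 <= x.1 < 1 /\ 0 <= x.2 < 1].

Definition cell {R : realType} (K k l : nat) : set (plane R) :=
  [set x | k%:R / K%:R <= x.1 < k.+1%:R / K%:R /\
           l%:R / K%:R <= x.2 < l.+1%:R / K%:R].

(** The axis is a boolean so that one proof serves both directions, [~~ d] being the transversal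
    one. *)
Definition vec {R : realType} (d : bool) (u : R) : plane R :=
  if d then (0, u) else (u, 0).

(* [nle A f x] stands for [\int_A |f|^e <= x], or for [sup_A |f| <= x] with [e = 1].
   In [nle_avg] the point [y] is a typical point of the corner cell: the right-hand
   side, averaged over [y], is controlled by translates of [f] and by the [g t];
   the final [+ 1] is the price for picking one [y]. *)
Record gauge (R : realType) (e : R) := Gauge {
  nle :> set (plane R) -> (plane R -> R) -> R -> Prop;
  nle_ge0 : forall A f x, nle A f x -> 0 <= x;
  nle_sub : forall A B f x, measurable (A : set (mplane R)) ->
    A `<=` B -> nle B f x -> nle A f x;
  nle_weak : forall A f x y, x <= y -> nle A f x -> nle A f y;
  nle_union : forall A B f x y, nle A f x -> nle B f y -> nle (A `|` B) f (x + y);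
  nle_shift : forall v A f x, nle A f x ->
    nle (shift_set v A) (fun z => f (z + v)) x;
  nle_add : forall A f g x y, nle A f x -> nle A g y ->
    nle A (fun z => f z + g z) (2 `^ e * (x + y));
  nle_scale : forall c A f x, nle A f x ->
    nle A (fun z => c * f z) (`|c| `^ e * x);
  nle_ext : forall A f g x, (forall z, A z -> f z = g z) ->
    nle A f x -> nle A g x;
  nle_avg : forall (K r rho : nat) (T : finType) (node : nat -> nat -> nat)
      (a b w1 w2 : R) (f : plane R -> R) (x : R) (g : T -> plane R -> R),
    (0 < K)%N -> 0 <= a -> 0 <= b ->
    (forall k i, (k < K)%N -> (i < r)%N ->
       [/\ node k i < K, k <= node k i + rho & node k i <= k + rho]%N) ->
    nle usq f x ->
    (forall u, `|u.1| <= rho.+1%:R / K%:R -> `|u.2| <= rho.+1%:R / K%:R ->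
       nle (usq `&` shift_set u usq) (fun z => f (z + u) - f z) w1) ->
    (forall t, nle (cell K 0 0) (g t) w2) ->
    exists2 y, cell K 0 0 y & forall Q : plane R -> R,
      measurable_fun setT (Q : mplane R -> R) ->
      (forall k l z, (k < K)%N -> (l < K)%N -> cell K k l z ->
         `|f z - Q z| `^ e <=
           a * (\sum_(i < r) \sum_(j < r)
             `|f (y + ((node k i)%:R / K%:R, (node l j)%:R / K%:R)) - f z| `^ e) +
           b * \sum_t `|g t y| `^ e) ->
      nle usq (fun z => f z - Q z)
        (a * (r ^ 2 * (2 * rho.+1) ^ 2)%:R * w1 + b * (K ^ 2 * #|T|)%:R * w2 + 1)
}.

Lemma measurable_shift_set {R : realType} (v : plane R) (A : set (plane R)) :
  measurable (A : set (mplane R)) -> measurable (shift_set v A : set (mplane R)).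
Proof.
move=> mA; rewrite -[shift_set v A]setTI.
have mf : measurable_fun setT (fun z : mplane R => (z.1 + v.1, z.2 + v.2) : mplane R).
  apply: measurable_fun_pair.
    by apply: measurable_funD => //; exact: measurable_fst.
  by apply: measurable_funD => //; exact: measurable_snd.
exact: (mf measurableT A mA).
Qed.

Lemma measurable_box {R : realType} (I J : interval R) :
  measurable ([set x | x.1 \in I /\ x.2 \in J] : set (mplane R)).
Proof.
have -> : [set x : mplane R | x.1 \in I /\ x.2 \in J] =
    [set` I] `*` [set` J] by apply/seteqP; split.
by apply: measurableX.
Qed.

Lemma measurable_cell {R : realType} (K k l : nat) :
  measurable (cell K k l : set (mplane R)).
Proof.
have := measurable_box `[k%:R / K%:R, k.+1%:R / K%:R[ `[l%:R / K%:R, l.+1%:R / K%:R[ : measurable (_ : set (mplane R)).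
by congr measurable; apply/seteqP; split => x /=; rewrite !in_itv.
Qed.

Lemma cell1 {R : realType} : cell 1 0 0 = usq :> set (plane R).
Proof. by rewrite /cell /usq !mul0r !divr1. Qed.

Lemma measurable_usq {R : realType} : measurable (usq : set (mplane R)).
Proof. by rewrite -cell1; exact: measurable_cell. Qed.

Lemma diff_domainE {R : realType} (A : set (plane R)) r h :
  diff_domain A r h = \bigcap_(j in [set j | (j <= r)%N]) shift_set (j%:R *: h) A.
Proof. by []. Qed.

Lemma measurable_diff_domain {R : realType} (A : set (plane R)) r h :
  measurable (A : set (mplane R)) -> measurable (diff_domain A r h : set (mplane R)).
Proof.
move=> mA; rewrite diff_domainE; apply: bigcap_measurable => [|j _].
  by exists 0%N.
exact: measurable_shift_set.
Qed.

Lemma vecN {R : realType} d (u : R) : - vec d u = vec d (- u).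
Proof. by case: d; rewrite /vec; congr (_, _); rewrite oppr0. Qed.

Lemma vecZ {R : realType} d (c u : R) : c *: vec d u = vec d (c * u).
Proof.
by case: d; rewrite [LHS]surjective_pairing /vec /= ?scaler0.
Qed.

Definition coord {R : realType} (d : bool) (x : plane R) : R :=
  if d then x.2 else x.1.

Lemma coord_vec {R : realType} d (x : plane R) u :
  coord d (x + vec d u) = coord d x + u.
Proof. by case: d. Qed.

Lemma coord_vecN {R : realType} d (x : plane R) u :
  coord (~~ d) (x + vec d u) = coord (~~ d) x.
Proof. by case: d; rewrite /coord /= addr0. Qed.

Lemma usqE {R : realType} d (x : plane R) :
  usq x <-> 0 <= coord d x < 1 /\ 0 <= coord (~~ d) x < 1.
Proof. by case: d; rewrite /usq /coord /=; split => -[]. Qed.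

Lemma usq_vec {R : realType} d (x : plane R) u : usq x ->
  usq (x + vec d u) <-> 0 <= coord d x + u < 1.
Proof.
move=> /(usqE d)[x1 x2]; rewrite (usqE d) coord_vec coord_vecN.
by split => [[]|].
Qed.

Lemma usq_seg {R : realType} d (u : R) n x : usq x -> usq (x + n%:R *: vec d u) ->
  forall j, (j <= n)%N -> usq (x + j%:R *: vec d u).
Proof.
move=> Ux; rewrite vecZ (usq_vec _ _ Ux) => Un j jn.
rewrite vecZ (usq_vec _ _ Ux).
have {jn} : (j%:R : R) <= n%:R by rewrite ler_nat.
have : 0 <= (j%:R : R) by [].
move: Ux => /(usqE d)[Ux _].
move: Un; move: (coord d x) Ux (n%:R : R) (j%:R : R) => c /andP[c0 c1] N J /andP[N0 N1] J0 JN.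
have [u0|u0] := leP 0 u; apply/andP; split; nra.
Qed.

(** * Marchaud inequality on the unit square *)

Section marchaud.
Context {R : realType} {e : R}.
Hypothesis e0 : 0 < e.
Implicit Types (N : gauge e) (A : set (plane R)) (f g : plane R -> R).

(** Gauges add two functions at a time, each addition costing a factor 2^e. *)
Lemma nle_lincomb n (c : 'I_n.+1 -> R) : exists2 C, 0 <= C &
  forall N A (f : 'I_n.+1 -> plane R -> R) x, (forall i, N A (f i) x) ->
    N A (fun z => \sum_i c i * f i z) (C * x).
Proof.
elim: n c => [|n IH] c.
  exists (`|c ord0| `^ e); first exact: powR_ge0.
  move=> N A f x Hf; apply: nle_ext (nle_scale (c ord0) (Hf ord0)) => z _.
  by rewrite big_ord1.
have [C C0 HC] := IH (fun i => c (widen_ord (leqnSn _) i)).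
exists (2 `^ e * (C + `|c ord_max| `^ e)).
  by rewrite mulr_ge0 ?addr_ge0 ?powR_ge0.
move=> N A f x Hf.
have H := nle_add (HC N A (fun i => f (widen_ord (leqnSn _) i)) x (fun i => Hf _))
  (nle_scale (c ord_max) (Hf ord_max)).
rewrite -mulrA mulrDl; apply: nle_ext H => z _.
by rewrite [RHS]big_ord_recr.
Qed.

Lemma nle_shift_op (q : {poly R}) : exists2 C, 0 <= C &
  forall N A v f x,
    (forall i, (i <= (size q).-1)%N -> N A (fun z => f (z + i%:R *: v)) x) ->
    N A (shift_op q v f) (C * x).
Proof.
(* [nle_lincomb] wants at least one term; for [q = 0] it has coefficient 0. *)
have [C C0 HC] := nle_lincomb (fun i : 'I_(size q).-1.+1 => q`_i).
exists C => // N A v f x Hf.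
have H := HC N A (fun i z => f (z + i%:R *: v)) x (fun i => Hf i (ltn_ord i)).
by apply: nle_ext H => z _; rewrite (@shift_op_widen _ (size q).-1.+1) // leqSpred.
Qed.

(* From (X^m - 1)^k = m^k (X - 1)^k + q (X - 1)^(k+1): the left-hand side is bounded
   by [f] alone, so that dividing by m^k leaves a small multiple of [f]. *)
Lemma marchaud_forward k : (0 < k)%N -> exists2 c, 0 <= c &
  forall m, (1 < m)%N -> exists2 C, 0 <= C & forall N A v f x w,
    (forall j, (j <= k)%N -> N A (fun z => f (z + (j * m)%:R *: v)) x) ->
    (forall i, (i + k.+1 <= k * m)%N ->
       N A (fun z => fdiff k.+1 v f (z + i%:R *: v)) w) ->
    N A (fdiff k v f) (m%:R `^ (- e) * c * x + C * w).
Proof.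
move=> k0; have [c1 c10 Hc1] := nle_shift_op (('X - 1) ^+ k).
exists (2 `^ e * c1); first by rewrite mulr_ge0 ?powR_ge0.
move=> m m1; have [q [Hq szq]] := powXB1 (R := R) k m.
have [c2 c20 Hc2] := nle_shift_op q.
exists (2 `^ e * (c2)); first by rewrite mulr_ge0 ?powR_ge0.
have m0 : (0 < m)%N by exact: ltn_trans m1.
move=> N A v f x w Hx Hw.
have mk0 : (m%:R ^+ k : R) != 0 by rewrite expf_neq0 // pnatr_eq0 -lt0n.
(* m^k >= m because k >= 1, so the gain is at least m^-e whatever [k]. *)
have mk1 : `|(m%:R ^+ k)^-1| `^ e <= (m%:R : R) `^ (- e).
  have -> : (m%:R : R) `^ (- e) = (m%:R^-1) `^ e.
    by rewrite -powR_inv1 // -powRrM mulN1r.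
  rewrite ge0_ler_powR ?nnegrE ?invr_ge0 ?ler0n ?(ltW e0) //.
  rewrite normfV lef_pV2 ?posrE ?normr_gt0 ?ltr0n //.
  by rewrite ger0_norm ?exprn_ge0 // ler_eXnr // ler1n.
have Hj j : (j <= (size (('X - 1 : {poly R}) ^+ k)).-1)%N -> (j <= k)%N.
  by rewrite -polyC1 size_exp_XsubC.
(* From size q <= k (m - 1). For [q = 0] the index i = 0 is still present, and k + 1 <= k m holds
   because m > 1. *)
have Hi i : (i <= (size q).-1)%N -> (i + k.+1 <= k * m)%N.
  move=> iq; have := szq m0 k0; have : (m = m.-1.+1)%N by rewrite prednK.
  move: (m.-1) => n mn; have : (0 < n)%N by lia.
  by rewrite mn mulnS; have := leq_mul k0 (leqnn n); nia.
have H1 := Hc1 N A (m%:R *: v) f x.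
have {}H1 := H1 (fun j hj => nle_ext _ (Hx j (Hj j hj))).
have {}H1 : N A (shift_op (('X - 1) ^+ k) (m%:R *: v) f) (c1 * x).
  by apply: H1 => j z _; rewrite scalerA -natrM.
have H2 := Hc2 N A v _ w (fun i hi => Hw i (Hi i hi)).
have H3 := nle_scale (- (m%:R ^+ k)^-1) H2.
have H4 := nle_add (nle_scale (m%:R ^+ k)^-1 H1) H3.
have x0 : 0 <= x := nle_ge0 (Hx 0%N (leq0n _)).
have w0 : 0 <= w by apply: (nle_ge0 (Hw 0%N _)); apply: (Hi 0%N).
apply: nle_ext (nle_weak _ H4).
  move=> z _; rewrite -shift_op_comp_Xn Hq shift_opD shift_opZ !shift_op_fdiff.
  have -> : shift_op (q * ('X - 1) ^+ k.+1) v f z = shift_op q v (fdiff k.+1 v f) z.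
    rewrite shift_opM; congr (shift_op _ _ _ z).
    by apply/funext => y; rewrite shift_op_fdiff.
  by field.
rewrite normrN.
have -> : m%:R `^ (- e) * (2 `^ e * c1) * x + 2 `^ e * c2 * w =
  2 `^ e * (m%:R `^ (- e) * (c1 * x) + 1 * (c2 * w)) by ring.
rewrite ler_wpM2l ?powR_ge0 // lerD // ler_wpM2r ?mulr_ge0 // (le_trans mk1) //.
have m1R : 1 <= m%:R :> R by rewrite ler1n.
by have := ler_powR m1R (_ : - e <= 0); rewrite powRr0; apply; rewrite oppr_le0 ltW.
Qed.

Lemma powRN_small (c delta : R) : 0 <= c -> 0 < delta ->
  exists2 m, (1 < m)%N & m%:R `^ (- e) * c <= delta.
Proof.
move=> c0 d0; pose b := ((c + 1) / delta) `^ e^-1.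
have b0 : 0 <= b by exact: powR_ge0.
exists (Num.truncn b).+2 => //.
rewrite powRN mulrC ler_pdivrMr ?powR_gt0 ?ltr0n //.
have h : (c + 1) / delta <= (Num.truncn b).+2%:R `^ e.
  have -> : (c + 1) / delta = b `^ e.
    by rewrite /b -powRrM mulVf ?gt_eqF // powRr1 // divr_ge0 ?addr_ge0 // ltW.
  rewrite ge0_ler_powR ?nnegrE ?(ltW e0) //.
  by rewrite (le_trans (ltW (truncnS_gt _))) // ler_nat.
by move: h; rewrite ler_pdivrMr // mulrC; lra.
Qed.

(** [marchaud_forward] needs room for k m steps of length u. Near the far side of the square that
    room lies backwards, which is why the step -u appears among the hypotheses. *)
Lemma marchaud k (delta : R) : (0 < k)%N -> 0 < delta ->
  exists2 t, 0 < t & exists2 C, 0 <= C & forall N f x w d u, `|u| <= t ->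
    N usq f x ->
    N (diff_domain usq k.+1 (vec d u)) (fdiff k.+1 (vec d u) f) w ->
    N (diff_domain usq k.+1 (vec d (- u))) (fdiff k.+1 (vec d (- u)) f) w ->
    N (diff_domain usq k (vec d u)) (fdiff k (vec d u) f) (delta * x + C * w).
Proof.
move=> k0 d0; have [c c0 Hc] := marchaud_forward k0.
have d20 : 0 < delta / 2 by rewrite divr_gt0.
have [m m1 mc] := powRN_small c0 d20.
have [C C0 HC] := Hc m m1.
have m0 : (0 < m)%N by exact: ltn_trans m1.
(* k m steps then cover at most half of the square, so from every admissible point the forward or
   the backward walk stays inside. *)
exists ((2 * (k * m)%:R)^-1).
  by rewrite invr_gt0 mulr_gt0 // ltr0n muln_gt0 k0.
exists (2 * C); first by rewrite mulr_ge0.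
move=> N f x w d u ut Hx Hw Hw'.
pose A1 v := [set z | usq z /\ usq (z + (k * m)%:R *: vec d v)] : set (plane R).
have mA1 v : measurable (A1 v : set (mplane R)).
  apply: measurableI; first exact: measurable_usq.
  exact: (measurable_shift_set _ measurable_usq).
have fwd v : N (diff_domain usq k.+1 (vec d v)) (fdiff k.+1 (vec d v) f) w ->
    N (A1 v) (fdiff k (vec d v) f) (delta / 2 * x + C * w).
  move=> H; have x0 := nle_ge0 Hx; have w0 := nle_ge0 H.
  apply: nle_weak (HC N (A1 v) (vec d v) f x w _ _).
  - by rewrite lerD2r ler_wpM2r.
  - move=> j jk; apply: nle_sub (nle_shift ((j * m)%:R *: vec d v) Hx) => //.
    by move=> z [z1 z2]; apply: (usq_seg z1 z2); rewrite leq_mul2r jk orbT.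
  - move=> i ik; apply: nle_sub (nle_shift (i%:R *: vec d v) H) => //.
    move=> z [z1 z2] j jk; rewrite -addrA -scalerDl -natrD.
    by apply: (usq_seg z1 z2); rewrite (leq_trans _ ik) // leq_add2l.
(* The backward walk starts at the other end z + k u; [fdiff_opp] turns its difference into the
   forward one. *)
have H2 := nle_scale ((-1) ^+ k) (nle_shift (k%:R *: vec d u) (fwd _ Hw')).
rewrite normrX normrN1 expr1n powR1 mul1r in H2.
have {}H2 : N (shift_set (k%:R *: vec d u) (A1 (- u))) (fdiff k (vec d u) f) (delta / 2 * x + C * w).
  by apply: nle_ext H2 => z _; rewrite [RHS]fdiff_opp vecN.
have := nle_union (fwd _ Hw) H2.
have -> : delta / 2 * x + C * w + (delta / 2 * x + C * w) = delta * x + 2 * C * w by field.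
apply: nle_sub; first exact: measurable_diff_domain measurable_usq.
move=> z Uz; have Uz0 := Uz 0%N (leq0n _); have Uzk := Uz k (leqnn _).
rewrite scale0r addr0 in Uz0.
have km0 : 0 < (k * m)%:R :> R by rewrite ltr0n muln_gt0 k0.
have {}ut : `|u| * (k * m)%:R <= 2^-1.
  by move: ut; rewrite invfM -ler_pdivlMr.
have kkm : k%:R <= (k * m)%:R :> R by rewrite ler_nat leq_pmulr.
have k0' : 0 <= k%:R :> R by [].
rewrite vecZ (usq_vec _ _ Uz0) in Uzk.
suff [h|h] : 0 <= coord d z + (k * m)%:R * u < 1 \/
             0 <= coord d z + (k%:R - (k * m)%:R) * u < 1.
- by left; split => //; rewrite vecZ (usq_vec _ _ Uz0).
- right; split; first by rewrite vecZ (usq_vec _ _ Uz0).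
  rewrite -addrA !vecZ; have -> : vec d (k%:R * u) + vec d ((k * m)%:R * - u) =
      vec d ((k%:R - (k * m)%:R) * u).
    by rewrite -!vecZ -vecN scalerN -scalerBl.
  by rewrite (usq_vec _ _ Uz0).
move: (usqE d z).1 => /(_ Uz0)[cz _].
move: Uzk ut km0 kkm k0'; move: (coord d z) cz => c' /andP[c0' c1'].
move: (k%:R : R) ((k * m)%:R : R) => a b /andP[a0 a1] + b0 ab a0'.
have [u0|u0] := leP 0 u; rewrite ?(ger0_norm u0) ?(ltr0_norm u0) => ub.
  by have [h|h] := ltP (c' + b * u) 1; [left|right]; apply/andP; split; nra.
by have [h|h] := leP 0 (c' + b * u); [left|right]; apply/andP; split; nra.
Qed.

Lemma marchaud_iter n k (delta : R) : (0 < k)%N -> 0 < delta ->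
  exists2 t, 0 < t & exists2 C, 0 <= C & forall N f x d u, `|u| <= t ->
    N usq f x ->
    N (diff_domain usq (k + n) (vec d u)) (fdiff (k + n) (vec d u) f) 1 ->
    N (diff_domain usq (k + n) (vec d (- u))) (fdiff (k + n) (vec d (- u)) f) 1 ->
    N (diff_domain usq k (vec d u)) (fdiff k (vec d u) f) (delta * x + C).
Proof.
elim: n k delta => [|n IH] k delta k0 d0.
  exists 1 => //; exists 1 => // N f x d u ut Hx; rewrite addn0 => + _.
  by apply: nle_weak; rewrite lerDr mulr_ge0 ?(ltW d0) ?(nle_ge0 Hx).
have d20 : 0 < delta / 2 by rewrite divr_gt0.
have [t t0 [C C0 HC]] := marchaud k0 d20.
(* The recursive bound gets multiplied by [C]; dividing by C + 1 keeps the total coefficient of [f]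
   below [delta]. *)
have d'0 : 0 < delta / 2 / (C + 1) by rewrite divr_gt0 // ltr_wpDl.
have [t' t'0 [C' C'0 HC']] := IH k.+1 _ (ltn0Sn k) d'0.
exists (Num.min t t'); first by rewrite lt_min t0.
exists (C * C'); first by rewrite mulr_ge0.
move=> N f x d u; rewrite le_min => /andP[ut ut'] Hx; rewrite -addSnnS => H1 H2.
apply: nle_weak (HC N f x (delta / 2 / (C + 1) * x + C') d u ut Hx _ _).
- have x0 := nle_ge0 Hx.
  rewrite mulrDr addrA lerD2r.
  have -> : delta * x = delta / 2 * x + delta / 2 * x by field.
  rewrite lerD2l mulrA ler_wpM2r // mulrCA ler_piMr ?(ltW d20) //.
  by rewrite ler_pdivrMr ?ltr_wpDl // mul1r lerDl.
- exact: HC'.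
- by apply: HC' => //; rewrite ?normrN ?opprK.
Qed.

End marchaud.

Section small_translations.
Context {R : realType} {e : R}.
Hypothesis e0 : 0 < e.

(** Marchaud's inequality descends from order r to order 1 along each axis, and a translation by [u]
    is two axis moves. *)
Lemma small_translation r (delta : R) : (0 < r)%N -> 0 < delta ->
  exists2 t, 0 < t & exists2 C, 0 <= C & forall (N : gauge e) f x,
    N usq f x ->
    (forall d u, N (diff_domain usq r (vec d u)) (fdiff r (vec d u) f) 1) ->
    forall u : plane R, `|u.1| <= t -> `|u.2| <= t ->
    N (usq `&` shift_set u usq) (fun z => f (z + u) - f z) (delta * x + C).
Proof.
(* 2 is the number of axis moves and 2^e the cost of adding them. *)
move=> r0 d0; have d'0 : 0 < delta / 2 / 2 `^ e by rewrite !divr_gt0 // powR_gt0.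
have [t t0 [C C0 HC]] := marchaud_iter e0 r.-1 (ltnSn 0) d'0.
exists t => //; exists (2 `^ e * (2 * C)); first by rewrite !mulr_ge0 ?powR_ge0.
move=> N f x Hx Hr u u1 u2; rewrite add1n prednK // in HC.
have H1 := HC N f x false _ u1 Hx (Hr _ _) (Hr _ _).
have H2 := HC N f x true _ u2 Hx (Hr _ _) (Hr _ _).
have mA : measurable (usq `&` shift_set u usq : set (mplane R)).
  apply: measurableI; first exact: measurable_usq.
  exact: (measurable_shift_set _ measurable_usq).
have fE v z : fdiff 1 v f z = f (z + v) - f z.
  rewrite /fdiff big_ord_recr big_ord1 /= scale0r scale1r addr0 !bin0 binn.
  by rewrite addn0 expr1 sqrrN expr1n !mulr1 mulN1r mul1r addrC.
have uE : u = vec false u.1 + vec true u.2.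
  by rewrite [LHS]surjective_pairing [RHS]surjective_pairing /= addr0 add0r.
(* The corner of the path takes its first coordinate from z + u and its second from z. *)
have Hz z : (usq `&` shift_set u usq) z -> usq (z + vec false u.1).
  move=> [z1 z2]; apply/(usq_vec _ _ z1).
  by case: z2 => /= [+ _]; rewrite /coord.
have {}H1 := nle_sub mA _ H1.
have {}H2 := nle_sub mA _ (nle_shift (vec false u.1) H2).
apply: nle_ext (nle_weak _ (nle_add (H1 _) (H2 _))).
- move=> z _; have uz : z + vec false u.1 + vec true u.2 = z + u by rewrite -addrA -uE.
  rewrite !fE uz.
  by move: (f (z + u)) (f z) (f (z + vec false u.1)) => p q s; ring.
- rewrite le_eqVlt; apply/orP; left; apply/eqP; field.
  by rewrite gt_eqF ?powR_gt0.
- move=> z zA [|[|//]] _; first by rewrite scale0r addr0; case: zA.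
  by rewrite scale1r; apply: Hz.
- move=> z zA [|[|//]] _ /=; first by rewrite scale0r addr0; apply: Hz.
  by rewrite /shift_set /= scale1r -addrA -uE; case: zA.
Qed.

End small_translations.

(** * Tensor product interpolation *)

Section tensor_polynomials.
Context {R : realType}.

(** Degree below [r] in each variable separately, as [dir_poly] asks along the coordinate axes. With
    a list of products, addition is concatenation. *)
Definition tensor_poly (r : nat) (Q : plane R -> R) :=
  exists2 s : seq ({poly R} * {poly R}),
    all (fun p : {poly R} * {poly R} => (size p.1 <= r)%N && (size p.2 <= r)%N) s &
    forall x, Q x = \sum_(p <- s) p.1.[x.1] * p.2.[x.2].

Lemma tensor_poly0 r : tensor_poly r (fun=> 0).
Proof. by exists [::] => // x; rewrite big_nil. Qed.

Lemma tensor_polyD r P Q : tensor_poly r P -> tensor_poly r Q ->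
  tensor_poly r (fun x => P x + Q x).
Proof.
move=> [s Hs HP] [t Ht HQ]; exists (s ++ t); first by rewrite all_cat Hs.
by move=> x; rewrite big_cat HP HQ.
Qed.

Lemma measurable_horner (p : {poly R}) : measurable_fun setT (horner p).
Proof.
elim/poly_ind: p => [|p c IH].
  have -> : horner 0 = cst (0 : R) by apply/funext => x; rewrite horner0.
  exact: measurable_cst.
have -> : horner (p * 'X + c%:P) = (fun x => p.[x] * x + c).
  by apply/funext => x; rewrite hornerMXaddC.
by apply: measurable_funD => //; apply: measurable_funM.
Qed.

Lemma measurable_tensor_poly r Q : tensor_poly r Q ->
  measurable_fun setT (Q : mplane R -> R).
Proof.
move=> [s _ HQ]; rewrite (funext HQ).
apply: measurable_sum => p; apply: measurable_funM.
  by apply: (measurableT_comp (measurable_horner _)); exact: measurable_fst.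
by apply: (measurableT_comp (measurable_horner _)); exact: measurable_snd.
Qed.

(** p(x + u) and p(x) have the same leading term, so one degree is lost. *)
Lemma size_diff_poly (p : {poly R}) u r : (size p <= r.+1)%N ->
  exists2 q : {poly R}, (size q <= r)%N & forall x, p.[x + u] - p.[x] = q.[x].
Proof.
move=> sp; exists (p \Po ('X + u%:P) - p); last first.
  by move=> x; rewrite !hornerE horner_comp !hornerE.
have [->|p0] := eqVneq p 0; first by rewrite comp_poly0 subr0 size_poly0.
have sX : size ('X + u%:P) = 2%N by rewrite size_XaddC.
have sc : size (p \Po ('X + u%:P)) = size p by rewrite size_comp_poly2.
have lc : lead_coef (p \Po ('X + u%:P)) = lead_coef p.
  by rewrite lead_coef_comp ?sX // lead_coefXaddC expr1n mulr1.
have sp0 : (0 < size p)%N by rewrite size_poly_gt0.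
suff h : (size (p \Po ('X + u%:P) - p)%R <= (size p).-1)%N.
  by rewrite (leq_trans h) // -ltnS prednK.
apply/leq_sizeP => j; rewrite leq_eqVlt coefB => /predU1P[<-|].
  by move: lc; rewrite !lead_coefE sc => ->; rewrite subrr.
by rewrite prednK // => pj; rewrite !nth_default ?sc // subrr.
Qed.

Lemma fdiff_horner r d u (p : {poly R}) x : (size p <= r)%N ->
  fdiff r (vec d u) (fun z => p.[coord d z]) x = 0.
Proof.
elim: r p x => [|r IH] p x sp.
  have -> : p = 0 by apply/eqP; rewrite -size_poly_eq0 -leqn0.
  by rewrite /fdiff big1 // => i _; rewrite horner0 mulr0.
have [q sq Hq] := size_diff_poly u sp.
rewrite -shift_op_fdiff exprSr shift_opM shift_op_fdiff -[RHS](IH q x sq).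
rewrite /fdiff; apply: eq_bigr => i _; congr (_ * _).
rewrite -Hq shift_opD -{1}['X]expr1 shift_opXn scale1r coord_vec.
by rewrite -[- 1]/(- (1%:P)) shift_opN shift_opC mul1r.
Qed.

(** Along an axis one factor of each product varies, and r differences annihilate it. Hence
    subtracting a [tensor_poly] preserves every hypothesis on r-th differences. *)
Lemma fdiff_tensor_poly r d u Q x : tensor_poly r Q -> fdiff r (vec d u) Q x = 0.
Proof.
move=> [s /allP Hs HQ]; rewrite /fdiff; under eq_bigr do rewrite HQ mulr_sumr.
rewrite exchange_big big1_seq //= => p /Hs /andP[s1 s2].
case: d.
  transitivity (p.1.[x.1] * fdiff r (vec true u) (fun z => p.2.[coord true z]) x).
    by rewrite mulr_sumr; apply: eq_bigr => i _; rewrite /coord /vec /= scaler0 addr0; ring.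
  by rewrite fdiff_horner // mulr0.
transitivity (p.2.[x.2] * fdiff r (vec false u) (fun z => p.1.[coord false z]) x).
  by rewrite mulr_sumr; apply: eq_bigr => i _; rewrite /coord /vec /= scaler0 addr0; ring.
by rewrite fdiff_horner // mulr0.
Qed.

Lemma horner_bounded (p : {poly R}) (M : R) : exists2 C, 0 <= C &
  forall x, `|x| <= M -> `|p.[x]| <= C.
Proof.
exists (\sum_(i < size p) `|p`_i| * `|M| ^+ i).
  by apply: sumr_ge0 => i _; rewrite mulr_ge0 ?exprn_ge0.
move=> x xM; rewrite horner_coef (le_trans (ler_norm_sum _ _ _)) //.
apply: ler_sum => i _; rewrite normrM ler_wpM2l // normrX lerXn2r ?nnegrE //.
by rewrite (le_trans xM) // ler_norm.
Qed.

Lemma horner_family_bounded n (p : 'I_n -> {poly R}) (M : R) : exists2 C, 0 <= C &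
  forall i x, `|x| <= M -> `|(p i).[x]| <= C.
Proof.
have h i := cid2 (horner_bounded (p i) M).
exists (\sum_i s2val (h i)) => [|i x xM].
  by apply: sumr_ge0 => i _; case: (h i).
rewrite (le_trans (s2valP' (h i) x xM)) // (bigD1 i) //= lerDl.
by apply: sumr_ge0 => j _; case: (h j).
Qed.

Lemma horner_affine (p : {poly R}) (a b : R) : exists2 q : {poly R},
  (size q <= size p)%N & forall x, q.[x] = p.[a * x + b].
Proof.
exists (p \Po (a *: 'X + b%:P)); last by move=> x; rewrite horner_comp !hornerE.
have [->|p0] := eqVneq p 0; first by rewrite comp_poly0.
have sp0 : (0 < size p)%N by rewrite size_poly_gt0.
apply: (leq_trans (size_comp_poly_leq _ _)).
rewrite -[X in (_ <= X)%N](prednK sp0) ltnS -[X in (_ <= X)%N]muln1 leq_mul2l; apply/orP; right.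
have : (size (a *: 'X + b%:P)%R <= 2)%N.
  rewrite (leq_trans (size_polyD _ _)) // geq_max (leq_trans (size_scale_leq _ _)) ?size_polyX //.
  by rewrite (leq_trans (size_polyC_leq1 _)).
by case: size.
Qed.

(** The nodes are the integers 0, ..., r-1. Grids of spacing 1/K arise by an affine substitution, so
    one bound on the basis serves every [K]. *)
Lemma lagrange_basis r : (0 < r)%N -> exists l : 'I_r -> {poly R},
  [/\ forall i, (size (l i) <= r)%N,
      forall i j : 'I_r, (l i).[j%:R] = (i == j)%:R &
      forall p : {poly R}, (size p <= r)%N ->
        forall x, p.[x] = \sum_(i < r) p.[i%:R] * (l i).[x]].
Proof.
move=> r0; pose x (n : nat) : R := n%:R.
have xI : injective x by move=> m n /eqP; rewrite eqr_nat => /eqP.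
exists (fun i => tnth (qpoly.lagrange r x) i); split.
- by move=> i; rewrite qpoly.size_lagrange_.
- by move=> i j; rewrite (qpoly.lagrange_sample r0 xI).
- move=> p sp z; rewrite {1}(qpoly.lagrange_gen r0 xI sp) horner_sum.
  by apply: eq_bigr => i _; rewrite hornerM hornerC.
Qed.

Lemma tensor_poly1 r (p q : {poly R}) : (size p <= r)%N -> (size q <= r)%N ->
  tensor_poly r (fun x => p.[x.1] * q.[x.2]).
Proof.
move=> sp sq; exists [:: (p, q)]; first by rewrite /= sp sq.
by move=> x; rewrite big_seq1.
Qed.

Lemma tensor_poly_sum r n (F : 'I_n -> plane R -> R) :
  (forall i, tensor_poly r (F i)) -> tensor_poly r (fun x => \sum_i F i x).
Proof.
elim: n F => [|n IH] F HF.
  by have [s Hs HQ] := tensor_poly0 r; exists s => // x; rewrite big_ord0 -HQ.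
have [s Hs HQ] := tensor_polyD (HF ord0) (IH _ (fun i => HF (lift ord0 i))).
by exists s => // x; rewrite big_ord_recl -HQ.
Qed.

Definition grid (K i j : nat) : plane R := (i%:R / K%:R, j%:R / K%:R).

(** The grid may start at any corner [b]: the polynomial can be read off from nodes close to [z]
    instead of those at which it was constructed. *)
Lemma tensor_poly_lagrange r (l : 'I_r -> {poly R}) K (b : plane R) Q z :
  (forall p : {poly R}, (size p <= r)%N ->
     forall x, p.[x] = \sum_(i < r) p.[i%:R] * (l i).[x]) ->
  (0 < K)%N -> tensor_poly r Q ->
  Q z = \sum_(i < r) \sum_(j < r)
    (l i).[(z.1 - b.1) * K%:R] * (l j).[(z.2 - b.2) * K%:R] * Q (b + grid K i j).
Proof.
move=> Hl K0 [s /allP Hs HQ]; rewrite HQ.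
transitivity (\sum_(p <- s) \sum_(i < r) \sum_(j < r)
    (l i).[(z.1 - b.1) * K%:R] * (l j).[(z.2 - b.2) * K%:R] *
    (p.1.[(b + grid K i j).1] * p.2.[(b + grid K i j).2])); last first.
  rewrite exchange_big; apply: eq_bigr => i _.
  by rewrite exchange_big; apply: eq_bigr => j _; rewrite HQ mulr_sumr.
rewrite !big_seq; apply: eq_bigr => p /Hs /andP[s1 s2].
have aux (q : {poly R}) (a w : R) : (size q <= r)%N ->
    q.[w] = \sum_i (l i).[(w - a) * K%:R] * q.[a + i%:R / K%:R].
  move=> sq; have [q' sq' Hq'] := horner_affine q K%:R^-1 a.
  have -> : q.[w] = q'.[(w - a) * K%:R].
    by rewrite Hq'; congr horner; field; rewrite pnatr_eq0 -lt0n.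
  rewrite (Hl q' (leq_trans sq' sq)); apply: eq_bigr => i _.
  by rewrite Hq' mulrC [a + _]addrC [_^-1 * _]mulrC.
rewrite (aux _ b.1 z.1 s1) (aux _ b.2 z.2 s2) mulr_suml; apply: eq_bigr => i _.
by rewrite mulr_sumr; apply: eq_bigr => j _; rewrite /=; ring.
Qed.

End tensor_polynomials.

(** * Growth of functions on a grid and error of the interpolant *)

Section interpolation_error.
Context {R : realType}.

(* Divide X^k by (X - 1)^r and apply quotient and remainder to [f]. *)
Lemma grid_bound1 r k : exists2 c : R, 0 <= c & forall f (v y : plane R) S1 S2,
  0 <= S1 -> 0 <= S2 ->
  (forall i, (i + r <= k)%N -> `|fdiff r v f (y + i%:R *: v)| <= S1) ->
  (forall i, (i < r)%N -> `|f (y + i%:R *: v)| <= S2) ->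
  `|f (y + k%:R *: v)| <= c * (S1 + S2).
Proof.
have [q [rem [srem [sq Xk]]]] := shift_expn_modXB1 (R := R) r k.
exists (\sum_(i < size q) `|q`_i| + \sum_(i < size rem) `|rem`_i|).
  by rewrite addr_ge0 // sumr_ge0.
move=> f v y S1 S2 S10 S20 H1 H2; rewrite -shift_opXn Xk shift_opD shift_opM.
have -> : shift_op q v (shift_op (('X - 1) ^+ r) v f) y = shift_op q v (fdiff r v f) y.
  by congr (shift_op _ _ _ y); apply/funext => z; rewrite shift_op_fdiff.
rewrite (le_trans (ler_normD _ _)) // mulrDl lerD //.
  rewrite (le_trans (ler_norm_sum _ _ _)) // mulr_suml; apply: ler_sum => i _.
  rewrite normrM ler_wpM2l // (le_trans (H1 i _)) ?lerDl //.
  by have := ltn_ord i; have := leq_trans (ltn_ord i) sq; lia.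
rewrite (le_trans (ler_norm_sum _ _ _)) // mulr_suml; apply: ler_sum => i _.
rewrite normrM ler_wpM2l // (le_trans (H2 i _)) ?lerDr //.
exact: leq_trans (ltn_ord i) srem.
Qed.

Lemma grid_bound r K : exists2 c : R, 0 <= c &
  forall k, (k < K)%N -> forall f (v y : plane R) S1 S2,
  0 <= S1 -> 0 <= S2 ->
  (forall i, (i + r < K)%N -> `|fdiff r v f (y + i%:R *: v)| <= S1) ->
  (forall i, (i < r)%N -> `|f (y + i%:R *: v)| <= S2) ->
  `|f (y + k%:R *: v)| <= c * (S1 + S2).
Proof.
have h k := cid2 (grid_bound1 r k).
exists (\sum_(k < K) s2val (h k)).
  by apply: sumr_ge0 => k _; case: (h k).
move=> k kK f v y S1 S2 S10 S20 H1 H2.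
have H := s2valP' (h k) f v y S1 S2 S10 S20 (fun i hi => H1 i (leq_ltn_trans hi kK)) H2.
rewrite (le_trans H) // ler_wpM2r ?addr_ge0 //.
rewrite (bigD1 (Ordinal kK)) //= lerDl.
by apply: sumr_ge0 => j _; case: (h j).
Qed.

(** With M the largest of the n terms, (n M)^e = n^e M^e and M^e is one of the summands. This covers
    e < 1 and e >= 1 alike. *)
Lemma powR_sum (e : R) (T : finType) (a : T -> R) : 0 < e -> (forall t, 0 <= a t) ->
  (\sum_t a t) `^ e <= #|T|%:R `^ e * \sum_t (a t) `^ e.
Proof.
move=> e0 a0.
case: (pickP (fun _ : T => true)) => [t0 _|T0]; last first.
  by rewrite !big1 ?mulr0 ?powR0 ?gt_eqF // => t; have := T0 t.
pose M := a [arg max_(t > t0) a t]%O.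
have aM t : a t <= M by rewrite /M; case: arg_maxP => // s _ /(_ t); apply.
rewrite (@le_trans _ _ ((#|T|%:R * M) `^ e)) //.
  rewrite ge0_ler_powR ?nnegrE ?sumr_ge0 ?mulr_ge0 ?(ltW e0) ?a0 //.
  by rewrite mulr_natl -sumr_const; apply: ler_sum => t _; exact: aM.
rewrite powRM ?a0 // ler_wpM2l ?powR_ge0 //.
by rewrite /M (bigD1 [arg max_(t > t0) a t]%O) //= lerDl sumr_ge0 // => t _; rewrite powR_ge0.
Qed.

Lemma powR_addn (e x y : R) : 0 < e -> 0 <= x -> 0 <= y ->
  (x + y) `^ e <= 2 `^ e * (x `^ e + y `^ e).
Proof.
move=> e0 x0 y0; have := @powR_sum e bool (fun b => if b then x else y) e0.
by rewrite !big_bool card_bool; apply; case.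
Qed.

End interpolation_error.

Section interpolation.
Context {R : realType}.

(** [t] holds the axis, the starting index along it and the transversal index; the range K - r keeps
    all r + 1 points among the K points of a line of the grid. *)
Definition grid_fdiff r K (f : plane R -> R) (t : bool * 'I_(K - r) * 'I_K) (y : plane R) : R :=
  fdiff r (vec t.1.1 K%:R^-1) f
    (y + vec t.1.1 (t.1.2%:R / K%:R) + vec (~~ t.1.1) (t.2%:R / K%:R)).

(* The interpolation nodes attached to the cell of index [k] stay within the grid. *)
Definition node r K k i := (minn k (K - r) + i)%N.

Lemma node_lt r K k i : (r <= K)%N -> (i < r)%N -> (node r K k i < K)%N.
Proof. by rewrite /node; lia. Qed.

Lemma node_near r K k i : (r <= K)%N -> (k < K)%N -> (i < r)%N ->
  [/\ node r K k i < K, k <= node r K k i + r & node r K k i <= k + r]%N.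
Proof. by rewrite /node => rK kK ir; split; lia. Qed.

Lemma gridD K i j i' j' : grid K i j + grid K i' j' = grid K (i + i') (j + j') :> plane R.
Proof. by rewrite [LHS]surjective_pairing /grid /= !natrD !mulrDl. Qed.

Lemma vec_grid K i d : i%:R *: vec d K%:R^-1 = (if d then grid K 0 i else grid K i 0) :> plane R.
Proof. by rewrite vecZ; case: d; rewrite /vec /grid mul0r. Qed.

(** The nodes form an r by r block at one corner of the grid; over the rest of the grid the
    interpolant extrapolates, at a cost depending on [K]. *)
Lemma interpolant_exists r K (f : plane R -> R) (y : plane R) (l : 'I_r -> {poly R}) :
  (0 < K)%N -> (forall i, size (l i) <= r)%N ->
  (forall i j : 'I_r, (l i).[j%:R] = (i == j)%:R) ->
  exists2 L, tensor_poly r L &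
    forall i j, (i < r)%N -> (j < r)%N -> L (y + grid K i j) = f (y + grid K i j).
Proof.
move=> K0 sl lE.
have K0' : K%:R != 0 :> R by rewrite pnatr_eq0 -lt0n.
pose L z := \sum_(i < r) \sum_(j < r) f (y + grid K i j) *
   ((l i).[K%:R * z.1 + - (K%:R * y.1)] * (l j).[K%:R * z.2 + - (K%:R * y.2)]).
exists L.
  apply: tensor_poly_sum => i; apply: tensor_poly_sum => j.
  have [p sp Hp] := horner_affine (l i) K%:R (- (K%:R * y.1)).
  have [q sq Hq] := horner_affine (l j) K%:R (- (K%:R * y.2)).
  have sp' : (size (f (y + grid K i j) *: p)%R <= r)%N.
    by rewrite (leq_trans (size_scale_leq _ _)) // (leq_trans sp).
  have := tensor_poly1 sp' (leq_trans sq (sl j)); congr tensor_poly.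
  by apply/funext => z; rewrite hornerZ Hp Hq mulrA.
move=> i j ir jr; rewrite /L (bigD1 (Ordinal ir)) //= (bigD1 (Ordinal jr)) //=.
have cancel (a : R) n : K%:R * (a + n%:R / K%:R) + - (K%:R * a) = n%:R by field.
rewrite !cancel (lE _ (Ordinal ir)) (lE _ (Ordinal jr)) !eqxx !mulr1.
rewrite big1 ?addr0 => [|j' j'j].
  rewrite big1 ?addr0 // => i' i'i; apply: big1 => j' _.
  by rewrite (lE _ (Ordinal ir)) (negbTE i'i) mul0r mulr0.
by rewrite (lE _ (Ordinal jr)) (negbTE j'j) !mulr0.
Qed.

(** The error vanishes at the r by r nodes and has the same r-th differences as [f]. Its growth is
    bounded along the first r rows, and then along every column, which starts in these rows. *)
Lemma interpolation_grid_error r K : (r <= K)%N -> exists2 c : R, 0 <= c &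
  forall (f L : plane R -> R) y, tensor_poly r L ->
  (forall i j, (i < r)%N -> (j < r)%N -> L (y + grid K i j) = f (y + grid K i j)) ->
  forall k l, (k < K)%N -> (l < K)%N ->
  `|f (y + grid K k l) - L (y + grid K k l)| <=
    c * \sum_t `|grid_fdiff f (t : _ * 'I_(K - r) * _) y|.
Proof.
move=> rK; have [c c0 Hc] := grid_bound (R := R) r K.
exists (c * (1 + c)); first by rewrite mulr_ge0 ?addr_ge0.
move=> f L y HL Lf k l kK lK.
set S := \sum_t _; have S0 : 0 <= S by apply: sumr_ge0.
pose g z := f z - L z.
have gd d z : fdiff r (vec d K%:R^-1) g z = fdiff r (vec d K%:R^-1) f z.
  by rewrite /g fdiffB (fdiff_tensor_poly _ _ _ HL) subr0.
have GS (d : bool) i j : (i + r < K)%N -> (j < K)%N ->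
    `|fdiff r (vec d K%:R^-1) f (y + vec (~~ d) (j%:R / K%:R) + i%:R *: vec d K%:R^-1)| <= S.
  move=> iK jK; have iK' : (i < K - r)%N by lia.
  rewrite /S (bigD1 (d, Ordinal iK', Ordinal jK)) //= /grid_fdiff /=.
  rewrite vecZ addrAC lerDl; exact: sumr_ge0.
have H1 k' j : (k' < K)%N -> (j < r)%N -> `|g (y + grid K k' j)| <= c * S.
  move=> k'K jr.
  have := Hc k' k'K g (vec false K%:R^-1) (y + grid K 0 j) S 0 S0 (lexx _).
  rewrite addr0 vec_grid -addrA gridD add0n addn0; apply.
    move=> i iK; rewrite gd.
    have -> : grid K 0 j = vec (~~ false) (j%:R / K%:R) :> plane R.
      by rewrite /grid mul0r.
    by apply: GS => //; exact: leq_trans jr rK.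
  move=> i ir; rewrite vec_grid -addrA gridD add0n addn0.
  by rewrite /g Lf // subrr normr0.
have := Hc l lK g (vec true K%:R^-1) (y + grid K k 0) S (c * S) S0 (mulr_ge0 c0 S0).
rewrite vec_grid -addrA gridD add0n addn0 (_ : S + c * S = (1 + c) * S); last by ring.
rewrite mulrA; apply.
  move=> i iK; rewrite gd.
  have -> : grid K k 0 = vec (~~ true) (k%:R / K%:R) :> plane R.
    by rewrite /grid mul0r.
  exact: GS.
by move=> i ir; rewrite vec_grid -addrA gridD add0n addn0; apply: H1.
Qed.

(** The basis sums to 1, so f(z) - L(z) combines the f(z) - L(node) over r^2 nodes close to z.
    Inserting f(node) splits each into an oscillation of [f] and an error on the grid. The bound on
    the basis does not involve [K], hence neither does [a]. *)
Lemma interpolation_pointwise (e : R) r : 0 < e -> (0 < r)%N ->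
  exists2 a : R, 0 <= a & forall K, (r <= K)%N -> exists2 b : R, 0 <= b &
  forall (f : plane R -> R) y, cell K 0 0 y -> exists2 L, tensor_poly r L &
  forall k l z, (k < K)%N -> (l < K)%N -> cell K k l z ->
    `|f z - L z| `^ e <=
      a * (\sum_(i < r) \sum_(j < r)
        `|f (y + grid K (node r K k i) (node r K l j)) - f z| `^ e) +
      b * \sum_t `|grid_fdiff f (t : _ * 'I_(K - r) * _) y| `^ e.
Proof.
move=> e0 r0; have [l [sl lE lL]] := lagrange_basis (R := R) r0.
(* In units of 1/K, [z] is within r + 1 of the corner [b] of its nodes: at most r from clamping the
   index, less than 1 from the position in the cell, the offset [y] counting with the opposite
   sign. *)
have [M M0 HM] := horner_family_bounded l r.+1%:R.
exists ((M * M) `^ e * (2 `^ e * #|{: 'I_r * 'I_r}|%:R `^ e)).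
  by rewrite !mulr_ge0 ?powR_ge0.
move=> K rK; have K0 : (0 < K)%N by exact: leq_trans rK.
have K0' : 0 < K%:R :> R by rewrite ltr0n.
have [c c0 Hc] := interpolation_grid_error rK.
exists ((M * M) `^ e * (2 `^ e * (((r * r)%:R * c) `^ e * #|{: bool * 'I_(K - r) * 'I_K}|%:R `^ e))).
  by rewrite !mulr_ge0 ?powR_ge0.
move=> f y y00; have [L HL Lf] := interpolant_exists f y K0 sl lE.
exists L => // k m z kK mK zkm.
set S := \sum_(i < r) _; set G := \sum_t _.
pose b := y + grid K (minn k (K - r)) (minn m (K - r)).
have bE i j : b + grid K i j = y + grid K (node r K k i) (node r K m j).
  by rewrite /b -addrA gridD.
pose X := \sum_(p : 'I_r * 'I_r) `|f (b + grid K p.1 p.2) - f z|.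
pose Y := \sum_t `|grid_fdiff f (t : _ * 'I_(K - r) * 'I_K) y|.
have X0 : 0 <= X by apply: sumr_ge0.
have Y0 : 0 <= Y by apply: sumr_ge0.
pose th1 := (z.1 - b.1) * K%:R; pose th2 := (z.2 - b.2) * K%:R.
have thb (a s : R) n : (n < K)%N -> n%:R / K%:R <= s < n.+1%:R / K%:R -> 0 <= a < K%:R^-1 ->
    `|(s - (a + (minn n (K - r))%:R / K%:R)) * K%:R| <= r.+1%:R.
  move=> nK; rewrite ler_pdivrMr // ltr_pdivlMr // => /andP[s1 s2].
  rewrite -[X in _ < X]mul1r ltr_pdivlMr // => /andP[a1 a2].
  have {}a1 : 0 <= a * K%:R by rewrite mulr_ge0.
  have -> : (s - (a + (minn n (K - r))%:R / K%:R)) * K%:R =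
      s * K%:R - a * K%:R - (minn n (K - r))%:R by field; rewrite gt_eqF.
  have : (minn n (K - r) <= n)%N by rewrite geq_minl.
  have : (n <= minn n (K - r) + r)%N by move: nK; clear; lia.
  rewrite -!(ler_nat R) natrD; move: s1 s2; rewrite -!natr1 => s1 s2 h1 h2.
  by rewrite ler_norml; apply/andP; split; lra.
have [[z1 z2] [y1 y2]] := (zkm, y00).
rewrite mul0r div1r in y1; rewrite mul0r div1r in y2.
have t1 : `|th1| <= r.+1%:R by apply: thb.
have t2 : `|th2| <= r.+1%:R by apply: thb.
have fL : `|f z - L z| <= M * M * (X + (r * r)%:R * c * Y).
  have one : 1 = \sum_(i < r) \sum_(j < r) (l i).[th1] * (l j).[th2].
    have sz1 : (size (1%R : {poly R}) <= r)%N by rewrite size_poly1.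
    have := tensor_poly_lagrange b z lL K0 (tensor_poly1 sz1 sz1).
    rewrite !hornerC mulr1 => {1}->; apply: eq_bigr => i _; apply: eq_bigr => j _.
    by rewrite !hornerC !mulr1.
  have -> : f z - L z = \sum_(p : 'I_r * 'I_r) (l p.1).[th1] * (l p.2).[th2] *
      (f z - L (b + grid K p.1 p.2)).
    transitivity ((\sum_(i < r) \sum_(j < r) (l i).[th1] * (l j).[th2]) * f z - L z).
      by rewrite -one mul1r.
    rewrite (tensor_poly_lagrange b z lL K0 HL) mulr_suml -sumrB.
    rewrite -(pair_bigA _ (fun i j => (l i).[th1] * (l j).[th2] * (f z - L (b + grid K i j)))) /=.
    apply: eq_bigr => i _; rewrite mulr_suml -sumrB; apply: eq_bigr => j _.
    by rewrite mulrBr.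
  rewrite (le_trans (ler_norm_sum _ _ _)) // mulrDr [M * M * X]mulr_sumr.
  have -> : M * M * ((r * r)%:R * c * Y) = \sum_(p : 'I_r * 'I_r) M * M * (c * Y).
    by rewrite sumr_const card_prod card_ord -mulr_natl; ring.
  rewrite -big_split /=; apply: ler_sum => p _; rewrite -mulrDr !normrM.
  apply: ler_pM => //; first by apply: ler_pM => //; apply: HM.
  rewrite bE (le_trans (ler_distD (f (y + grid K (node r K k p.1) (node r K m p.2))) _ _)) //.
  rewrite lerD //; first by rewrite distrC.
  by apply: Hc => //; apply: node_lt.
rewrite (le_trans (ge0_ler_powR (ltW e0) _ _ fL)) ?nnegrE //.
  by rewrite !mulr_ge0 ?addr_ge0 ?mulr_ge0.
set c' := (r * r)%:R * c; have c'0 : 0 <= c' by rewrite mulr_ge0.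
set n1 := #|_|%:R `^ e; set n2 := #|_|%:R `^ e.
have h3 : X `^ e <= n1 * S.
  rewrite /S (pair_bigA _ (fun i j : 'I_r => `|f (y + grid K (node r K k i) (node r K m j)) - f z| `^ e)) /=.
  rewrite (le_trans (powR_sum e0 _)) // ler_wpM2l ?powR_ge0 //.
  by apply: ler_sum => p _; rewrite bE.
have h4 : (c' * Y) `^ e <= c' `^ e * (n2 * G).
  by rewrite powRM // ler_wpM2l ?powR_ge0 //; exact: powR_sum.
have h2 : (X + c' * Y) `^ e <= 2 `^ e * (n1 * S + c' `^ e * (n2 * G)).
  rewrite (le_trans (powR_addn e0 X0 _)) ?mulr_ge0 //.
  by rewrite ler_wpM2l ?powR_ge0 ?lerD.
rewrite powRM ?mulr_ge0 ?addr_ge0 ?mulr_ge0 //.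
rewrite (le_trans (ler_wpM2l (powR_ge0 (M * M) e) h2)) //.
by rewrite le_eqVlt; apply/orP; left; apply/eqP; ring.
Qed.

End interpolation.

(** * Whitney inequality on the square and on normalized bodies *)

Section whitney_square.
Context {R : realType} {e : R}.
Hypothesis e0 : 0 < e.

(* The interpolation error is controlled by differences f(. + u) - f with small [u],
   which [small_translation] bounds by a small multiple of [f] itself. *)
Lemma whitney_contraction r : (0 < r)%N -> exists2 C : R, 0 <= C &
  forall (N : gauge e) f x, N usq f x ->
    (forall d u, N (diff_domain usq r (vec d u)) (fdiff r (vec d u) f) 1) ->
    exists2 L, tensor_poly r L & N usq (fun z => f z - L z) (x / 2 + C).
Proof.
move=> r0; have [a a0 Ha] := interpolation_pointwise e0 r0.
pose cr : R := (r ^ 2 * (2 * r.+1) ^ 2)%:R.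
have acr : 0 <= a * cr by rewrite mulr_ge0.
(* Makes a cr delta at most 1/2, the contraction factor; [cr] is the factor that [nle_avg] puts
   before the translation bound for [rho := r]. *)
pose delta := (2 * (a * cr + 1))^-1.
have delta0 : 0 < delta by rewrite invr_gt0 mulr_gt0 // ltr_wpDl.
have [t t0 [C1 C10 HC1]] := small_translation e0 r0 delta0.
(* So fine that the reach (r + 1)/K of the nodes is within the range [t] of [small_translation]. *)
pose K := maxn r (Num.truncn (r.+1%:R / t)).+1.
have rK : (r <= K)%N by rewrite leq_maxl.
have K0 : (0 < K)%N by rewrite (leq_trans r0).
have Kt : r.+1%:R / K%:R <= t.
  rewrite ler_pdivrMr ?ltr0n // mulrC -ler_pdivrMr //.
  by rewrite (le_trans (ltW (truncnS_gt _))) // ler_nat leq_maxr.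
have [b b0 Hb] := Ha K rK.
pose T := (bool * 'I_(K - r) * 'I_K)%type.
exists (a * cr * C1 + b * (K ^ 2 * #|{: T}|)%:R + 1).
  by rewrite !addr_ge0 ?mulr_ge0.
move=> N f x Hx Hr; have x0 := nle_ge0 Hx.
(* Starting in the corner cell, all points of the difference stay in the square, since their grid
   indices are below [K]; so the hypothesis applies with step 1/K. *)
have Hg (s : T) : N (cell K 0 0) (grid_fdiff f s) 1.
  case: s => -[d i] j.
  apply: nle_ext (nle_sub (measurable_cell _ _ _) _
    (nle_shift (vec d (i%:R / K%:R) + vec (~~ d) (j%:R / K%:R)) (Hr d K%:R^-1))).
    by move=> z _; rewrite /grid_fdiff /= addrA.
  move=> z z00 k kr; apply/(usqE d).
  have {z00} [z1 z2] : 0 <= coord d z < K%:R^-1 /\ 0 <= coord (~~ d) z < K%:R^-1.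
    by move: z00; rewrite /cell /= !mul0r !div1r; case: d => -[].
  have e1 : coord d (z + (vec d (i%:R / K%:R) + vec (~~ d) (j%:R / K%:R)) + k%:R *: vec d K%:R^-1) =
     coord d z + (i + k)%:R / K%:R.
    rewrite vecZ coord_vec [vec d _ + _]addrC addrA coord_vec.
    by rewrite -{1}(negbK d) coord_vecN negbK natrD mulrDl addrA.
  have e2 : coord (~~ d) (z + (vec d (i%:R / K%:R) + vec (~~ d) (j%:R / K%:R)) + k%:R *: vec d K%:R^-1) =
     coord (~~ d) z + j%:R / K%:R.
    by rewrite vecZ coord_vecN addrA coord_vec coord_vecN.
  rewrite e1 e2; have K0' : 0 < K%:R :> R by rewrite ltr0n.
  have aux (s : R) n : 0 <= s < K%:R^-1 -> (n < K)%N -> 0 <= s + n%:R / K%:R < 1.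
    move=> /andP[s0 s1] nK; rewrite addr_ge0 ?divr_ge0 //=.
    rewrite (lt_le_trans (_ : _ < K%:R^-1 + n%:R / K%:R)) ?ltrD2r //.
    by rewrite -[X in X + _]div1r -mulrDl ler_pdivrMr // mul1r nat1r ler_nat.
  by split; apply: aux => //; move: (ltn_ord i) kr rK; clear; lia.
have [y y00 Hy] := nle_avg (r := r) (rho := r) (node := node r K) K0 a0 b0
  (fun k i kK ir => node_near rK kK ir)
  Hx (fun u u1 u2 => HC1 N f x Hx Hr u (le_trans u1 Kt) (le_trans u2 Kt)) Hg.
have [L HL fL] := Hb f y y00.
exists L => //; apply: nle_weak (Hy L (measurable_tensor_poly HL) fL).
rewrite -/cr -/T; set B := b * _; rewrite mulr1 addrA lerD2r addrA lerD2r.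
rewrite mulrDr lerD2r.
rewrite mulrA [x / 2]mulrC ler_wpM2r // /delta invfM mulrCA ler_piMr //.
by rewrite ler_pdivrMr ?ltr_wpDl // mul1r lerDl.
Qed.

(** Corrections by tensor polynomials do not change the r-th differences, so the contraction can be
    repeated with the same constant; x -> x/2 + C has the fixed point 2 C. *)
Lemma whitney_square r : (0 < r)%N -> exists2 C : R, 0 <= C &
  forall (N : gauge e) f x, N usq f x ->
    (forall d u, N (diff_domain usq r (vec d u)) (fdiff r (vec d u) f) 1) ->
    exists2 L, tensor_poly r L & N usq (fun z => f z - L z) C.
Proof.
move=> r0; have [C C0 HC] := whitney_contraction r0.
exists (2 * C + 1); first by rewrite addr_ge0 ?mulr_ge0.
move=> N f x Hx Hr.
have step n : exists2 L, tensor_poly r L &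
    N usq (fun z => f z - L z) (x / 2 ^+ n + 2 * C).
  elim: n => [|n [L HL fL]].
    exists (fun=> 0); first exact: tensor_poly0.
    apply: nle_ext (nle_weak _ Hx) => [z _|]; first by rewrite subr0.
    by rewrite expr0 divr1 lerDl mulr_ge0.
  have [] := HC N _ _ fL.
    move=> d u; apply: nle_ext (Hr d u) => z _.
    by rewrite fdiffB (fdiff_tensor_poly _ _ _ HL) subr0.
  move=> L' HL' fL'; exists (fun z => L z + L' z); first exact: tensor_polyD.
  apply: nle_ext (nle_weak _ fL') => [z _|]; first by rewrite opprD addrA.
  have -> : x / 2 ^+ n.+1 = x / 2 ^+ n / 2 by rewrite exprSr invfM mulrA.
  lra.
(* After this many steps 2^n exceeds x, and the part that depends on [f] is at most 1. *)
have [L HL fL] := step (Num.truncn x).+1.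
exists L => //; apply: nle_weak fL; rewrite addrC lerD2l.
rewrite ler_pdivrMr ?exprn_gt0 // mul1r -natrX.
rewrite (le_trans (ltW (truncnS_gt _))) // ler_nat ltnW //; exact: ltn_expl.
Qed.

End whitney_square.

(** * Propagation from the square along the strips *)

Section extension.
Context {R : realType} {e : R}.

Lemma measurable_eqset (A B : set (plane R)) : A = B ->
  measurable (A : set (mplane R)) -> measurable (B : set (mplane R)).
Proof. by move=> ->. Qed.

Lemma nle_eqset (N : gauge e) A B f x : A = B -> N A f x -> N B f x.
Proof. by move=> ->. Qed.

Lemma subr_scale_nat (z v : plane R) n j : (j <= n)%N ->
  z - n%:R *: v + j%:R *: v = z - (n - j)%:R *: v.
Proof. by move=> jn; rewrite natrB // scalerBl opprB addrA addrAC. Qed.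

(* Solve the r-th difference for its last term: [g z] is expressed through the
   values of [g] at z - v, ..., z - (r+1) v. *)
Lemma extend_once r : exists2 c : R, 0 <= c &
  forall (N : gauge e) (G S T : set (plane R)) v g w,
  measurable (T : set (mplane R)) ->
  (forall z j, T z -> (j <= r.+1)%N -> G (z - j%:R *: v)) ->
  (forall z j, T z -> (0 < j <= r.+1)%N -> S (z - j%:R *: v)) ->
  N S g w -> N (diff_domain G r.+1 v) (fdiff r.+1 v g) 1 ->
  N T g (c * (w + 1)).
Proof.
pose co (i : 'I_r.+1) : R := - ((-1) ^+ (r.+1 + i) * 'C(r.+1, i)%:R).
have [c c0 Hc] := nle_lincomb (e := e) co.
exists (2 `^ e * (c + 1)); first by rewrite mulr_ge0 ?powR_ge0 ?addr_ge0.
move=> N G S T v g w mT TG TS Hg Hd; have w0 := nle_ge0 Hg.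
have H1 : N T (fun z => \sum_i co i * g (z + (i%:R - r.+1%:R) *: v)) (c * w).
  apply: (Hc N T (fun i z => g (z + (i%:R - r.+1%:R) *: v))) => i.
  apply: nle_sub (nle_shift _ Hg) => // z Tz; rewrite /shift_set /=.
  rewrite -[_ - _]opprB scaleNr -natrB ?(ltnW (ltn_ord i)) //; apply: TS => //.
  by rewrite subn_gt0 ltn_ord leq_subr.
have H2 : N T (fun z => fdiff r.+1 v g (z - r.+1%:R *: v)) 1.
  apply: nle_sub (nle_shift _ Hd) => // z Tz j jr; rewrite /shift_set /=.
  by rewrite subr_scale_nat //; apply: TG => //; rewrite leq_subr.
apply: nle_ext (nle_weak _ (nle_add H2 H1)) => [z Tz|]; last first.
  rewrite -mulrA ler_wpM2l ?powR_ge0 // mulrDl mul1r mulrDr mulr1.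
  by have : 0 <= c * 1 := mulr_ge0 c0 ler01; lra.
rewrite /fdiff big_ord_recr /= addnn -signr_odd odd_double expr0 binn !mul1r subrK.
rewrite addrAC -big_split /= big1 ?add0r // => i _.
rewrite /co mulNr -addrA -scaleNr -scalerDl [- _ + _]addrC.
exact: subrr.
Qed.

(** Layers of width 1/(r+1) are added at both ends. From a new layer, r + 1 steps of that width
    towards the square span a distance 1, at most the length already covered, so all values used are
    known. *)
Lemma extend_strip r d k : exists2 C : R, 0 <= C &
  forall (N : gauge e) (G : set (plane R)) (I : interval R) g w,
  measurable (G : set (mplane R)) ->
  (forall z a b c, G (z + vec d a) -> G (z + vec d b) -> a <= c <= b -> G (z + vec d c)) ->
  (forall z, 0 <= coord d z <= 1 -> coord (~~ d) z \in I -> G z) ->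
  (forall u, N (diff_domain G r.+1 (vec d u)) (fdiff r.+1 (vec d u) g) 1) ->
  N (G `&` [set z | coord (~~ d) z \in I /\ 0 <= coord d z < 1]) g w ->
  N (G `&` [set z | coord (~~ d) z \in I /\
      - (k%:R / r.+1%:R) <= coord d z < 1 + k%:R / r.+1%:R]) g (C * (w + 1)).
Proof.
elim: k => [|k [C C0 HC]].
  exists 1 => // N G I g w mG _ _ _ H; apply: nle_weak (nle_eqset _ H).
    by rewrite mul1r lerDl.
  by rewrite mul0r oppr0 addr0.
have [c c0 Hc] := extend_once r.
exists (C + 2 * (c * (C + 1))).
  by rewrite addr_ge0 ?mulr_ge0 ?addr_ge0.
move=> N G I g w mG cvx sq Hd Hg; have w0 := nle_ge0 Hg.
have Hk := HC N G I g w mG cvx sq Hd Hg.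
set S := G `&` _ in Hk.
pose t (n : nat) : R := n%:R / r.+1%:R.
have tS n : t n.+1 = t n + t 1 by rewrite /t -natr1 mulrDl.
have t0 n : 0 <= t n by rewrite /t divr_ge0.
have tr : t r.+1 = 1 by rewrite /t divff ?pnatr_eq0.
have tle m n : (m <= n)%N -> t m <= t n.
  by move=> mn; rewrite /t ler_wpM2r ?invr_ge0 ?ler_nat.
have mstrip (a b : R) :
    measurable (G `&` [set z | coord (~~ d) z \in I /\ a <= coord d z < b] : set (mplane R)).
  apply: measurableI => //; case: (d) => /=.
    have := measurable_box I `[a, b[; apply: measurable_eqset; apply/seteqP.
    by split=> z /=; rewrite in_itv.
  have := measurable_box `[a, b[ I; apply: measurable_eqset; apply/seteqP.
  by split=> z /=; rewrite in_itv => -[].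
pose T1 := G `&` [set z | coord (~~ d) z \in I /\ 1 + t k <= coord d z < 1 + t k.+1].
pose T2 := G `&` [set z | coord (~~ d) z \in I /\ - t k.+1 <= coord d z < - t k].
(* The square supplies a point of [G] on the line through z; convexity along this line then gives
   the intermediate points. *)
have foot z a : coord (~~ d) z \in I -> 0 <= a <= 1 -> G (z + vec d (a - coord d z)).
  move=> zI a01; apply: sq; first by rewrite coord_vec addrC subrK.
  by rewrite coord_vecN.
have foot0 z : coord (~~ d) z \in I -> G (z + vec d (0 - coord d z)).
  by move=> zI; apply: (foot z _ zI); rewrite lexx ler01.
have foot1 z : coord (~~ d) z \in I -> G (z + vec d (1 - coord d z)).
  by move=> zI; apply: (foot z _ zI); rewrite lexx ler01.
have jt (j : nat) (s : R) (z : plane R) : z - j%:R *: vec d (s / r.+1%:R) = z + vec d (- (s * t j)).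
  by rewrite vecZ vecN /t; congr (z + vec d (- _)); ring.
have H1 : N T1 g (c * (C * (w + 1) + 1)).
  apply: (Hc N G S T1 (vec d (1 / r.+1%:R)) g _ (mstrip _ _) _ _ Hk (Hd _)).
    move=> z j [Gz [zI /andP[z1 z2]]] jr; rewrite jt mul1r.
    apply: (cvx _ (0 - coord d z) 0); first exact: foot0.
      by rewrite (_ : vec d 0 = 0) ?addr0 //; case: (d).
    by have := tle _ _ jr; have := t0 j; have := t0 k; lra.
  move=> z j [Gz [zI /andP[z1 z2]]] /andP[j0 jr]; rewrite jt mul1r.
  split; last first.
    rewrite /= coord_vec coord_vecN; split => //.
    rewrite -/(t k); apply/andP.
    by have := tle _ _ jr; have := tle _ _ j0; have := t0 k; have := tS k; lra.
  apply: (cvx _ (0 - coord d z) 0); first exact: foot0.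
    by rewrite (_ : vec d 0 = 0) ?addr0 //; case: (d).
  by have := tle _ _ jr; have := t0 j; have := t0 k; lra.
have H2 : N T2 g (c * (C * (w + 1) + 1)).
  have G0 z : G z -> G (z + vec d 0).
    by rewrite (_ : vec d 0 = 0) ?addr0 //; case: (d).
  have TG z j : T2 z -> (j <= r.+1)%N -> G (z - j%:R *: vec d (- 1 / r.+1%:R)).
    move=> [Gz [zI /andP[z1 z2]]] jr; rewrite jt mulN1r opprK.
    apply: (cvx _ 0 (1 - coord d z)); [exact: G0|exact: foot1|].
    by have := tle _ _ jr; have := t0 j; have := t0 k; lra.
  apply: (Hc N G S T2 (vec d (- 1 / r.+1%:R)) g _ (mstrip _ _) TG _ Hk (Hd _)).
  move=> z j Tz /andP[j0 jr]; split; first exact: TG.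
  move: Tz => [Gz [zI /andP[z1 z2]]]; rewrite jt mulN1r opprK.
  rewrite /= coord_vec coord_vecN; split => //; rewrite -/(t k); apply/andP.
  by have := tle _ _ jr; have := tle _ _ j0; have := t0 k; have := tS k; lra.
have := nle_union Hk (nle_union H1 H2).
move=> /(nle_sub (mstrip _ _)) H; apply: nle_weak (H _ _ _).
  have : 0 <= C * w by rewrite mulr_ge0.
  have : 0 <= c * w by rewrite mulr_ge0.
  rewrite mulrDl -[2 * _ * _]mulrA lerD2l.
  rewrite (_ : 2 * (c * (C + 1) * (w + 1)) =
    c * (C * (w + 1) + 1) + c * (C * (w + 1) + 1) + 2 * c * w); last by ring.
  by move=> cw _; rewrite lerDl -mulrA mulr_ge0.
move=> z [Gz [zI /andP[]]]; rewrite -/(t k.+1) => z1 z2.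
have [h1|h1] := ltP (coord d z) (1 + t k).
  have [h2|h2] := leP (- t k) (coord d z).
    by left; split => //=; split => //; apply/andP.
  by right; right; split => //=; split => //; apply/andP.
by right; left; split => //=; split => //; apply/andP.
Qed.

(** 4 (r+1) layers reach [-4, 5), which contains [-3, 4] in spite of the open end. *)
Lemma extend r d : exists2 C : R, 0 <= C &
  forall (N : gauge e) (G : set (plane R)) (I : interval R) g w,
  measurable (G : set (mplane R)) ->
  (forall z a b c, G (z + vec d a) -> G (z + vec d b) -> a <= c <= b -> G (z + vec d c)) ->
  (forall z, 0 <= coord d z <= 1 -> coord (~~ d) z \in I -> G z) ->
  (forall z, G z -> -3 <= coord d z <= 4) ->
  (forall u, N (diff_domain G r.+1 (vec d u)) (fdiff r.+1 (vec d u) g) 1) ->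
  N (G `&` [set z | coord (~~ d) z \in I /\ 0 <= coord d z < 1]) g w ->
  N (G `&` [set z | coord (~~ d) z \in I]) g (C * (w + 1)).
Proof.
have [C C0 HC] := extend_strip r d (4 * r.+1)%N; exists C => //.
move=> N G I g w mG cvx sq bd Hd Hg; have := HC N G I g w mG cvx sq Hd Hg.
have -> : (4 * r.+1)%:R / r.+1%:R = 4 :> R by rewrite natrM mulfK // pnatr_eq0.
apply: nle_eqset; apply/seteqP; split => z [Gz]; first by case.
by split => //; split => //; have /andP[? ?] := bd z Gz; apply/andP; split; lra.
Qed.

End extension.

Section whitney_convex.
Context {R : realType} {e : R}.
Hypothesis e0 : 0 < e.

(* The unit square is inscribed in [G] in such a way that every point of [G] lies
   in the horizontal or in the vertical strip spanned by the square. *)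
Record normalized (G : set (plane R)) : Prop := Normalized {
  norm_meas : measurable (G : set (mplane R));
  norm_cvx : forall d z a b c, G (z + vec d a) -> G (z + vec d b) ->
    a <= c <= b -> G (z + vec d c);
  norm_sq : forall z, 0 <= z.1 <= 1 -> 0 <= z.2 <= 1 -> G z;
  norm_bd : forall d z, G z -> -3 <= coord d z <= 4;
  norm_cross : forall z, G z -> 0 <= z.1 <= 1 \/ 0 <= z.2 <= 1 }.

(** The polynomial found on the square serves on all of [G], because [f - L] has the same
    differences as [f]. *)
Lemma whitney_normalized r : (0 < r)%N -> exists2 C : R, 0 < C &
  forall (N : gauge e) G f x, normalized G -> N G f x ->
    (forall d u, N (diff_domain G r (vec d u)) (fdiff r (vec d u) f) 1) ->
    exists2 L, tensor_poly r L & N G (fun z => f z - L z) C.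
Proof.
case: r => // r _; have [C C0 HC] := whitney_square e0 (ltn0Sn r).
have [C1 C10 HC1] := extend (e := e) r false.
have [C2 C20 HC2] := extend (e := e) r true.
pose w1 := C1 * (C + 1); pose w2 := C2 * (w1 + 1); pose w3 := C1 * (w2 + 1).
have w10 : 0 <= w1 by rewrite mulr_ge0 ?addr_ge0.
have w20 : 0 <= w2 by rewrite mulr_ge0 ?addr_ge0.
have w30 : 0 <= w3 by rewrite mulr_ge0 ?addr_ge0.
exists (w2 + w3 + 1); first by rewrite ltr_wpDl ?addr_ge0.
move=> N G f x [mG cvx sq bd cross] Hx Hr.
have usqG : usq `<=` G.
  by move=> z [/andP[z1 z2] /andP[z3 z4]]; apply: sq; apply/andP; split => //; apply: ltW.
have [|L HL fL] := HC N f x (nle_sub measurable_usq usqG Hx).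
  move=> d u; apply: nle_sub (Hr d u); first exact: measurable_diff_domain measurable_usq.
  by move=> z Uz j jr; apply: usqG; apply: Uz.
exists L => //; set g := (fun z => f z - L z) in fL *.
have Hd d u : N (diff_domain G r.+1 (vec d u)) (fdiff r.+1 (vec d u) g) 1.
  by apply: nle_ext (Hr d u) => z _; rewrite fdiffB (fdiff_tensor_poly _ _ _ HL) subr0.
have ms (d : bool) (I J : interval R) :
    measurable (G `&` [set z | coord (~~ d) z \in I /\ coord d z \in J] : set (mplane R)).
  apply: measurableI => //; case: d; first exact: (measurable_box I J).
  have := measurable_box J I; apply: measurable_eqset; apply/seteqP.
  by split => z /= [].
(* The square is half-open, the strips of [norm_cross] are closed. The half-open horizontal strip
   has the edge x = 1 that the closed vertical strip needs; the latter has the edge y = 1 that the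
   closed horizontal strip needs. Hence three extensions. *)
have H1 : N (G `&` [set z | coord true z \in `[0, 1[]) g w1.
  apply: (HC1 N G `[0, 1[ g C mG (cvx false)) => //.
  - by move=> z z1; rewrite in_itv /= => /andP[z2 z3]; apply: sq => //; apply/andP; split => //; apply: ltW.
  - exact: (bd false).
  - apply: nle_sub fL; last by move=> z [_ [/= + ?]]; rewrite in_itv.
    have := ms false `[0, 1[ `[0, 1[; apply: measurable_eqset; apply/seteqP.
    by split=> z [Gz [z1 z2]]; split => //; split => //; move: z2; rewrite in_itv.
have H2 : N (G `&` [set z | coord false z \in `[0, 1]]) g w2.
  apply: (HC2 N G `[0, 1] g w1 mG (cvx true)) => //.
  - by move=> z z1; rewrite in_itv /= => z2; apply: sq.
  - exact: (bd true).
  - apply: nle_sub H1; last by move=> z [Gz [/= + ?]]; split => //=; rewrite in_itv.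
    have := ms true `[0, 1] `[0, 1[; apply: measurable_eqset; apply/seteqP.
    by split=> z [Gz [z1 z2]]; split => //; split => //; move: z2; rewrite in_itv.
have H3 : N (G `&` [set z | coord true z \in `[0, 1]]) g w3.
  apply: (HC1 N G `[0, 1] g w2 mG (cvx false)) => //.
  - exact: (bd false).
  - apply: nle_sub H2.
      have := ms false `[0, 1] `[0, 1[; apply: measurable_eqset; apply/seteqP.
      by split=> z [Gz [z1 z2]]; split => //; split => //; move: z2; rewrite in_itv.
    move=> z [Gz [/= + /andP[z1 z2]]]; split => //=; rewrite in_itv /= z1.
    exact: ltW.
apply: nle_weak (nle_sub mG _ (nle_union H2 H3)); first by rewrite lerDl.
move=> z Gz; have [h|h] := cross z Gz; [left|right]; split => //=;
  by rewrite in_itv.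
Qed.

End whitney_convex.

(** * The gauges of the uniform norm and of the p-norms *)

Section cells.
Context {R : realType}.
Implicit Types (z y : plane R) (s t : R).

Lemma slot_exists K n s : (0 < K)%N -> 0 <= s < n%:R / K%:R ->
  exists2 k, (k < n)%N & k%:R / K%:R <= s < k.+1%:R / K%:R.
Proof.
move=> K0 /andP[s0 s1]; have K0' : 0 < K%:R :> R by rewrite ltr0n.
have sK : 0 <= s * K%:R by rewrite mulr_ge0.
have h : (Num.truncn (s * K%:R))%:R <= s * K%:R by rewrite truncn_le.
exists (Num.truncn (s * K%:R)).
  by rewrite -(ltr_nat R) (le_lt_trans h) // -ltr_pdivlMr.
by rewrite ler_pdivrMr // ltr_pdivlMr // h truncnS_gt.
Qed.

Lemma slot_unique K k k' s : (0 < K)%N ->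
  k%:R / K%:R <= s < k.+1%:R / K%:R -> k'%:R / K%:R <= s < k'.+1%:R / K%:R -> k = k'.
Proof.
move=> K0; have K0' : 0 < K%:R :> R by rewrite ltr0n.
rewrite !ler_pdivrMr // !ltr_pdivlMr // => /andP[h1 h2] /andP[h3 h4].
have : (k < k'.+1)%N by rewrite -(ltr_nat R) (le_lt_trans h1).
have : (k' < k.+1)%N by rewrite -(ltr_nat R) (le_lt_trans h3).
lia.
Qed.

Lemma slot_unit K k s : (k < K)%N -> k%:R / K%:R <= s < k.+1%:R / K%:R -> 0 <= s < 1.
Proof.
move=> kK /andP[h1 h2]; have K0' : 0 < K%:R :> R by rewrite ltr0n (leq_trans _ kK).
rewrite (le_trans _ h1) ?divr_ge0 //= (lt_le_trans h2) //.
by rewrite ler_pdivrMr // mul1r ler_nat.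
Qed.

Lemma slot_near K k k' rho s t : (0 < K)%N ->
  (k <= k' + rho)%N -> (k' <= k + rho)%N ->
  k%:R / K%:R <= s < k.+1%:R / K%:R -> k'%:R / K%:R <= t < k'.+1%:R / K%:R ->
  - (rho.+1%:R / K%:R) < s - t < rho.+1%:R / K%:R.
Proof.
move=> K0; have K0' : 0 < K%:R :> R by rewrite ltr0n.
rewrite !ler_pdivrMr // !ltr_pdivlMr // -mulNr ltr_pdivrMr // -!(ler_nat R) !natrD -!natr1.
move: (k%:R) (k'%:R) (rho%:R) => a b c h1 h2 /andP[h3 h4] /andP[h5 h6].
by rewrite mulrBl; apply/andP; split; lra.
Qed.

Lemma cell_exists K z : (0 < K)%N -> usq z ->
  exists k l, [/\ (k < K)%N, (l < K)%N & cell K k l z].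
Proof.
have KK : (0 < K)%N -> 1 = K%:R / K%:R :> R.
  by move=> K0; rewrite divff // pnatr_eq0 -lt0n.
move=> K0 [z1 z2]; rewrite (KK K0) in z1 z2.
have [k kK zk] := slot_exists K0 z1.
by have [l lK zl] := slot_exists K0 z2; exists k, l.
Qed.

Lemma cell_usq K k l : (k < K)%N -> (l < K)%N -> cell K k l `<=` (usq : set (plane R)).
Proof. by move=> kK lK z [z1 z2]; split; [exact: slot_unit z1|exact: slot_unit z2]. Qed.

Lemma cell_shift K k l : (0 < K)%N ->
  shift_set (grid K k l) (cell K k l) = cell K 0 0 :> set (plane R).
Proof.
move=> K0; have K0' : 0 < K%:R :> R by rewrite ltr0n.
have aux n s : (n%:R / K%:R <= s + n%:R / K%:R < n.+1%:R / K%:R) =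
    (0%:R / K%:R <= s < 1%:R / K%:R).
  by rewrite -addn1 natrD mulrDl addrC ltrD2l -[X in X <= _]addr0 lerD2l mul0r.
by apply/seteqP; split => z; rewrite /cell /shift_set /= !aux.
Qed.

Lemma cell_grid K k l : (0 < K)%N -> cell K k l (grid K k l : plane R).
Proof.
move=> K0; have K0' : 0 < K%:R :> R by rewrite ltr0n.
by rewrite /cell /grid /= !lexx /= !ltr_pM2r ?invr_gt0 // !ltr_nat !ltnSn.
Qed.

End cells.

Section sup_gauge.
Context {R : realType}.

(** The condition 0 <= x matters for empty [A], where the other one is void. *)
Definition sup_le (A : set (plane R)) (f : plane R -> R) (x : R) :=
  0 <= x /\ forall z, A z -> `|f z| <= x.

(** Bounds on a supremum hold at every point, so the corner 0 is taken for [y] without averaging. *)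
Lemma sup_le_avg (K r rho : nat) (T : finType) (node : nat -> nat -> nat)
    (a b w1 w2 : R) (f : plane R -> R) (x : R) (g : T -> plane R -> R) :
  (0 < K)%N -> 0 <= a -> 0 <= b ->
  (forall k i, (k < K)%N -> (i < r)%N ->
     [/\ node k i < K, k <= node k i + rho & node k i <= k + rho]%N) ->
  sup_le usq f x ->
  (forall u, `|u.1| <= rho.+1%:R / K%:R -> `|u.2| <= rho.+1%:R / K%:R ->
     sup_le (usq `&` shift_set u usq) (fun z => f (z + u) - f z) w1) ->
  (forall t, sup_le (cell K 0 0) (g t) w2) ->
  exists2 y, cell K 0 0 y & forall Q : plane R -> R,
    measurable_fun setT (Q : mplane R -> R) ->
    (forall k l z, (k < K)%N -> (l < K)%N -> cell K k l z ->
       `|f z - Q z| `^ 1 <=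
         a * (\sum_(i < r) \sum_(j < r)
           `|f (y + ((node k i)%:R / K%:R, (node l j)%:R / K%:R)) - f z| `^ 1) +
         b * \sum_t `|g t y| `^ 1) ->
    sup_le usq (fun z => f z - Q z)
      (a * (r ^ 2 * (2 * rho.+1) ^ 2)%:R * w1 + b * (K ^ 2 * #|T|)%:R * w2 + 1).
Proof.
move=> K0 a0 b0 Hnode Hf Hw1 Hg; have y0 := cell_grid (R := R) 0 0 K0.
have gr0 : grid K 0 0 = 0 :> plane R by rewrite /grid mul0r.
have w10 : 0 <= w1.
  have h : `|(0 : plane R).1| <= rho.+1%:R / K%:R by rewrite normr0 divr_ge0.
  by have [] := Hw1 0 h h.
(* For empty [T] nothing is known about the sign of [w2]. *)
have w2T : 0 <= #|T|%:R * w2.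
  have [->|T0] := posnP #|T|; first by rewrite mul0r.
  have /card_gt0P[t _] := T0; rewrite mulr_ge0 //; by have [] := Hg t.
exists (grid K 0 0) => // Q _ HQ; split.
  have B0 : 0 <= b * (K ^ 2 * #|T|)%:R * w2.
    by rewrite natrM -!mulrA; do 2 apply: mulr_ge0 => //.
  by rewrite addr_ge0 // addr_ge0 // !mulr_ge0.
move=> z Uz; have [k [l [kK lK zkl]]] := cell_exists K0 Uz.
have := HQ k l z kK lK zkl; rewrite powRr1 // => /le_trans; apply.
rewrite -[leLHS]addr0 lerD // lerD //.
  rewrite -mulrA ler_wpM2l // (@le_trans _ _ ((r ^ 2)%:R * w1)) //; last first.
    by rewrite ler_wpM2r // ler_nat leq_pmulr // expn_gt0 muln_gt0.
  have -> : (r ^ 2)%:R * w1 = \sum_(i < r) \sum_(j < r) w1.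
    by rewrite !sumr_const !card_ord -mulrnA mulr_natl mulnn.
  apply: ler_sum => i _; apply: ler_sum => j _; rewrite powRr1 //.
  have [n1 n2 n3] := Hnode k i kK (ltn_ord i).
  have [m1 m2 m3] := Hnode l j lK (ltn_ord j).
  rewrite gr0 add0r -/(grid K (node k i) (node l j)).
  have Hgr := cell_grid (R := R) (node k i) (node l j) K0.
  pose u : plane R := grid K (node k i) (node l j) - z.
  have u1 : `|u.1| <= rho.+1%:R / K%:R.
    by have := slot_near K0 n3 n2 Hgr.1 zkl.1; rewrite ler_norml => /andP[? ?]; rewrite !ltW.
  have u2 : `|u.2| <= rho.+1%:R / K%:R.
    by have := slot_near K0 m3 m2 Hgr.2 zkl.2; rewrite ler_norml => /andP[? ?]; rewrite !ltW.
  have zu : z + u = grid K (node k i) (node l j) by rewrite addrC subrK.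
  have [_ /(_ z)] := Hw1 u u1 u2; rewrite /shift_set /= zu; apply; split => //.
  exact: cell_usq Hgr.
rewrite natrM -!mulrA ler_wpM2l // (@le_trans _ _ (#|T|%:R * w2)) //; last first.
  by rewrite ler_peMl // ler1n expn_gt0 K0.
rewrite mulr_natl -sumr_const; apply: ler_sum => t _; rewrite powRr1 //.
by have [_] := Hg t; apply.
Qed.

Definition sup_gauge : gauge (1 : R).
Proof.
refine (@Gauge R 1 sup_le _ _ _ _ _ _ _ _ sup_le_avg); rewrite /sup_le.
- by move=> A f x [].
- by move=> A B f x _ AB [x0 H]; split => // z /AB; exact: H.
- by move=> A f x y xy [x0 H]; split=> [|z /H h]; exact: le_trans xy.
- move=> A B f x y [x0 H] [y0 H']; split=> [|z]; first exact: addr_ge0.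
  by case=> [/H|/H'] h; rewrite (le_trans h) // ?lerDl ?lerDr.
- by move=> v A f x [x0 H]; split=> // z; exact: H.
- move=> A f g x y [x0 H] [y0 H']; rewrite powRr1 //; split=> [|z Az].
    by rewrite mulr_ge0 ?addr_ge0.
  rewrite (le_trans (ler_normD _ _)) // (le_trans (lerD (H z Az) (H' z Az))) //.
  by have : 0 <= x + y := addr_ge0 x0 y0; lra.
- move=> c A f x [x0 H]; rewrite powRr1 //; split=> [|z Az]; first by rewrite mulr_ge0.
  by rewrite normrM ler_wpM2l // H.
- by move=> A f g x fg [x0 H]; split=> // z Az; rewrite -fg // H.
Defined.

End sup_gauge.

(** * The p-th power integral for a translation invariant measure *)

Section Lp_gauge.
Context {R : realType} {e : R}.
Hypothesis e0 : 0 < e.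
Variable mu : {sigma_finite_measure set (mplane R) -> \bar R}.
Hypothesis mu_shift : forall v (A : set (plane R)),
  measurable (A : set (mplane R)) -> mu (shift_set v A) = mu A.
Hypothesis mu_usq : (mu usq < +oo)%E.
Implicit Types (A B : set (mplane R)) (f g : mplane R -> R).

Definition Lp_int A f : \bar R := (\int[mu]_(z in A) (`|f z| `^ e)%:E)%E.

(** Measurability is part of the relation because most laws of a gauge do not mention it. *)
Definition Lp_le (A : set (plane R)) (f : plane R -> R) (x : R) :=
  [/\ measurable (A : set (mplane R)), measurable_fun (A : set (mplane R)) (f : mplane R -> R) &
      (Lp_int A f <= x%:E)%E].

Lemma measurable_normpow A f : measurable_fun A f ->
  measurable_fun A (fun z => (`|f z| `^ e)%:E).
Proof.
move=> mf; apply/measurable_EFinP.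
apply: (measurableT_comp (measurable_powR e)).
exact: (measurableT_comp (@normr_measurable R setT)).
Qed.

Lemma normpow_ge0 f z : (0 <= (`|f z| `^ e)%:E)%E.
Proof. by rewrite lee_fin powR_ge0. Qed.

Lemma Lp_int_ge0 A f : (0 <= Lp_int A f)%E.
Proof. by apply: integral_ge0 => z _; exact: normpow_ge0. Qed.

Lemma measurable_addr_plane (v : mplane R) :
  measurable_fun setT (fun z : mplane R => (z.1 + v.1, z.2 + v.2) : mplane R).
Proof.
apply: measurable_fun_pair.
  by apply: measurable_funD => //; exact: measurable_fst.
by apply: measurable_funD => //; exact: measurable_snd.
Qed.

Lemma ge0_integral_shift (v : plane R) A (h : mplane R -> \bar R) :
  measurable A -> measurable_fun A h -> (forall z, A z -> 0 <= h z)%E ->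
  (\int[mu]_(z in shift_set v A) h (z + v)%R = \int[mu]_(z in A) h z)%E.
Proof.
move=> mA mh h0.
apply/esym; apply: etrans (ge0_integral_pushforward (measurable_addr_plane v) mu mA mh _).
  apply: eq_measure_integral => [|mf' B mB _]; first exact: measurable_addr_plane.
  exact: esym (mu_shift v mB).
by move=> z; rewrite inE; exact: h0.
Qed.

Lemma Lp_int_setU A B f : measurable A -> measurable B ->
  measurable_fun A f -> measurable_fun B f ->
  (Lp_int (A `|` B) f <= Lp_int A f + Lp_int B f)%E.
Proof.
move=> mA mB mfA mfB; rewrite /Lp_int.
have -> : A `|` B = A `|` (B `\` A).
  by rewrite setUDr setDv setD0.
have mBA : measurable (B `\` A) by apply: measurableD.
have mfBA : measurable_fun (B `\` A) f by apply: measurable_funS mfB => // z [].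
rewrite ge0_integral_setU //.
- rewrite leeD2l //; apply: ge0_subset_integral => //.
  exact: measurable_normpow.
- by apply: measurable_normpow; apply/measurable_funU.
- by apply/disj_setPS; rewrite setDE setICA setICr setI0.
Qed.

Lemma Lp_le_sub A B f x : measurable A -> A `<=` B -> Lp_le B f x -> Lp_le A f x.
Proof.
move=> mA AB [mB mf fx]; split => //; first exact: measurable_funS mf.
by apply: le_trans fx; apply: ge0_subset_integral => //; exact: measurable_normpow.
Qed.

Lemma Lp_le_union A B f x y : Lp_le A f x -> Lp_le B f y -> Lp_le (A `|` B) f (x + y).
Proof.
move=> [mA mfA fx] [mB mfB fy]; split; first exact: measurableU.
  exact/measurable_funU.
by rewrite (le_trans (Lp_int_setU mA mB mfA mfB)) // EFinD leeD.
Qed.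

Lemma Lp_le_shift v A f x : Lp_le A f x -> Lp_le (shift_set v A) (fun z => f (z + v)) x.
Proof.
move=> [mA mf fx]; split; first exact: measurable_shift_set.
  apply: (measurable_comp (F := A)) => //.
    by move=> _ [z /= Az <-].
  by apply: (measurable_funS _ (@subsetT _ _) (measurable_addr_plane v)).
apply: le_trans fx; rewrite /Lp_int -[leRHS](ge0_integral_shift v) //.
exact: measurable_normpow.
Qed.

Lemma Lp_le_add A f g x y : Lp_le A f x -> Lp_le A g y ->
  Lp_le A (fun z => f z + g z) (2 `^ e * (x + y)).
Proof.
move=> [mA mf fx] [_ mg gy]; split => //; first exact: measurable_funD.
apply: (@le_trans _ _ (\int[mu]_(z in A) ((2 `^ e)%:E * ((`|f z| `^ e)%:E + (`|g z| `^ e)%:E)))%E).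
  apply: ge0_le_integral => //.
  - by apply: (measurable_normpow (f := fun z => f z + g z)); exact: measurable_funD.
  - by apply: measurable_funeM; apply: emeasurable_funD; exact: measurable_normpow.
  - move=> z _; rewrite -EFinD -EFinM lee_fin.
    rewrite (le_trans _ (powR_addn e0 _ _)) // ge0_ler_powR ?nnegrE ?(ltW e0) ?addr_ge0 //.
    exact: ler_normD.
rewrite ge0_integralZl_EFin ?powR_ge0 //; last 2 first.
- by move=> z _; rewrite adde_ge0 ?normpow_ge0.
- by apply: emeasurable_funD; exact: measurable_normpow.
rewrite ge0_integralD //; try exact: measurable_normpow.
by rewrite EFinM lee_wpmul2l ?lee_fin ?powR_ge0 // EFinD leeD.
Qed.

Lemma Lp_le_scale c A f x : Lp_le A f x -> Lp_le A (fun z => c * f z) (`|c| `^ e * x).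
Proof.
move=> [mA mf fx]; split => //; first by apply: measurable_funM.
rewrite /Lp_int; under eq_integral do rewrite normrM powRM // EFinM.
rewrite ge0_integralZl_EFin ?powR_ge0 //; last exact: measurable_normpow.
by rewrite EFinM lee_wpmul2l // lee_fin powR_ge0.
Qed.

Lemma Lp_le_ext A f g x : (forall z, A z -> f z = g z) -> Lp_le A f x -> Lp_le A g x.
Proof.
move=> fg [mA mf fx]; split => //.
  by apply: eq_measurable_fun mf => z; rewrite inE; exact: fg.
apply: le_trans fx; rewrite /Lp_int le_eqVlt; apply/orP; left; apply/eqP.
by apply: eq_integral => z; rewrite inE => Az; rewrite fg.
Qed.

(** Otherwise h is at least t + 1 on all of [A], and integrating contradicts the bound, as [mu A] is
    positive and finite. *)
Lemma integral_le_average A (h : mplane R -> \bar R) (t : R) :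
  measurable A -> measurable_fun A h -> (forall z, A z -> 0 <= h z)%E -> 0 <= t ->
  (0 < mu A)%E -> (mu A < +oo)%E ->
  (\int[mu]_(z in A) h z <= t%:E * mu A)%E ->
  exists2 z, A z & (h z <= (t + 1)%:E)%E.
Proof.
move=> mA mh h0 t0 A0 Aoo hA; apply: contrapT => H.
have Hz z : A z -> ((t + 1)%:E <= h z)%E.
  move=> Az; rewrite leNgt; apply/negP => /ltW hz; apply: H; by exists z.
have : (\int[mu]_(z in A) (cst (t + 1)%:E z) <= \int[mu]_(z in A) h z)%E.
  apply: ge0_le_integral => //.
  by move=> z _; rewrite lee_fin addr_ge0.
rewrite integral_cst // => /le_trans /(_ hA).
have Afin : mu A \is a fin_num by rewrite ge0_fin_numE ?ltW.
rewrite lee_pmul2r // lee_fin.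
lra.
Qed.

Lemma Lp_int_cover (I : finType) (A : I -> set (mplane R)) B f :
  (forall i, measurable (A i)) -> measurable B -> (forall i, measurable_fun (A i) f) ->
  measurable_fun B f ->
  (forall z, B z -> exists i, A i z) -> (Lp_int B f <= \sum_i Lp_int (A i) f)%E.
Proof.
move=> mA mB mfA mfB BA.
have H (s : seq I) : [/\ measurable (\big[setU/set0]_(i <- s) A i),
    measurable_fun (\big[setU/set0]_(i <- s) A i) f &
    (Lp_int (\big[setU/set0]_(i <- s) A i) f <= \sum_(i <- s) Lp_int (A i) f)%E].
  elim: s => [|i s [mU mfU IH]].
    rewrite !big_nil; split => //; first exact: measurable_fun_set0.
    by rewrite /Lp_int integral_set0.
  rewrite !big_cons; split; first exact: measurableU.
    exact/measurable_funU.
  by rewrite (le_trans (Lp_int_setU _ _ _ _)) // leeD2l.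
have [mU mfU HU] := H (index_enum I); apply: le_trans HU.
apply: ge0_subset_integral => //; first exact: measurable_normpow.
move=> z /BA[i Aiz]; rewrite (bigD1 i) //=; by left.
Qed.

Lemma Lp_int_cst1 A : measurable A -> Lp_int A (cst 1) = mu A.
Proof.
move=> mA; rewrite /Lp_int; under eq_integral do rewrite normr1 powR1.
by rewrite (integral_cst mu mA 1%:E) mul1e.
Qed.

Lemma measure_cover (I : finType) (A : I -> set (mplane R)) B :
  (forall i, measurable (A i)) -> measurable B ->
  (forall z, B z -> exists i, A i z) -> (mu B <= \sum_i mu (A i))%E.
Proof.
move=> mA mB BA; rewrite -Lp_int_cst1 //.
rewrite (eq_bigr (fun i => Lp_int (A i) (cst 1))); last first.
  by move=> i _; rewrite Lp_int_cst1.
by apply: Lp_int_cover.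
Qed.

Lemma integral_indicM A (h : mplane R -> R) :
  (\int[mu]_(z in A) (h z)%:E = \int[mu]_z (\1_A z * h z)%:E)%E.
Proof.
rewrite integral_mkcond; apply: eq_integral => z _.
rewrite patchE indicE; case: (z \in A); first by rewrite mul1r.
by rewrite mul0r.
Qed.

(** * A typical position of the grid, by Tonelli's theorem *)

Section averaging.
Variables (K rho : nat).
Hypothesis K0 : (0 < K)%N.

Let C (p : nat * nat) : set (mplane R) := cell K p.1 p.2.

Let mC p : measurable (C p). Proof. exact: measurable_cell. Qed.

Lemma mu_cell k l : mu (cell K k l) = mu (cell K 0 0).
Proof. by rewrite -(mu_shift (grid K k l) (measurable_cell K k l)) cell_shift. Qed.

(** Contains all displacements from a node to a point using it: the cell indices differ by at most
    [rho], the points by less than (rho + 1)/K. *)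
Definition box : set (plane R) :=
  [set v | - (rho.+1%:R / K%:R) <= v.1 < rho.+1%:R / K%:R /\
           - (rho.+1%:R / K%:R) <= v.2 < rho.+1%:R / K%:R].

Lemma measurable_box_set : measurable (box : set (mplane R)).
Proof.
have := measurable_box `[- (rho.+1%:R / K%:R), rho.+1%:R / K%:R[
  (`[- (rho.+1%:R / K%:R), rho.+1%:R / K%:R[ : interval R).
by apply: measurable_eqset; apply/seteqP; split => x /=; rewrite !in_itv.
Qed.

(** Up to a translation the box is covered by (2 (rho + 1))^2 cells of equal measure: the origin of
    this factor in [nle_avg]. *)
Lemma mu_box : (mu box <= (((2 * rho.+1) ^ 2)%:R)%:E * mu (cell K 0 0))%E.
Proof.
pose n := (2 * rho.+1)%N.
pose A (p : 'I_n * 'I_n) : set (mplane R) :=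
  shift_set (grid K rho.+1 rho.+1) (cell K p.1 p.2).
have mA p : measurable (A p) by apply: measurable_shift_set; exact: measurable_cell.
apply: (le_trans (measure_cover mA measurable_box_set _)).
  have aux (s : R) : - (rho.+1%:R / K%:R) <= s < rho.+1%:R / K%:R ->
      0 <= s + rho.+1%:R / K%:R < n%:R / K%:R.
    by rewrite /n natrM => /andP[? ?]; apply/andP; split; lra.
  move=> z [/aux z1 /aux z2].
  have [k kn zk] := slot_exists K0 z1; have [l ln zl] := slot_exists K0 z2.
  by exists (Ordinal kn, Ordinal ln).
rewrite (eq_bigr (fun=> 1%:E * mu (cell K 0 0))%E); last first.
  by move=> p _; rewrite /A mu_shift ?mu_cell ?mul1e //; exact: measurable_cell.
by rewrite -ge0_sume_distrl // sumEFin sumr_const card_prod card_ord mulnn.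
Qed.

Variables (node : nat -> nat -> nat) (r : nat).
Hypothesis Hnode : forall k i, (k < K)%N -> (i < r)%N ->
  [/\ node k i < K, k <= node k i + rho & node k i <= k + rho]%N.
Variable f : mplane R -> R.
Hypothesis mf : measurable_fun setT f.

Let J := ('I_K * 'I_K * ('I_r * 'I_r))%type.
Let nd (j : J) : nat * nat := (node j.1.1 j.2.1, node j.1.2 j.2.2).
Let kl (j : J) : nat * nat := (val j.1.1, val j.1.2).

Definition cell_osc (j : J) (y : mplane R) : \bar R :=
  (\int[mu]_(z in C (kl j)) (`|f (y + grid K (nd j).1 (nd j).2) - f z| `^ e)%:E)%E.

(** The variables are the displacement v and the node y; the point z of the cell is v + y. In this
    form Tonelli's theorem can put v outside. *)
Let kernel (j : J) (vy : mplane R * mplane R) : R :=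
  \1_(C (nd j)) vy.2 * (\1_(C (kl j)) (vy.1 + vy.2) * `|f vy.2 - f (vy.1 + vy.2)| `^ e).

Lemma measurable_kernel j : measurable_fun setT (kernel j).
Proof.
have m12 : measurable_fun setT
    (fun vy : mplane R * mplane R => (vy.1.1 + vy.2.1, vy.1.2 + vy.2.2) : mplane R).
  apply: measurable_fun_pair; apply: measurable_funD.
  - by apply: (measurableT_comp (f := fst)) => //; exact: measurable_fst.
  - by apply: (measurableT_comp (f := fst)) => //; exact: measurable_snd.
  - by apply: (measurableT_comp (f := snd)) => //; exact: measurable_fst.
  - by apply: (measurableT_comp (f := snd)) => //; exact: measurable_snd.
apply: measurable_funM.
  have m1 : measurable_fun setT (\1_(C (nd j)) : mplane R -> R) by exact: measurable_indic.
  by apply: (measurableT_comp m1); exact: measurable_snd.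
apply: measurable_funM.
  have m1 : measurable_fun setT (\1_(C (kl j)) : mplane R -> R) by exact: measurable_indic.
  exact: (measurableT_comp m1 m12).
apply: (measurableT_comp (measurable_powR e)).
apply: (measurableT_comp (@normr_measurable R setT)).
apply: measurable_funB; first by apply: (measurableT_comp mf); exact: measurable_snd.
exact: (measurableT_comp mf m12).
Qed.

Lemma kernel_ge0 j vy : (0 <= (kernel j vy)%:E)%E.
Proof. by rewrite lee_fin !mulr_ge0 ?powR_ge0 // indicE. Qed.

Let mkernel j : measurable_fun setT (EFin \o kernel j).
Proof. by apply/measurable_EFinP; exact: measurable_kernel. Qed.

Lemma kernel_oscE j y : cell K 0 0 y ->
  cell_osc j y = fubini_G mu (EFin \o kernel j) (y + grid K (nd j).1 (nd j).2).
Proof.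
move=> y0; rewrite /fubini_G /cell_osc integral_indicM.
set y' := y + _.
have y'C : C (nd j) y'.
  by have := cell_shift (R := R) (nd j).1 (nd j).2 K0; rewrite /C => /seteqP[_ /(_ y y0)].
rewrite -(ge0_integral_shift y' measurableT); last 2 first.
- apply/measurable_EFinP; apply: measurable_funM; first exact: measurable_indic.
  apply: (measurableT_comp (measurable_powR e)).
  apply: (measurableT_comp (@normr_measurable R setT)).
  exact: measurable_funB.
- by move=> z _; rewrite lee_fin mulr_ge0 ?powR_ge0 // indicE.
apply: eq_integral => z _ /=; rewrite /kernel /= (_ : \1_(C (nd j)) y' = 1) ?mul1r //.
by rewrite indicE mem_set.
Qed.

Lemma measurable_cell_osc j : measurable_fun (cell K 0 0 : set (mplane R)) (cell_osc j).
Proof.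
apply: (@eq_measurable_fun _ _ _ _ _ (fun y : mplane R =>
    fubini_G mu (EFin \o kernel j) ((y : plane R) + grid K (nd j).1 (nd j).2)%R)).
  by move=> y; rewrite inE => y0; rewrite kernel_oscE.
apply: measurable_funTS.
apply: (measurableT_comp (f := fubini_G mu (EFin \o kernel j))).
  by apply: measurable_fun_fubini_tonelli_G => //; exact: kernel_ge0.
exact: measurable_addr_plane.
Qed.

(** While [y] runs through the corner cell, its node runs through the cell [nd j]. Enlarging this
    cell to the plane and exchanging the integrals puts the displacement outside. *)
Lemma integral_cell_osc j :
  (\int[mu]_(y in cell K 0 0) cell_osc j y <=
   \int[mu]_v fubini_F mu (EFin \o kernel j) v)%E.
Proof.
rewrite fubini_tonelli //; last exact: kernel_ge0.
rewrite (eq_integral (fun y : mplane R =>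
    fubini_G mu (EFin \o kernel j) ((y : plane R) + grid K (nd j).1 (nd j).2)%R)); last first.
  by move=> y; rewrite inE => y0; rewrite kernel_oscE.
rewrite -(cell_shift (R := R) (nd j).1 (nd j).2 K0).
have mG : measurable_fun setT (fubini_G mu (EFin \o kernel j)).
  by apply: measurable_fun_fubini_tonelli_G => //; exact: kernel_ge0.
have G0 y : (0 <= fubini_G mu (EFin \o kernel j) y)%E.
  by apply: integral_ge0 => v _; exact: kernel_ge0.
rewrite (ge0_integral_shift (grid K (nd j).1 (nd j).2) (mC (nd j))) //.
  by apply: ge0_subset_integral.
exact: measurable_funTS.
Qed.

Lemma sum_cell_indic (w : plane R) : \sum_(p : 'I_K * 'I_K) \1_(C (val p.1, val p.2)) w <= 1 :> R.
Proof.
have [[p0 Hp]|H] := pselect (exists p0 : 'I_K * 'I_K, C (val p0.1, val p0.2) w).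
  rewrite (bigD1 p0) //= big1 ?addr0 => [|p pp0].
    by rewrite indicE; case: (_ \in _).
  rewrite indicE; case: (boolP (_ \in _)) => //; rewrite inE => Hp'.
  case/negP: pp0; apply/eqP; case: p Hp' => k l; case: p0 Hp => k0 l0 /= [h1 h2] [h3 h4].
  by congr (_, _); apply: val_inj; [exact: slot_unique h3 h1|exact: slot_unique h4 h2].
rewrite big1 // => p _; rewrite indicE; case: (boolP (_ \in _)) => //.
by rewrite inE => Hp; case: H; exists p.
Qed.

Let osc (v y : plane R) : R :=
  \1_(usq `&` shift_set v usq) y * `|f (y + v) - f y| `^ e.

Lemma kernel_le (j : J) (v y : plane R) :
  kernel j (v, y) <= \1_(C (kl j)) (v + y) * (\1_box v * osc v y).
Proof.
case: j => -[k l] [i i']; rewrite /kernel /nd /kl /=.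
rewrite [\1_(C (node _ _, _)) y]indicE [\1_(C (_, _)) _]indicE.
have X0 : 0 <= \1_box v * osc v y :> R.
  by rewrite /osc !mulr_ge0 ?powR_ge0 // indicE.
case: (boolP (y \in C _)) => yC; rewrite ?mul0r; last by rewrite mulr_ge0.
case: (boolP (v + y \in C _)) => vyC; rewrite ?mul0r ?mulr0 // !mul1r.
move: yC vyC; rewrite !inE => yC vyC.
have [n1 n2 n3] := Hnode (ltn_ord k) (ltn_ord i).
have [m1 m2 m3] := Hnode (ltn_ord l) (ltn_ord i').
have yU : usq y by apply: cell_usq yC.
have vyU : usq (v + y) by exact: (cell_usq (ltn_ord k) (ltn_ord l) vyC).
have b1 := slot_near K0 n2 n3 vyC.1 yC.1; have b2 := slot_near K0 m2 m3 vyC.2 yC.2.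
rewrite addrK in b1; rewrite addrK in b2.
have vbox : box v.
  by move: b1 b2 => /andP[h1 h2] /andP[h3 h4]; split; apply/andP; split => //; apply: ltW.
rewrite /osc !indicE !mem_set //; last by split => //; rewrite /shift_set /= addrC.
by rewrite /= !mul1r distrC [v + y]addrC.
Qed.

(** v + y lies in at most one cell, so at most r^2 of the indices [j] contribute. Summing over all
    cells naively would cost a factor K^2 and destroy the contraction. *)
Lemma sum_kernel_le (v y : plane R) :
  \sum_(j : J) kernel j (v, y) <= \1_box v * ((r ^ 2)%:R * osc v y).
Proof.
have X0 : 0 <= \1_box v * osc v y :> R.
  by rewrite /osc !mulr_ge0 ?powR_ge0 // indicE.
rewrite (le_trans (ler_sum _ (fun j _ => kernel_le j v y))) // -mulr_suml.
rewrite [leRHS]mulrCA ler_wpM2r //.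
rewrite -(pair_bigA _ (fun (p : 'I_K * 'I_K) (q : 'I_r * 'I_r) => \1_(C (val p.1, val p.2)) (v + y))) /=.
rewrite (eq_bigr (fun p : 'I_K * 'I_K => (r ^ 2)%:R * \1_(C (val p.1, val p.2)) (v + y))).
  by rewrite -mulr_sumr ler_piMr // sum_cell_indic.
by move=> p _; rewrite sumr_const card_prod card_ord mulnn mulr_natl.
Qed.

Lemma cell_osc_ge0 j y : (0 <= cell_osc j y)%E.
Proof. by apply: integral_ge0 => z _; rewrite lee_fin powR_ge0. Qed.

(** For a fixed displacement v the inner integral is that of |f(. + v) - f|^e, at most [w1], and the
    displacements fill only [box]. *)
Lemma integral_sum_cell_osc (w1 : R) :
  (forall u : plane R, `|u.1| <= rho.+1%:R / K%:R -> `|u.2| <= rho.+1%:R / K%:R ->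
    (Lp_int (usq `&` shift_set u usq) (fun z => f ((z : plane R) + u) - f z)%R <= w1%:E)%E) ->
  (\int[mu]_(y in cell K 0 0) (\sum_j cell_osc j y) <= ((r ^ 2)%:R * w1)%:E * mu box)%E.
Proof.
move=> Hw1.
have mA (v : plane R) : measurable (usq `&` shift_set v usq : set (mplane R)).
  apply: measurableI; first exact: measurable_usq.
  exact: measurable_shift_set measurable_usq.
have osc0 v y : 0 <= osc v y by rewrite /osc mulr_ge0 ?powR_ge0 // indicE.
have mosc v : measurable_fun setT (osc v : mplane R -> R).
  apply: measurable_funM; first exact: measurable_indic.
  apply: (measurableT_comp (measurable_powR e)).
  apply: (measurableT_comp (@normr_measurable R setT)).
  apply: measurable_funB => //.
  exact: (measurableT_comp mf (measurable_addr_plane v)).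
have w10 : 0 <= w1.
  have h : `|(0 : plane R).1| <= rho.+1%:R / K%:R by rewrite normr0 divr_ge0.
  by have := Hw1 0 h h; rewrite -lee_fin; apply: le_trans; exact: Lp_int_ge0.
rewrite ge0_integral_sum; [|exact: measurable_cell|exact: measurable_cell_osc|].
  rewrite (le_trans (lee_sum _ (fun j _ => integral_cell_osc j))) //.
  have F0 j v : (0 <= fubini_F mu (EFin \o kernel j) v)%E.
    by apply: integral_ge0 => y _; exact: kernel_ge0.
  have mF j : measurable_fun setT (fubini_F mu (EFin \o kernel j)).
    by apply: measurable_fun_fubini_tonelli_F => //; exact: kernel_ge0.
  rewrite -ge0_integral_sum //.
  have -> : (((r ^ 2)%:R * w1)%:E * mu box = \int[mu]_v (((r ^ 2)%:R * w1) * \1_box v)%:E)%E.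
    under eq_integral do rewrite EFinM.
    rewrite ge0_integralZl_EFin ?mulr_ge0 //.
    - by rewrite integral_indic ?setIT //; exact: measurable_box_set.
    - by apply/measurable_EFinP; apply: measurable_indic; exact: measurable_box_set.
  apply: ge0_le_integral => //.
  - by move=> v _; rewrite sume_ge0.
  - exact: emeasurable_sum.
  - apply/measurable_EFinP; apply: measurable_funM => //.
    by apply: measurable_indic; exact: measurable_box_set.
  move=> v _; rewrite /fubini_F -ge0_integral_sum //; last 2 first.
  - move=> j; apply: measurableT_comp => //; exact: measurable_pair1.
  - by move=> j y _; exact: kernel_ge0.
  apply: (@le_trans _ _ (\int[mu]_y ((\1_box v * (r ^ 2)%:R)%:E * (osc v y)%:E))%E).
    apply: ge0_le_integral => //.
    - by move=> y _; rewrite sume_ge0 // => j _; exact: kernel_ge0.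
    - apply: emeasurable_sum => j.
      apply: measurableT_comp => //; exact: measurable_pair1.
    - by apply: measurable_funeM; apply/measurable_EFinP.
    - move=> y _; rewrite sumEFin -EFinM lee_fin -mulrA; exact: sum_kernel_le.
  rewrite ge0_integralZl_EFin //; last 2 first.
  - by move=> y _; rewrite lee_fin osc0.
  - exact/measurable_EFinP.
  rewrite -(integral_indicM (usq `&` shift_set v usq) (fun y => `|f ((y : plane R) + v) - f y| `^ e)).
  rewrite indicE; case: (boolP (v \in box)); last by rewrite !mul0r mulr0 mul0e.
  rewrite inE mul1r mulr1 EFinM => -[/andP[v1 v2] /andP[v3 v4]].
  rewrite lee_wpmul2l // ?lee_fin //; apply: Hw1; rewrite ler_norml; apply/andP; split => //; exact: ltW.
by move=> j y _; exact: cell_osc_ge0.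
Qed.

Lemma cell_cover z : usq z -> exists p : 'I_K * 'I_K, C (val p.1, val p.2) z.
Proof.
by move=> /(cell_exists K0)[k [l [kK lK zkl]]]; exists (Ordinal kK, Ordinal lK).
Qed.

Lemma cell_integral_bound (a b G : R) (y : mplane R) (h : mplane R -> R) :
  0 <= a -> 0 <= b -> 0 <= G -> measurable_fun setT h ->
  (forall k l z, (k < K)%N -> (l < K)%N -> cell K k l z ->
    `|h z| `^ e <= a * (\sum_(i < r) \sum_(i' < r)
       `|f ((y : plane R) + grid K (node k i) (node l i')) - f z| `^ e) + b * G) ->
  (Lp_int usq h <= a%:E * (\sum_j cell_osc j y) +
     (b * (K ^ 2)%:R * G)%:E * mu (cell K 0 0))%E.
Proof.
move=> a0 b0 G0 mh Hh.
pose A (p : 'I_K * 'I_K) := C (val p.1, val p.2).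
have mA p : measurable (A p) by exact: mC.
apply: (le_trans (Lp_int_cover mA measurable_usq _ _ cell_cover)).
- by move=> p; exact: measurable_funTS.
- exact: measurable_funTS.
pose o (p : 'I_K * 'I_K) (q : 'I_r * 'I_r) (z : mplane R) : R :=
  `|f ((y : plane R) + grid K (node p.1 q.1) (node p.2 q.2)) - f z| `^ e.
have o0 p q z : 0 <= o p q z by exact: powR_ge0.
have mo p q : measurable_fun setT (o p q).
  apply: (measurableT_comp (measurable_powR e)).
  apply: (measurableT_comp (@normr_measurable R setT)).
  exact: measurable_funB.
have Hp p : (Lp_int (A p) h <= a%:E * (\sum_q \int[mu]_(z in A p) (o p q z)%:E) +
    (b * G)%:E * mu (cell K 0 0))%E.
  apply: (@le_trans _ _ (\int[mu]_(z in A p) (a%:E * (\sum_q (o p q z)%:E) + (b * G)%:E))%E).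
    apply: ge0_le_integral => //.
    - by apply: measurable_normpow; exact: measurable_funTS.
    - apply: emeasurable_funD => //; apply: measurable_funeM.
      apply: emeasurable_sum => q; apply/measurable_EFinP; exact: measurable_funTS.
    - move=> z Az; rewrite sumEFin -EFinM -EFinD lee_fin.
      have := Hh _ _ _ (ltn_ord p.1) (ltn_ord p.2) Az.
      by rewrite (pair_bigA _ (fun i i' : 'I_r => `|f ((y : plane R) + grid K (node p.1 i) (node p.2 i')) - f z| `^ e)).
  have mo' q : measurable_fun (A p) (fun z => (o p q z)%:E).
    by apply/measurable_EFinP; exact: measurable_funTS.
  have os0 z : (0 <= \sum_q (o p q z)%:E)%E by apply: sume_ge0 => q _; rewrite lee_fin.
  rewrite ge0_integralD //; last 3 first.
  - by move=> z _; rewrite mule_ge0.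
  - by apply: measurable_funeM; exact: emeasurable_sum.
  - by move=> z _; rewrite lee_fin mulr_ge0.
  rewrite ge0_integralZl_EFin //; last exact: emeasurable_sum.
  rewrite ge0_integral_sum //; last by move=> q z _; rewrite lee_fin.
  have muA : mu (A p) = mu (cell K 0 0) by exact: mu_cell.
  have -> // : (\int[mu]_(z in A p) (b * G)%:E = (b * G)%:E * mu (cell K 0 0))%E.
  by rewrite -muA; exact: integral_cst.
rewrite (le_trans (lee_sum _ (fun p _ => Hp p))) // big_split /= leeD //.
  rewrite -ge0_sume_distrr; last first.
    by move=> p _; apply: sume_ge0 => q _; apply: integral_ge0 => z _; rewrite lee_fin.
  by rewrite pair_bigA lee_wpmul2l ?lee_fin.
have -> : (b * (K ^ 2)%:R * G = \sum_(p : 'I_K * 'I_K) b * G)%R.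
  by rewrite sumr_const card_prod card_ord mulnn -mulr_natl; ring.
by rewrite -sumEFin ge0_sume_distrl // => p _; rewrite lee_fin mulr_ge0.
Qed.

End averaging.

(** The bound of [cell_integral_bound], averaged over [y] in the corner cell, is at most [tt]; some
    [y] exceeds the average by at most 1. *)
Lemma Lp_le_avg (K r rho : nat) (T : finType) (node : nat -> nat -> nat)
    (a b w1 w2 : R) (f : plane R -> R) (x : R) (g : T -> plane R -> R) :
  (0 < K)%N -> 0 <= a -> 0 <= b ->
  (forall k i, (k < K)%N -> (i < r)%N ->
     [/\ node k i < K, k <= node k i + rho & node k i <= k + rho]%N) ->
  Lp_le usq f x ->
  (forall u, `|u.1| <= rho.+1%:R / K%:R -> `|u.2| <= rho.+1%:R / K%:R ->
     Lp_le (usq `&` shift_set u usq) (fun z => f (z + u) - f z) w1) ->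
  (forall t, Lp_le (cell K 0 0) (g t) w2) ->
  exists2 y, cell K 0 0 y & forall Q : plane R -> R,
    measurable_fun setT (Q : mplane R -> R) ->
    (forall k l z, (k < K)%N -> (l < K)%N -> cell K k l z ->
       `|f z - Q z| `^ e <=
         a * (\sum_(i < r) \sum_(j < r)
           `|f (y + ((node k i)%:R / K%:R, (node l j)%:R / K%:R)) - f z| `^ e) +
         b * \sum_t `|g t y| `^ e) ->
    Lp_le usq (fun z => f z - Q z)
      (a * (r ^ 2 * (2 * rho.+1) ^ 2)%:R * w1 + b * (K ^ 2 * #|T|)%:R * w2 + 1).
Proof.
move=> K0 a0 b0 Hnode [_ mf0 _] Hw1 Hg.
(* Tonelli's theorem wants a function measurable on the whole plane; the points that matter lie in
   the square, where [f0] is [f]. *)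
pose f0 : mplane R -> R := (f : mplane R -> R) \_ (usq : set (mplane R)).
have f0E z : usq z -> f0 z = f z by move=> Uz; rewrite /f0 patchE mem_set.
have mf : measurable_fun setT f0 := (measurable_restrictT _ measurable_usq).1 mf0.
have w10 : 0 <= w1.
  have h : `|(0 : plane R).1| <= rho.+1%:R / K%:R by rewrite normr0 divr_ge0.
  by have [_ _] := Hw1 0 h h; rewrite -lee_fin; apply: le_trans; exact: Lp_int_ge0.
have w2T : 0 <= #|T|%:R * w2.
  have [->|T0] := posnP #|T|; first by rewrite mul0r.
  have /card_gt0P[t _] := T0; rewrite mulr_ge0 //.
  by have [_ _] := Hg t; rewrite -lee_fin; apply: le_trans; exact: Lp_int_ge0.
pose tt := a * (r ^ 2 * (2 * rho.+1) ^ 2)%:R * w1 + b * (K ^ 2 * #|T|)%:R * w2.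
have B0 : 0 <= b * (K ^ 2 * #|T|)%:R * w2.
  by rewrite natrM -!mulrA; do 2 apply: mulr_ge0 => //.
have tt0 : 0 <= tt by rewrite addr_ge0 // !mulr_ge0.
have tt1 : 0 <= tt + 1 by exact: addr_ge0.
have Hw1' (u : plane R) : `|u.1| <= rho.+1%:R / K%:R -> `|u.2| <= rho.+1%:R / K%:R ->
    (Lp_int (usq `&` shift_set u usq) (fun z => f0 ((z : plane R) + u) - f0 z)%R <= w1%:E)%E.
  move=> u1 u2; have [_ _] := Hw1 u u1 u2; apply: le_trans; rewrite le_eqVlt; apply/orP; left.
  apply/eqP; apply: eq_integral => z; rewrite inE => -[z1 z2].
  by rewrite !f0E.
pose osc := @cell_osc K node r f0.
pose G (y : mplane R) := \sum_t `|g t y| `^ e.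
have G0 y : 0 <= G y by apply: sumr_ge0 => t _; exact: powR_ge0.
pose m := mu (cell K 0 0); have hm0 : (0 <= m)%E by exact: measure_ge0.
have mC := measurable_cell (R := R) K 0 0.
have H0 y : (0 <= a%:E * (\sum_j osc j y) + (b * (K ^ 2)%:R * G y)%:E * m)%E.
  rewrite adde_ge0 // mule_ge0 ?lee_fin ?mulr_ge0 //.
  by apply: sume_ge0 => j _; exact: cell_osc_ge0.
suff [y y0 Hy] : exists2 y, cell K 0 0 y &
    (a%:E * (\sum_j osc j y) + (b * (K ^ 2)%:R * G y)%:E * m <= (tt + 1)%:E)%E.
  exists y => // Q mQ HQ.
  have mfQ : measurable_fun setT (fun z : mplane R => f0 z - Q z) by exact: measurable_funB.
  suff : Lp_le usq (fun z => f0 z - Q z) (tt + 1).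
    by apply: Lp_le_ext => z Uz; rewrite f0E.
  split; [exact: measurable_usq|exact: measurable_funTS|].
  apply: le_trans Hy; apply: cell_integral_bound => // k l z kK lK zkl.
  rewrite f0E; last exact: cell_usq zkl.
  rewrite (le_trans (HQ k l z kK lK zkl)) // lerD2r ler_wpM2l //.
  apply: ler_sum => i _; apply: ler_sum => j _.
  have [n1 _ _] := Hnode k i kK (ltn_ord i); have [n2 _ _] := Hnode l j lK (ltn_ord j).
  rewrite [f0 (_ + _)]f0E //.
  apply: (cell_usq n1 n2).
  by have := cell_shift (R := R) (node k i) (node l j) K0 => /seteqP[_ /(_ y y0)].
have mle : (m < +oo)%E.
  rewrite (le_lt_trans _ mu_usq) // le_measure ?inE //; first exact: measurable_usq.
  exact: cell_usq.
(* An invariant measure may vanish on cells. Then there is no average, but both terms are zero at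
   any [y]. *)
have [m0|m0] := eqVneq m 0%E.
  exists (grid K 0 0); first exact: cell_grid.
  rewrite m0 mule0 adde0 big1 ?mule0 ?lee_fin // => j _.
  have mC' := measurable_cell (R := R) K j.1.1 j.1.2.
  have mo : measurable_fun (cell K j.1.1 j.1.2 : set (mplane R))
      (fun z : mplane R => (`|f0 (grid K 0 0 + grid K (node j.1.1 j.2.1) (node j.1.2 j.2.2)) - f0 z| `^ e)%:E).
    apply: (measurable_normpow (f := fun z => f0 (grid K 0 0 + grid K (node j.1.1 j.2.1) (node j.1.2 j.2.2)) - f0 z)).
    by apply: measurable_funTS; exact: measurable_funB.
  have mC0 : mu (cell K j.1.1 j.1.2) = 0%E by rewrite mu_cell.
  rewrite /osc /cell_osc -[RHS](integral_abs_eq0 mC' mo mC0).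
  by apply: eq_integral => z _; rewrite gee0_abs // lee_fin powR_ge0.
have mpos : (0 < m)%E by rewrite lt_neqAle eq_sym m0 measure_ge0.
have mfin : m \is a fin_num by rewrite ge0_fin_numE ?ltW.
have mg t : measurable_fun (cell K 0 0 : set (mplane R)) (fun y => (`|g t y| `^ e)%:E).
  by apply: measurable_normpow; case: (Hg t).
have mG : measurable_fun (cell K 0 0 : set (mplane R)) (fun y => (G y)%:E).
  rewrite /G; under eq_fun do rewrite -sumEFin.
  exact: emeasurable_sum.
have mosc : measurable_fun (cell K 0 0 : set (mplane R)) (fun y => (\sum_j osc j y)%E).
  by apply: emeasurable_sum => j; exact: measurable_cell_osc.
have osc0 y : (0 <= \sum_j osc j y)%E by apply: sume_ge0 => j _; exact: cell_osc_ge0.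
have GE y : ((b * (K ^ 2)%:R * G y)%:E * m = (b * (K ^ 2)%:R * fine m)%:E * (G y)%:E)%E.
  by rewrite -(fineK mfin) -!EFinM; congr EFin; rewrite /=; ring.
have mh : measurable_fun (cell K 0 0 : set (mplane R))
    (fun y => a%:E * (\sum_j osc j y) + (b * (K ^ 2)%:R * G y)%:E * m)%E.
  apply: emeasurable_funD; first exact: measurable_funeM.
  by under eq_fun do rewrite GE; exact: measurable_funeM.
apply: integral_le_average => //; rewrite -/m.
rewrite ge0_integralD //; last 4 first.
- by move=> y _; rewrite mule_ge0.
- exact: measurable_funeM.
- by move=> y _; rewrite mule_ge0 // lee_fin !mulr_ge0.
- by under eq_fun do rewrite GE; exact: measurable_funeM.
have A0 : 0 <= a * (r ^ 2 * (2 * rho.+1) ^ 2)%:R * w1 by rewrite !mulr_ge0.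
(* The oscillations give r^2 w1 mu(box), and [mu_box] extracts [m]; in the other term [m] is already
   a factor. *)
rewrite /tt EFinD ge0_muleDl ?lee_fin //.
apply: leeD.
  rewrite ge0_integralZl_EFin // natrM -!mulrA EFinM -muleA lee_wpmul2l ?lee_fin //.
  have H := integral_sum_cell_osc K0 Hnode mf Hw1'.
  apply: le_trans H _.
  have H' : (((r ^ 2)%:R * w1)%:E * mu (box K rho) <=
      ((r ^ 2)%:R * w1)%:E * (((2 * rho.+1) ^ 2)%:R%:E * m))%E.
    rewrite lee_wpmul2l ?lee_fin ?mulr_ge0 //; exact: mu_box.
  apply: (le_trans H'); rewrite muleA -EFinM.
  by rewrite [X in (_ <= X%:E * _)%E](_ : _ = (r ^ 2)%:R * w1 * ((2 * rho.+1) ^ 2)%:R) //; ring.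
under eq_integral do rewrite GE.
rewrite ge0_integralZl_EFin //; last 2 first.
- by move=> y _; rewrite lee_fin.
- by rewrite !mulr_ge0 // fine_ge0.
have HG : (\int[mu]_(y in cell K 0 0) (G y)%:E <= (#|T|%:R * w2)%:E)%E.
  rewrite /G; under eq_integral do rewrite -sumEFin.
  rewrite ge0_integral_sum //.
  have Hgt t : true -> (\int[mu]_(y in cell K 0 0) (`|g t y| `^ e)%:E <= w2%:E)%E.
    by move=> _; case: (Hg t).
  rewrite (le_trans (lee_sum _ Hgt)) // sumEFin sumr_const.
  by rewrite lee_fin mulr_natl.
apply: (le_trans (lee_wpmul2l _ HG)); first by rewrite lee_fin !mulr_ge0 // fine_ge0.
rewrite -[X in (_ <= _ * X)%E](fineK mfin) -!EFinM lee_fin natrM.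
by rewrite le_eqVlt; apply/orP; left; apply/eqP; ring.
Qed.

Lemma Lp_le_ge0 A f x : Lp_le A f x -> 0 <= x.
Proof. by case=> _ _ h; rewrite -lee_fin; apply: le_trans h; exact: Lp_int_ge0. Qed.

Lemma Lp_le_weak A f x y : x <= y -> Lp_le A f x -> Lp_le A f y.
Proof. by move=> xy [mA mf h]; split => //; rewrite (le_trans h) ?lee_fin. Qed.

Definition Lp_gauge : gauge e :=
  Gauge Lp_le_ge0 Lp_le_sub Lp_le_weak
    Lp_le_union Lp_le_shift Lp_le_add Lp_le_scale Lp_le_ext Lp_le_avg.

End Lp_gauge.

(** * Inscribed parallelograms of maximal area *)

Section geometry.
Context {R : realType}.
Implicit Types (G : set (plane R)) (u v x y z : plane R).

Definition seg_convex G := forall x y l, G x -> G y -> 0 <= l <= 1 ->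
  G (x + l *: (y - x)).

Lemma convex_set_seg G : convex_set (G : set (convex_lmodType (plane R))) -> seg_convex G.
Proof.
move=> cG x y l Gx Gy l01.
have := cG y x (Itv01 (andP l01).1 (andP l01).2).
rewrite !inE => /(_ Gy Gx).
rewrite /conv /= /unstable.onem => H; rewrite scalerBr addrA addrAC addrC.
by move: H; rewrite scalerBl scale1r.
Qed.

Definition det2 u v : R := u.1 * v.2 - u.2 * v.1.

(* No parallelogram with its four vertices in [G] has a larger area than the unit
   square. *)
Record max_parallelogram G : Prop := MaxParallelogram {
  mp_cvx : seg_convex G;
  mp00 : G (0, 0); mp10 : G (1, 0); mp01 : G (0, 1); mp11 : G (1, 1);
  mp_max : forall p q w, G p -> G (p + q) -> G (p + w) -> G (p + q + w) ->
    `|det2 q w| <= 1 }.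

Lemma plane_eq x y : x.1 = y.1 -> x.2 = y.2 -> x = y.
Proof. by case: x => ? ?; case: y => ? ? /= -> ->. Qed.

Lemma seg_pt G x y l z : seg_convex G -> G x -> G y -> 0 <= l <= 1 ->
  z.1 = x.1 + l * (y.1 - x.1) -> z.2 = x.2 + l * (y.2 - x.2) -> G z.
Proof.
move=> cG Gx Gy l01 z1 z2; rewrite (_ : z = x + l *: (y - x)); first exact: cG.
exact: plane_eq.
Qed.

(* If [G] contained a point (1 + al, 1 + be), the parallelogram with the wider side
   [1 + de] given by these coefficients would fit in [G] and have area > 1. *)
Lemma corner_coefficients (al be : R) : 0 < al -> 0 < be ->
  exists de la mu ka, [/\ 0 < de, 0 <= la <= 1, 0 <= mu <= 1, 0 <= ka <= 1 &
    [/\ 1 + de = la * (1 + al), de = mu * al &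
        la * be = mu * (1 + be) + ka * (1 + la * be - mu * (1 + be))]].
Proof.
move=> al0 be0.
have al1 : 0 < 1 + al by lra.
have be1 : 0 < 1 + be by lra.
have ab1 : 0 < (1 + al) * (1 + be) by rewrite mulr_gt0.
pose de := al * be / ((1 + al) * (1 + be)); pose la := (1 + de) / (1 + al).
pose mu := be / ((1 + al) * (1 + be)).
have de0 : 0 < de by rewrite divr_gt0 // mulr_gt0.
have deal : de <= al by rewrite ler_pdivrMr //; nra.
have h : mu * (1 + be) <= la * be.
  have -> : mu * (1 + be) = be / (1 + al) by rewrite /mu; field; apply/andP; split; lra.
  have -> : la * be = be / (1 + al) * (1 + de) by rewrite /la; field; lra.
  by rewrite ler_peMr ?lerDl ?(ltW de0) // divr_ge0 ?(ltW be0) ?(ltW al1).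
have mu0 : 0 <= mu by rewrite divr_ge0 ?(ltW be0) ?(ltW ab1).
have la0 : 0 <= la by rewrite divr_ge0 ?(ltW al1) //; lra.
have dpos : 0 < 1 + la * be - mu * (1 + be) by lra.
exists de, la, mu, ((la * be - mu * (1 + be)) / (1 + la * be - mu * (1 + be))).
split => //.
- by rewrite la0 /= ler_pdivrMr // mul1r lerD2l.
- by rewrite mu0 /= ler_pdivrMr // mul1r; nra.
- by apply/andP; split; [apply: divr_ge0; lra|rewrite ler_pdivrMr // mul1r; lra].
- split.
  + by rewrite /la; field; lra.
  + by rewrite /mu /de; field; apply/andP; split; lra.
  + by field; lra.
Qed.

Lemma corner_empty G z : max_parallelogram G -> G z -> ~ (1 < z.1 /\ 1 < z.2).
Proof.
move=> [cG g00 g10 g01 g11 mx] Gz [z1 z2].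
have [al [al0 z1E]] : exists al : R, 0 < al /\ z.1 = 1 + al.
  by exists (z.1 - 1); rewrite subr_gt0 addrC subrK.
have [be [be0 z2E]] : exists be : R, 0 < be /\ z.2 = 1 + be.
  by exists (z.2 - 1); rewrite subr_gt0 addrC subrK.
have [de [la [mu [ka [de0 la01 mu01 ka01 [e1 e2 e3]]]]]] := corner_coefficients al0 be0.
(* On the line x = 1 + de, [GC] is on the segment from (0, 1) to z, [GL] on that from (1, 0) to z,
   and [GB] between them, exactly 1 below [GC]. With (0, 0) and (0, 1), [GB] and [GC] span area 1 +
   de. *)
have GC : G (1 + de, 1 + la * be).
  by apply: (seg_pt cG g01 Gz la01) => /=; rewrite ?z1E ?z2E ?e1; ring.
have GL : G (1 + de, mu * (1 + be)).
  by apply: (seg_pt cG g10 Gz mu01) => /=; rewrite ?z1E ?z2E ?e2; ring.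
have GB : G (1 + de, la * be).
  apply: (seg_pt cG GL GC ka01) => /=; first by ring.
  by rewrite {1}e3; ring.
have := mx 0 (1 + de, la * be) (0, 1) g00.
rewrite !add0r => /(_ GB g01).
have -> : ((1 + de, la * be) : plane R) + (0, 1) = (1 + de, 1 + la * be).
  by apply: plane_eq => /=; [rewrite addr0|rewrite addrC].
move=> /(_ GC); rewrite /det2 /= mulr0 subr0 mulr1 => /(le_trans (ler_norm _)).
by rewrite gerDl leNgt de0.
Qed.

(** Symmetries of the unit square, reducing its four corners to one. *)
Definition reflect (d1 d2 : bool) z : plane R :=
  (if d1 then 1 - z.1 else z.1, if d2 then 1 - z.2 else z.2).

Lemma max_parallelogram_reflect d1 d2 G : max_parallelogram G ->
  max_parallelogram (fun z => G (reflect d1 d2 z)).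
Proof.
move=> [cG g00 g10 g01 g11 mx]; split.
- move=> x y l Gx Gy l01; apply: (seg_pt cG Gx Gy l01).
    have e1 : (x + l *: (y - x)).1 = x.1 + l * (y.1 - x.1) by [].
    by rewrite /reflect e1; case: (d1) => /=; ring.
  have e2 : (x + l *: (y - x)).2 = x.2 + l * (y.2 - x.2) by [].
  by rewrite /reflect e2; case: (d2) => /=; ring.
- by rewrite /reflect /=; case: d1; case: d2; rewrite ?subr0.
- by rewrite /reflect /=; case: d1; case: d2; rewrite ?subr0 ?subrr.
- by rewrite /reflect /=; case: d1; case: d2; rewrite ?subr0 ?subrr.
- by rewrite /reflect /=; case: d1; case: d2; rewrite ?subrr.
- move=> p q w Gp Gpq Gpw Gpqw.
  pose s d (t : R) := if d then - t else t.
  have sh z t : reflect d1 d2 (z + t) = reflect d1 d2 z + (s d1 t.1, s d2 t.2).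
    by apply: plane_eq; rewrite /reflect /s /=; [case: (d1)|case: (d2)] => //; ring.
  have := mx _ (s d1 q.1, s d2 q.2) (s d1 w.1, s d2 w.2) Gp.
  rewrite -!sh => /(_ Gpq Gpw Gpqw); congr (_ <= _).
  rewrite /det2 /s /=; case: (d1); case: (d2) => //.
  + by congr `|_|; ring.
  + by rewrite -normrN; congr `|_|; ring.
  + by rewrite -normrN; congr `|_|; ring.
Qed.

Lemma max_parallelogram_cross G z : max_parallelogram G -> G z ->
  0 <= z.1 <= 1 \/ 0 <= z.2 <= 1.
Proof.
move=> mG Gz.
have refK d1 d2 : reflect d1 d2 (reflect d1 d2 z) = z.
  by apply: plane_eq; rewrite /reflect /=; [case: d1|case: d2]; rewrite ?subKr.
have H d1 d2 : ~ (1 < (reflect d1 d2 z).1 /\ 1 < (reflect d1 d2 z).2).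
  by apply: (corner_empty (max_parallelogram_reflect d1 d2 mG)); rewrite /= refK.
have [h1|/negP h1] := boolP (0 <= z.1 <= 1); first by left.
have [h2|/negP h2] := boolP (0 <= z.2 <= 1); first by right.
have out (t : R) : ~ (0 <= t <= 1) -> exists d : bool, 1 < (if d then 1 - t else t).
  move=> ht; have [t1|t1] := ltP 1 t; first by exists false.
  exists true; rewrite ltrDl oppr_gt0 ltNge; apply/negP => t0; apply: ht.
  by rewrite t0.
have [d1 hd1] := out _ h1; have [d2 hd2] := out _ h2.
by case: (H d1 d2).
Qed.

(** 0 and the midpoints of 0 and z, of 0 and (0, 1), and of (0, 1) and z form a parallelogram of
    area |z.1| / 4. The lower bound -3 = 1 - 4 follows by reflection. *)
Lemma max_parallelogram_bound1 G z : max_parallelogram G -> G z -> z.1 <= 4.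
Proof.
move=> [cG g00 g10 g01 g11 mx] Gz.
have half : 0 <= (2^-1 : R) <= 1 by rewrite invr_ge0 ler0n invf_le1 ?ler1n ?ltr0n.
have G1 : G (z.1 / 2, z.2 / 2) by apply: (seg_pt cG g00 Gz half) => /=; field.
have G2 : G (0, 1 / 2) by apply: (seg_pt cG g00 g01 half) => /=; field.
have G3 : G (z.1 / 2, z.2 / 2 + 1 / 2).
  by apply: (seg_pt cG g01 Gz half) => /=; field.
have := mx 0 (z.1 / 2, z.2 / 2) (0, 1 / 2) g00.
rewrite !add0r => /(_ G1 G2).
have -> : ((z.1 / 2, z.2 / 2) : plane R) + (0, 1 / 2) = (z.1 / 2, z.2 / 2 + 1 / 2).
  by apply: plane_eq => //=; rewrite addr0.
move=> /(_ G3); rewrite /det2 /= => /(le_trans (ler_norm _)).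
lra.
Qed.

Lemma max_parallelogram_swap G : max_parallelogram G ->
  max_parallelogram (fun z => G (z.2, z.1)).
Proof.
move=> [cG g00 g10 g01 g11 mx]; split => //.
- by move=> x y l Gx Gy l01; apply: (seg_pt cG Gx Gy l01).
- move=> p q w Gp Gpq Gpw Gpqw.
  have := mx _ (q.2, q.1) (w.2, w.1) Gp Gpq Gpw Gpqw.
  by rewrite -normrN; congr (`|_| <= _); rewrite /det2 /=; ring.
Qed.

Lemma max_parallelogram_bound G d z : max_parallelogram G -> G z -> -3 <= coord d z <= 4.
Proof.
have key H y : max_parallelogram H -> H y -> -3 <= y.1 <= 4.
  move=> mH Hy; rewrite (max_parallelogram_bound1 mH Hy) andbT.
  have := @max_parallelogram_bound1 _ (reflect true false y) (max_parallelogram_reflect true false mH).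
  rewrite /= /reflect /= subKr -surjective_pairing => /(_ Hy); lra.
case: d => mG Gz; last exact: key mG Gz.
by apply: (key _ (z.2, z.1) (max_parallelogram_swap mG)); rewrite /= -surjective_pairing.
Qed.

Lemma max_parallelogram_normalized G : measurable (G : set (mplane R)) ->
  max_parallelogram G -> normalized G.
Proof.
move=> mG mp; have [cG g00 g10 g01 g11 _] := mp; split => //.
- move=> d z a b c Ga Gb /andP[ac cb].
  have [ab|ab] := eqVneq a b.
    by have -> : c = a by apply/eqP; rewrite eq_le ac ab cb.
  have ab' : 0 < b - a by rewrite subr_gt0 lt_neqAle ab (le_trans ac).
  have l01 : 0 <= (c - a) / (b - a) <= 1.
    by apply/andP; split; [apply: divr_ge0; lra|rewrite ler_pdivrMr // mul1r; lra].
  have h : c = a + (c - a) / (b - a) * (b - a) by field; rewrite gt_eqF.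
  by apply: (seg_pt cG Ga Gb l01); case: d {Ga Gb} => /=; rewrite {1}h; ring.
- move=> z z1 z2.
  have G1 : G (z.1, 0) by apply: (seg_pt cG g00 g10 z1) => /=; ring.
  have G2 : G (z.1, 1) by apply: (seg_pt cG g01 g11 z1) => /=; ring.
  by apply: (seg_pt cG G1 G2 z2) => /=; ring.
- by move=> d z Gz; exact: max_parallelogram_bound mp Gz.
- by move=> z Gz; exact: max_parallelogram_cross mp Gz.
Qed.

End geometry.

(** * Coordinates and existence of a maximal parallelogram *)

Section frame.
Context {R : realType}.
Implicit Types (G : set (plane R)) (o a b u v x y z : plane R).

Definition from_frame o a b z : plane R := o + (z.1 *: a + z.2 *: b).

(** Cramer's rule. *)
Definition to_frame o a b x : plane R :=
  (det2 (x - o) b / det2 a b, det2 a (x - o) / det2 a b).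

Lemma to_frameK o a b : det2 a b != 0 -> cancel (to_frame o a b) (from_frame o a b).
Proof.
move=> D0 x; apply: plane_eq; rewrite /from_frame /to_frame /=.
  by move: D0; rewrite /det2 /GRing.scale /= => D0; field.
by move: D0; rewrite /det2 /GRing.scale /= => D0; field.
Qed.

Lemma from_frameK o a b : det2 a b != 0 -> cancel (from_frame o a b) (to_frame o a b).
Proof.
move=> D0 z; rewrite /from_frame /to_frame (addrC o) addrK; apply: plane_eq => /=.
  by move: D0; rewrite /det2 /= /GRing.scale /= => D0; field.
by move: D0; rewrite /det2 /= /GRing.scale /= => D0; field.
Qed.

Lemma det2_frame a b q w :
  det2 (q.1 *: a + q.2 *: b) (w.1 *: a + w.2 *: b) = det2 q w * det2 a b.
Proof. by rewrite /det2 /= /GRing.scale /=; ring. Qed.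

Lemma from_frameD o a b p q :
  from_frame o a b (p + q) = from_frame o a b p + (q.1 *: a + q.2 *: b).
Proof.
by rewrite /from_frame /= !scalerDl -!addrA; congr (o + (_ + _)); rewrite addrCA.
Qed.

Lemma continuous_det2 (T : topologicalType) (f g : T -> plane R) :
  continuous f -> continuous g -> continuous (fun t => det2 (f t) (g t)).
Proof.
move=> cf cg t; rewrite /det2.
have c1 (h : T -> plane R) : continuous h -> (fun s => (h s).1 : R^o) @ t --> ((h t).1 : R^o).
  by move=> ch; apply: (@continuous_comp _ _ _ h fst); [exact: ch|exact: cvg_fst].
have c2 (h : T -> plane R) : continuous h -> (fun s => (h s).2 : R^o) @ t --> ((h t).2 : R^o).
  by move=> ch; apply: (@continuous_comp _ _ _ h snd); [exact: ch|exact: cvg_snd].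
by apply: cvgB; apply: cvgM; [exact: c1|exact: c2|exact: c2|exact: c1].
Qed.

(** Three vertices A, B, D determine the parallelogram, and B + D - A in [G] is a closed condition,
    so the signed area has a maximum on a compact set. It is positive because an interior point is
    the corner of a small square in [G]. *)
Lemma max_parallelogram_frame G : convex_body G -> exists o a b,
  0 < det2 a b /\ max_parallelogram (fun z => G (from_frame o a b z)).
Proof.
move=> [compG convG [c Gc]].
have sG := convex_set_seg convG.
pose A (t : plane R * plane R * plane R) := t.1.1.
pose B (t : plane R * plane R * plane R) := t.1.2.
pose D (t : plane R * plane R * plane R) := t.2.
have cA : continuous A.
  by move=> t; apply: (@continuous_comp _ _ _ fst fst); exact: cvg_fst.
have cB : continuous B.
  by move=> t; apply: (@continuous_comp _ _ _ fst snd); [exact: cvg_fst|exact: cvg_snd].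
have cD : continuous D by move=> t; exact: cvg_snd.
pose S := (G `*` G `*` G) `&` [set t | G (B t + D t - A t)].
have compS : compact S.
  apply: compact_closedI; first by apply: compact_setX => //; exact: compact_setX.
  have cG : closed G by apply: compact_closed => //; exact: norm_hausdorff.
  apply: (@closed_comp _ _ (fun t => B t + D t - A t)) cG => t _.
  by apply: cvgB; [apply: cvgD; [exact: cB|exact: cD]|exact: cA].
pose f t := det2 (B t - A t) (D t - A t).
have cf : continuous f.
  by apply: continuous_det2 => t; apply: cvgB; [exact: cB|exact: cA|exact: cD|exact: cA].
have [t0 St0 ft0] : exists2 t, S t & 0 < f t.
  have /nbhs_ballP[e /= e0 He] := Gc.
  have e20 : 0 < e / 2 by rewrite divr_gt0.
  have Gx (s t : R) : 0 <= s <= e / 2 -> 0 <= t <= e / 2 -> G (c + (s, t)).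
    move=> /andP[s0 s1] /andP[u0 u1]; apply: He; split; rewrite /ball /= opprD addNKr normrN ger0_norm //; lra.
  have i0 : 0 <= (0 : R) <= e / 2 by rewrite lexx ltW.
  have i1 : 0 <= e / 2 <= e / 2 by rewrite lexx ltW.
  exists (c + (0, 0), c + (e / 2, 0), c + (0, e / 2)).
    split; first by split; [split|]; apply: Gx.
    rewrite /= /B /D /A /=.
    have -> : c + (e / 2, 0) + (c + (0, e / 2)) - (c + (0, 0)) = c + (e / 2, e / 2) :> plane R.
      by apply: plane_eq => /=; ring.
    exact: Gx.
  rewrite /f /B /D /A /det2 /= (_ : _ - _ = (e / 2) ^+ 2) ?exprn_gt0 //; ring.
have [t St Ht] := compact_EVT_max (ex_intro S t0 St0) compS (continuous_subspaceT cf).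
rewrite inE in St.
have Df : 0 < f t by rewrite (lt_le_trans ft0) // Ht // inE.
exists (A t), (B t - A t), (D t - A t); split => //.
have ptE z x : x.1 = z.1 * (B t - A t).1 + z.2 * (D t - A t).1 + (A t).1 ->
   x.2 = z.1 * (B t - A t).2 + z.2 * (D t - A t).2 + (A t).2 ->
   from_frame (A t) (B t - A t) (D t - A t) z = x.
  by move=> x1 x2; apply: plane_eq; rewrite /from_frame ?x1 ?x2 addrC.
case: St => -[[GA GB] GD] GC; split.
- move=> x y l Gx Gy l01.
  have -> : from_frame (A t) (B t - A t) (D t - A t) (x + l *: (y - x)) =
    from_frame (A t) (B t - A t) (D t - A t) x + l *: (from_frame (A t) (B t - A t) (D t - A t) y
     - from_frame (A t) (B t - A t) (D t - A t) x).
    by apply: plane_eq; rewrite /from_frame /= /GRing.scale /=; ring.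
  exact: sG.
- by rewrite (ptE _ (A t)) //= !mul0r !add0r.
- by rewrite (ptE _ (B t)) //=; ring.
- by rewrite (ptE _ (D t)) //=; ring.
- by rewrite (ptE _ (B t + D t - A t)) //=; ring.
- move=> p q w Gp Gpq Gpw Gpqw.
  set o := A t; set a := B t - A t; set b := D t - A t; rewrite -/o -/a -/b in Gp Gpq Gpw Gpqw.
  (* The frame divides areas by the maximal one. Signed areas suffice, since exchanging q and w
     changes the sign. *)
  have key q' w' : G (from_frame o a b (p + q')) -> G (from_frame o a b (p + w')) ->
      G (from_frame o a b (p + q' + w')) -> det2 q' w' <= 1.
    move=> G1 G2 G3.
    pose P := from_frame o a b p.
    have uE r : from_frame o a b (p + r) - P = r.1 *: a + r.2 *: b.
      by rewrite from_frameD addrC addrA addNr add0r.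
    have sE : from_frame o a b (p + q') + from_frame o a b (p + w') - P = from_frame o a b (p + q' + w').
      by rewrite -addrA uE -from_frameD.
    have := Ht (P, from_frame o a b (p + q'), from_frame o a b (p + w')).
    rewrite /f /A /B /D /= !uE det2_frame -[det2 _ _ <= 1](ler_pM2r Df) mul1r; apply.
    rewrite inE; split; first by split; [split|].
    by rewrite /A /B /D /= sE.
  rewrite ler_norml; apply/andP; split; last exact: key.
  rewrite lerNl; have -> : - det2 q w = det2 w q by rewrite /det2; ring.
  by apply: key => //; rewrite addrAC.
Qed.

End frame.

(** * Lebesgue measure in the coordinates of a parallelogram *)

Section plane_measure.
Context {R : realType}.

Lemma lebesgue_measure_shift (c : R) (A : set (measurableTypeR R)) :
  measurable A -> lebesgue_measure [set x | A (x + c)] = lebesgue_measure A.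
Proof.
move=> mA.
have mf : measurable_fun setT (fun x : measurableTypeR R => x + c : measurableTypeR R).
  by apply: measurable_funD => //; exact: measurable_cst.
have H := @lebesgue_measure_unique R
  (pushforward lebesgue_measure (fun x : measurableTypeR R => x + c : measurableTypeR R)).
rewrite [RHS](H mf _ A mA) // => X [[a b] _ <-] /=.
rewrite /pushforward.
have -> : (fun x : measurableTypeR R => x + c) @^-1` [set` `]a, b]] = [set` `]a - c, b - c]].
  by apply/seteqP; split => x /=; rewrite !in_itv /= ltrBlDr lerBrDr.
rewrite !lebesgue_measure_itv /= !lte_fin ltrD2r; case: ifP => // _.
by rewrite -!EFinB; congr EFin; ring.
Qed.

Lemma leb2X (X Y : set (measurableTypeR R)) : measurable X -> measurable Y ->
  leb2 (X `*` Y) = (lebesgue_measure X * lebesgue_measure Y)%E.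
Proof. by move=> mX mY; exact: product_measure1E. Qed.

(** Uniqueness of the product measure, tested on rectangles. *)
Lemma leb2_shift (v : plane R) (A : set (plane R)) : measurable (A : set (mplane R)) ->
  leb2 (shift_set v A) = leb2 (A : set (mplane R)).
Proof.
move=> mA.
have mf := measurable_addr_plane v.
have H := @product_measure_unique _ _ _ _ R (@lebesgue_measure R) (@lebesgue_measure R)
  (pushforward leb2 (fun z : mplane R => (z.1 + v.1, z.2 + v.2) : mplane R)).
rewrite [RHS](H mf _ A mA) // => X Y mX mY.
rewrite -[LHS]/(leb2 ([set x | X (x + v.1)] `*` [set x | Y (x + v.2)])).
have mX' (c : R) (Z : set (measurableTypeR R)) : measurable Z ->
    measurable ([set x | Z (x + c)] : set (measurableTypeR R)).
  move=> mZ; have := @measurable_funD _ (measurableTypeR R) R setT id (cst c)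
    (@measurable_id _ _ _) (measurable_cst _).
  by move=> /(_ measurableT Z mZ); rewrite setTI.
rewrite leb2X; [|exact: mX'|exact: mX'].
by rewrite !lebesgue_measure_shift.
Qed.

(** The sigma-algebra of [mplane] is a product; the link with the topology is that an open set is
    the union of the countably many rational boxes inside it. *)
Lemma open_measurable_plane (U : set (plane R)) : open U ->
  measurable (U : set (mplane R)).
Proof.
move=> oU.
pose bx (a b c d : rat) : set (plane R) :=
  [set x | (x.1 \in `]ratr a, ratr b[) /\ (x.2 \in `]ratr c, ratr d[)].
have -> : U = \bigcup_(a : rat) \bigcup_(b : rat) \bigcup_(c : rat) \bigcup_(d : rat)
    (if pselect (bx a b c d `<=` U) then bx a b c d else set0).
  apply/seteqP; split => x.
    move=> Ux; have /nbhs_ballP[e /= e0 He] := open_nbhs_nbhs (conj oU Ux).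
    have near (t : R) : exists a b : rat, (t \in `]ratr a, ratr b[) /\
        forall s : R, (s \in `]ratr a, ratr b[) -> ball t e s.
      have h1 : t - e < t by rewrite gtrDl oppr_lt0.
      have h2 : t < t + e by rewrite ltrDl.
      have [a] := rat_in_itvoo h1; have [b] := rat_in_itvoo h2.
      rewrite !in_itv /= => /andP[b1 b2] /andP[a1 a2]; exists a, b; split.
        by rewrite in_itv /= a2 b1.
      move=> s; rewrite in_itv /= => /andP[s1 s2]; rewrite /ball /= ltr_norml.
      by apply/andP; split; lra.
    have [a [b [x1 Hab]]] := near x.1; have [c [d [x2 Hcd]]] := near x.2.
    exists a => //; exists b => //; exists c => //; exists d => //.
    case: pselect => // H; exfalso; apply: H => y [y1 y2]; apply: He; split.
      exact: Hab.
    exact: Hcd.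
  by move=> [a _ [b _ [c _ [d _]]]]; case: pselect => // H; exact: H.
apply: bigcupT_measurable_rat => a; apply: bigcupT_measurable_rat => b.
apply: bigcupT_measurable_rat => c; apply: bigcupT_measurable_rat => d.
case: (pselect (bx a b c d `<=` U)) => H /=; last exact: measurable0.
exact: (measurable_box `]ratr a, ratr b[ `]ratr c, ratr d[).
Qed.

Lemma compact_measurable_plane (G : set (plane R)) : compact G ->
  measurable (G : set (mplane R)).
Proof.
move=> cG; have clG : closed G by apply: compact_closed => //; exact: norm_hausdorff.
rewrite -[G]setCK; apply: measurableC; apply: open_measurable_plane.
exact: closed_openC.
Qed.

Lemma leb2_box_lty (M : R) : (leb2 ([set` `[- M, M]%R] `*` [set` `[- M, M]%R] : set (mplane R)) < +oo)%E.
Proof.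
rewrite leb2X //.
rewrite lebesgue_measure_itv /=; case: ifP => _; last by rewrite mul0e.
by rewrite -EFinB -EFinM ltry.
Qed.

End plane_measure.

Section frame_measure.
Context {R : realType}.
Variables (o a b : plane R).
Hypothesis ab0 : det2 a b != 0.

Let phi : mplane R -> mplane R := from_frame o a b.
Let sig : mplane R -> mplane R := to_frame o a b.

Lemma measurable_from_frame : measurable_fun setT phi.
Proof.
apply: measurable_fun_pair; (apply: measurable_funD; first exact: measurable_cst);
  by apply: measurable_funD; apply: measurable_funM => //; first [exact: measurable_fst|exact: measurable_snd].
Qed.

Lemma measurable_to_frame : measurable_fun setT sig.
Proof.
by apply: measurable_fun_pair; rewrite /det2 /=; apply: measurable_funM => //;
  apply: measurable_funB; apply: measurable_funM => //;
  apply: measurable_funB => //; first [exact: measurable_fst|exact: measurable_snd].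
Qed.

(** As an image measure it turns integrals over [G] into integrals in coordinates without a
    Jacobian. What remains to check is sigma-finiteness, invariance, and finiteness on the
    square. *)
Definition frame_measure : set (mplane R) -> \bar R := pushforward leb2 sig.

(* The library instance on [pushforward] takes a measurability proof as argument. *)
Let frame_measure' : {measure set (mplane R) -> \bar R} :=
  @measure_function_pushforward__canonical__measure_function_Measure
    _ _ _ _ R leb2 sig measurable_to_frame.

HB.instance Definition _ := isMeasure.Build _ _ _ frame_measure
  (measure0 frame_measure') (measure_ge0 frame_measure')
  (@measure_semi_sigma_additive _ _ _ frame_measure').

Lemma frame_measure_sigma_finite : sigma_finite setT frame_measure.
Proof.
pose F (n : nat) : set (mplane R) := [set` `[- n%:R, n%:R]] `*` [set` `[- n%:R, n%:R]].
exists (fun n => phi @^-1` (F n)).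
  apply/esym/seteqP; split => // z _.
  have [n1 hn1] : exists n : nat, `|(phi z).1| <= n%:R.
    by exists (Num.truncn `|(phi z).1|).+1; rewrite ltW ?truncnS_gt.
  have [n2 hn2] : exists n : nat, `|(phi z).2| <= n%:R.
    by exists (Num.truncn `|(phi z).2|).+1; rewrite ltW ?truncnS_gt.
  exists (maxn n1 n2) => //; split; rewrite /= in_itv /= -ler_norml.
    by rewrite (le_trans hn1) // ler_nat leq_maxl.
  by rewrite (le_trans hn2) // ler_nat leq_maxr.
move=> n; split.
  rewrite -[X in measurable X]setTI; apply: measurable_from_frame => //.
  exact: measurableX.
rewrite /frame_measure /pushforward -comp_preimage.
rewrite (_ : phi \o sig = id) ?preimage_id; first exact: leb2_box_lty.
by apply/funext => x; rewrite /= /phi /sig to_frameK.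
Qed.

HB.instance Definition _ := Measure_isSigmaFinite.Build _ _ _ frame_measure
  frame_measure_sigma_finite.

Lemma to_frameD x (v : plane R) :
  to_frame o a b ((x : plane R) + (v.1 *: a + v.2 *: b)) = to_frame o a b x + v.
Proof.
apply: (can_inj (from_frameK o ab0)).
by rewrite to_frameK // from_frameD to_frameK.
Qed.

Lemma frame_measure_shift (v : plane R) (A : set (plane R)) :
  measurable (A : set (mplane R)) -> frame_measure (shift_set v A) = frame_measure A.
Proof.
move=> mA; rewrite /frame_measure /pushforward.
have -> : sig @^-1` (shift_set v A) = shift_set (v.1 *: a + v.2 *: b) (sig @^-1` A).
  by apply/funext => x; rewrite /preimage /shift_set /sig /= to_frameD.
by rewrite leb2_shift // -[X in measurable X]setTI; exact: measurable_to_frame.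
Qed.

Lemma frame_measure_usq (G : set (plane R)) : compact G -> (forall z, usq z -> G (phi z)) ->
  (frame_measure usq < +oo)%E.
Proof.
move=> cG HG; have [M [_ HM]] := compact_bounded cG.
have {}HM : forall x, G x -> `|x| <= M + 1 by apply: HM; rewrite ltrDl.
rewrite /frame_measure /pushforward (le_lt_trans _ (leb2_box_lty (M + 1))) //.
apply: le_measure; rewrite ?inE.
- by rewrite -[X in measurable X]setTI; apply: measurable_to_frame => //; exact: measurable_usq.
- by apply: measurableX.
- move=> x /= /HG; rewrite /phi /sig to_frameK // => /HM.
  rewrite prod_normE ge_max => /andP[x1 x2].
  by split; rewrite /= in_itv /= -ler_norml.
Qed.

Definition frame_mu : {sigma_finite_measure set (mplane R) -> \bar R} := frame_measure.

End frame_measure.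

(** * Transfer to the convex body *)

Section transfer.
Context {R : realType}.
Implicit Types (G : set (plane R)) (o a b v z : plane R) (f Q : plane R -> R).

Definition direction (v : plane R) : plane R := (enorm v)^-1 *: v.

Lemma enormZ (c : R) v : enorm (c *: v) = `|c| * enorm v.
Proof.
rewrite /enorm -(sqrtr_sqr c) -sqrtrM ?sqr_ge0 //; congr Num.sqrt.
by rewrite /= /GRing.scale /=; ring.
Qed.

Lemma enorm_gt0 v : v != 0 -> 0 < enorm v.
Proof.
move=> v0; rewrite /enorm sqrtr_gt0 lt_neqAle addr_ge0 ?sqr_ge0 // andbT eq_sym.
apply: contra v0; rewrite paddr_eq0 ?sqr_ge0 // !sqrf_eq0 => /andP[/eqP v1 /eqP v2].
by apply/eqP; exact: plane_eq.
Qed.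

Lemma enorm_direction v : v != 0 -> enorm (direction v) = 1.
Proof.
move=> /enorm_gt0 v0; rewrite /direction enormZ normfV gtr0_norm // mulVf //.
by rewrite gt_eqF.
Qed.

Lemma det2_neq0 a b : det2 a b != 0 -> a != 0 /\ b != 0.
Proof.
move=> D; split; apply: contra_neq D => ->.
  by rewrite /det2 /= !mul0r subrr.
by rewrite /det2 /= !mulr0 subrr.
Qed.

Lemma free_directions a b : det2 a b != 0 -> free [:: direction a; direction b].
Proof.
move=> D; have [a0 b0] := det2_neq0 D.
have /enorm_gt0 na := a0; have /enorm_gt0 nb := b0.
rewrite free_cons seq1_free span_seq1; apply/andP; split; last first.
  by rewrite scaler_eq0 invr_eq0 gt_eqF.
apply/negP => /vlineP[k H]; move/eqP: D; apply.
have : a = (enorm a * (k * (enorm b)^-1)) *: b.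
  by rewrite -scalerA -scalerA -/(direction b) -H /direction scalerA divff ?scale1r // gt_eqF.
by move: (_ * _) => c ->; rewrite /det2 /= /GRing.scale /=; ring.
Qed.

Definition axis a b (d : bool) := if d then b else a.

Lemma from_frame_vec o a b z d (u : R) :
  from_frame o a b (z + vec d u) = from_frame o a b z + u *: axis a b d.
Proof. by rewrite from_frameD; case: d; rewrite /= scale0r ?addr0 ?add0r. Qed.

Lemma from_frame_step o a b z d (u : R) j :
  from_frame o a b (z + j%:R *: vec d u) = from_frame o a b z + j%:R *: (u *: axis a b d).
Proof. by rewrite vecZ from_frame_vec scalerA. Qed.

Lemma fdiff_from_frame o a b r d (u : R) f z :
  fdiff r (vec d u) (fun z => f (from_frame o a b z)) z =
  fdiff r (u *: axis a b d) f (from_frame o a b z).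
Proof. by apply: eq_bigr => j _; rewrite from_frame_step. Qed.

Lemma diff_domain_from_frame o a b G r d (u : R) :
  diff_domain (fun z => G (from_frame o a b z)) r (vec d u) =
  from_frame o a b @^-1` diff_domain G r (u *: axis a b d).
Proof.
by apply/seteqP; split => z /= H j /H; rewrite from_frame_step.
Qed.

Lemma enorm_le v : enorm v <= `|v.1| + `|v.2|.
Proof.
rewrite -[leRHS]ger0_norm ?addr_ge0 // -sqrtr_sqr ler_sqrt ?sqr_ge0 //.
by rewrite sqrrD !real_normK ?num_real // [leRHS]addrAC lerDl mulrn_wge0 ?mulr_ge0.
Qed.

Lemma diam_ub G x y : compact G -> G x -> G y -> enorm (x - y) <= diam G.
Proof.
move=> cG Gx Gy; apply: ub_le_sup; last by exists (x, y).
have [M [_ HM]] := compact_bounded cG.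
have {}HM : forall x, G x -> `|x| <= M + 1 by apply: HM; rewrite ltrDl.
exists ((M + 1) + (M + 1) + ((M + 1) + (M + 1))) => _ [[p q] [/= Gp Gq] <-].
move/HM: Gp; move/HM: Gq; rewrite !prod_normE !ge_max => /andP[q1 q2] /andP[p1 p2].
apply: (le_trans (enorm_le _)); rewrite lerD //= (le_trans (ler_normB _ _)) //; exact: lerD.
Qed.

Lemma Lpnorm0 p f : (0 < p)%E -> Lpnorm set0 p f = 0%E.
Proof.
move=> p0; rewrite /Lpnorm image_set0 setU0 ereal_sup1; case: eqP => // _.
rewrite patch_set0; have -> : EFin \o cst 0 = cst 0%E :> (mplane R -> \bar R) by [].
by rewrite Lnorm0 // gt_eqF.
Qed.

(** For |u| beyond the diameter the difference has an empty domain and norm 0, so the bound holds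
    for all u, as the statements on gauges require. *)
Lemma Lpnorm_fdiff_le1 G p r (E : set (plane R)) f xi (u : R) :
  compact G -> (0 < p)%E -> (0 < r)%N -> E xi -> enorm xi = 1 ->
  (set_modulus G p r E f <= 1)%E ->
  (Lpnorm (diff_domain G r (u *: xi)) p (fdiff r (u *: xi) f) <= 1)%E.
Proof.
move=> cG p0 r0 Exi xi1 H.
have [uG|uG] := leP `|u| (diam G).
  apply: le_trans H; apply: (@le_trans _ _ (dir_modulus G p r xi f (diam G))).
    by apply: ereal_sup_ubound; exists u.
  by apply: ereal_sup_ubound; exists xi.
suff -> : diff_domain G r (u *: xi) = set0 by rewrite Lpnorm0.
apply/seteqP; split => // x Hx; move: uG; apply/negP; rewrite -leNgt.
have := diam_ub cG (Hx 1%N r0) (Hx 0%N (leq0n r)).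
by rewrite scale1r scale0r addr0 addrAC subrr add0r enormZ xi1 mulr1.
Qed.

Lemma to_frame_vec o a b x d (t : R) : det2 a b != 0 ->
  to_frame o a b (x + t *: direction (axis a b d)) =
  to_frame o a b x + vec d (t / enorm (axis a b d)).
Proof.
move=> D; rewrite -(to_frameD o D) scalerA; congr (to_frame _ _ _ (x + _)).
by case: d; rewrite /= scale0r ?addr0 ?add0r.
Qed.

Lemma continuous_to_frame o a b : continuous (to_frame o a b).
Proof.
move=> x; have c1 : continuous (fun y : plane R => y - o).
  by move=> y; apply: cvgB; [exact: cvg_id|exact: cvg_cst].
have h1 : (fun y => det2 (y - o) b / det2 a b : R^o) @ x --> (det2 (x - o) b / det2 a b : R^o).
  apply: cvgM; last exact: cvg_cst.
  by apply: (continuous_det2 c1) => y; exact: cvg_cst.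
have h2 : (fun y => det2 a (y - o) / det2 a b : R^o) @ x --> (det2 a (x - o) / det2 a b : R^o).
  apply: cvgM; last exact: cvg_cst.
  by apply: (continuous_det2 _ c1) => y; exact: cvg_cst.
exact: (cvg_pair h1 h2).
Qed.

Lemma continuous_tensor_poly r Q : tensor_poly r Q -> continuous Q.
Proof.
move=> [s _ /funext ->]; elim: s => [|p s IH] x.
  by under eq_fun do rewrite big_nil; exact: cvg_cst.
under eq_fun do rewrite big_cons.
apply: cvgD; last exact: IH.
apply: cvgM.
  apply: (@continuous_comp _ _ _ fst (horner p.1)); [exact: cvg_fst|exact: continuous_horner].
apply: (@continuous_comp _ _ _ snd (horner p.2)); [exact: cvg_snd|exact: continuous_horner].
Qed.

Lemma tensor_poly_line r Q d x (c : R) : tensor_poly r Q -> exists P : {poly R},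
  (size P <= r)%N /\ forall t : R, Q (x + vec d (t * c)) = P.[t].
Proof.
move=> [s]; elim: s Q => [|p s IH] Q /= => [_|/andP[/andP[p1 p2] Hs]] HQ.
  by exists 0; rewrite size_poly0; split => // t; rewrite HQ big_nil horner0.
have [P [sP HP]] := IH (fun x => \sum_(q <- s) q.1.[x.1] * q.2.[x.2]) Hs (fun=> erefl).
have [q1 sq1 Hq1] := horner_affine p.1 c x.1.
have [q2 sq2 Hq2] := horner_affine p.2 c x.2.
exists ((if d then p.1.[x.1] *: q2 else p.2.[x.2] *: q1) + P); split.
  rewrite (leq_trans (size_polyD _ _)) // geq_max sP andbT.
  by case: (d); rewrite (leq_trans (size_scale_leq _ _)) // (leq_trans sq1,leq_trans sq2).
move=> t; rewrite HQ big_cons HP hornerD; congr (_ + _).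
case: (d) => /=; rewrite !hornerZ ?Hq1 ?Hq2 addr0 //; last by rewrite mulrC [x.1 + _]addrC [t * c]mulrC.
by rewrite [x.2 + _]addrC [t * c]mulrC.
Qed.

Lemma dir_poly_tensor r Q o a b : det2 a b != 0 -> tensor_poly r Q ->
  dir_poly r [set direction a; direction b] (fun x => Q (to_frame o a b x)).
Proof.
move=> D HQ; split.
  move=> x; apply: (@continuous_comp _ _ _ (to_frame o a b) Q).
    exact: continuous_to_frame.
  exact: (continuous_tensor_poly HQ (x := to_frame o a b x)).
move=> x xi Hxi; have [d ->] : exists d, xi = direction (axis a b d).
  by case: Hxi => ->; [exists false|exists true].
have [P [sP HP]] := tensor_poly_line d (to_frame o a b x) (enorm (axis a b d))^-1 HQ.
by exists P; split => // t; rewrite to_frame_vec.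
Qed.

End transfer.

Section whitney_transfer.
Context {R : realType}.
Implicit Types (G A : set (plane R)) (o a b v z : plane R) (f Q : plane R -> R).

(* [C0] bounds the gauge of the error and [C] its norm. *)
Lemma whitney_const_transfer (e : R) (N : gauge e) (p : \bar R) r (C0 C : R) G o a b :
  (0 < p)%E -> (0 < r)%N -> compact G -> det2 a b != 0 ->
  (forall f x, N (from_frame o a b @^-1` G) f x ->
    (forall d u, N (diff_domain (from_frame o a b @^-1` G) r (vec d u)) (fdiff r (vec d u) f) 1) ->
    exists2 L, tensor_poly r L & N (from_frame o a b @^-1` G) (fun z => f z - L z) C0) ->
  (forall f, Lpspace G p f -> exists x,
     N (from_frame o a b @^-1` G) (f \o from_frame o a b) x) ->
  (forall f h, Lpspace G p f ->
     (Lpnorm (diff_domain G r h) p (fdiff r h f) <= 1)%E ->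
     N (from_frame o a b @^-1` diff_domain G r h) (fdiff r h f \o from_frame o a b) 1) ->
  (forall f, N (from_frame o a b @^-1` G) (f \o from_frame o a b) C0 ->
     (Lpnorm G p f <= C%:E)%E) ->
  (whitney_const G p r [set direction a; direction b] <= C%:E)%E.
Proof.
move=> p0 r0 cG D HN Hf Hd HC; apply: ge_ereal_sup => _ [f [Lf Mf] <-].
have [x Nx] := Hf f Lf.
have [|L tL NL] := HN _ _ Nx.
  move=> d u; rewrite diff_domain_from_frame.
  have ax0 : axis a b d != 0 by have [a0 b0] := det2_neq0 D; case: d.
  apply: nle_ext; first by move=> z _; rewrite fdiff_from_frame; reflexivity.
  (* Steps are multiples of the sides in coordinates, but of unit vectors in the modulus. *)
  have -> : u *: axis a b d = (u * enorm (axis a b d)) *: direction (axis a b d).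
    by rewrite scalerA mulfK // gt_eqF ?enorm_gt0.
  apply: Hd => //; apply: (Lpnorm_fdiff_le1 _ cG p0 r0 _ _ Mf).
    by case: d {ax0}; [right|left].
  exact: enorm_direction.
apply: le_trans (HC (f \- (L \o to_frame o a b)) _); last first.
  by apply: nle_ext NL => z _ /=; rewrite from_frameK.
apply: ereal_inf_lbound; exists (L \o to_frame o a b) => //.
exact: dir_poly_tensor.
Qed.

Lemma Lpnorm_oo_le A f (x : R) : (Lpnorm A +oo f <= x%:E)%E <-> 0 <= x /\ forall z, A z -> `|f z| <= x.
Proof.
rewrite /Lpnorm eqxx; split.
  move=> H; split; first by rewrite -lee_fin (le_trans _ H) // ereal_sup_ubound //; left.
  move=> z Az; rewrite -lee_fin (le_trans _ H) // ereal_sup_ubound //; right; by exists z.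
move=> [x0 H]; apply: ge_ereal_sup => _ [->|[z Az <-]]; rewrite lee_fin //.
exact: H.
Qed.

Lemma whitney_const_oo r : (0 < r)%N -> exists2 C : R, 0 < C & forall G o a b,
  compact G -> det2 a b != 0 -> normalized (from_frame o a b @^-1` G) ->
  (whitney_const G +oo r [set direction a; direction b] <= C%:E)%E.
Proof.
move=> r0; have [C C0 HC] := whitney_normalized (@ltr01 R) r0.
exists C => // G o a b cG D nG.
have frame_ex x : x = from_frame o a b (to_frame o a b x) by rewrite to_frameK.
apply: (whitney_const_transfer (N := sup_gauge) (C0 := C) (o := o)) => //.
- by move=> f x; exact: HC.
- move=> f; rewrite /Lpspace /= => cf.
  (* Boundedness on the compact [G] gives the finite starting value of the iteration. *)
  have : compact (f @` G).
    apply: continuous_compact => //; apply: continuous_subspaceW cf.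
    exact: subset_closure.
  move=> /compact_bounded[M [_ HM]]; exists (`|M| + 1); split => [|z Gz].
    by rewrite addr_ge0.
  apply: HM; first by rewrite ltr_pwDr // ler_norm.
  by exists (from_frame o a b z).
- by move=> f h _ /Lpnorm_oo_le[_ H]; split => // z; exact: H.
- move=> f [_ H]; apply/Lpnorm_oo_le; split; first exact: ltW.
  by move=> z; rewrite (frame_ex z) => /H.
Qed.

Lemma LpnormE A (q : R) f : 0 < q ->
  Lpnorm A q%:E f = ((\int[leb2]_(z in A) (`|f z| `^ q)%:E) `^ q^-1)%E.
Proof.
move=> q0; rewrite /Lpnorm /= unlock; congr (_ `^ _)%E.
rewrite [RHS]integral_mkcond; apply: eq_integral => z _ /=.
rewrite !patchE; case: ifP => //; by rewrite normr0 powR0 // gt_eqF.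
Qed.

Lemma Lpnorm_le A (q x : R) f : 0 < q -> 0 <= x ->
  (Lpnorm A q%:E f <= (x `^ q^-1)%:E)%E <-> (\int[leb2]_(z in A) (`|f z| `^ q)%:E <= x%:E)%E.
Proof.
move=> q0 x0; rewrite LpnormE // -poweR_EFin.
have I0 : (0 <= \int[leb2]_(z in A) (`|f z| `^ q)%:E)%E.
  by apply: integral_ge0 => z _; rewrite lee_fin powR_ge0.
move: (integral _ _ _) I0 => I I0.
have h (y : \bar R) : (0 <= y)%E -> (y \in `[0%E, +oo%E]).
  by move=> y0; rewrite in_itv /= y0 leey.
split => H; last by apply: gt0_ler_poweR; rewrite ?invr_ge0 ?(ltW q0) //; exact: h.
have K (y : \bar R) : (0 <= y)%E -> ((y `^ q^-1) `^ q = y)%E.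
  by move=> y0; rewrite -poweRrM mulVf ?gt_eqF // poweRe1.
rewrite -[leLHS]K // -[leRHS]K ?lee_fin //.
by apply: gt0_ler_poweR; rewrite ?(ltW q0) //; apply: h; rewrite poweR_ge0.
Qed.

Lemma measurable_fdiff G r h f : measurable (G : set (mplane R)) ->
  measurable_fun (G : set (mplane R)) (f : mplane R -> R) ->
  measurable_fun (diff_domain G r h : set (mplane R)) (fdiff r h f : mplane R -> R).
Proof.
move=> mG mf; rewrite /fdiff; apply: measurable_sum => j.
apply: measurable_funM => //.
apply: (measurable_comp (F := G)) => //.
  by move=> _ [z /= Hz <-]; apply: Hz; rewrite -ltnS.
exact: (measurable_funS _ (@subsetT _ _) (measurable_addr_plane (j%:R *: h))).
Qed.

Lemma measurable_comp_from_frame o a b A f :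
  measurable (A : set (mplane R)) -> measurable_fun (A : set (mplane R)) (f : mplane R -> R) ->
  measurable_fun (from_frame o a b @^-1` A : set (mplane R)) (f \o from_frame o a b : mplane R -> R).
Proof.
move=> mA mf; apply: (measurable_comp (F := A)) => //.
  by move=> _ [z /= Az <-].
exact: (measurable_funS _ (@subsetT _ _) (measurable_from_frame o a b)).
Qed.

Lemma Lp_int_frame o a b (D : det2 a b != 0) (q : R) A f :
  measurable (A : set (mplane R)) -> measurable_fun (A : set (mplane R)) (f : mplane R -> R) ->
  Lp_int (e := q) (frame_mu o D) (from_frame o a b @^-1` A)
    (f \o from_frame o a b) = (\int[leb2]_(z in A) (`|f z| `^ q)%:E)%E.
Proof.
move=> mA mf; have mphi := measurable_from_frame o a b.
have mt : measurable_fun setT (to_frame o a b : mplane R -> mplane R) by exact: measurable_to_frame.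
have mA' : measurable (from_frame o a b @^-1` A : set (mplane R)).
  by rewrite -[X in measurable X]setTI; exact: mphi.
have AE : to_frame o a b @^-1` (from_frame o a b @^-1` A) = A.
  by rewrite -comp_preimage; apply/seteqP; split => x /=; rewrite to_frameK.
rewrite /Lp_int.
have := @ge0_integral_pushforward _ _ (mplane R) (mplane R) R (to_frame o a b) mt leb2
  (from_frame o a b @^-1` A) (fun z => (`|(f \o from_frame o a b) z| `^ q)%:E) mA'.
rewrite AE => H; apply: etrans (H _ _) _.
- by apply: measurable_normpow; exact: measurable_comp_from_frame.
- by move=> z _; rewrite lee_fin powR_ge0.
- by apply: eq_integral => z _ /=; rewrite to_frameK.
Qed.

Lemma whitney_const_fin (q : R) r : 0 < q -> (0 < r)%N -> exists2 C : R, 0 < C & forall G o a b,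
  compact G -> det2 a b != 0 -> normalized (from_frame o a b @^-1` G) ->
  (whitney_const G q%:E r [set direction a; direction b] <= C%:E)%E.
Proof.
move=> q0 r0; have [C C0 HC] := whitney_normalized q0 r0.
(* The gauge bounds the q-th power of the norm, hence the root. *)
exists (C `^ q^-1) => [|G o a b cG D nG]; first exact: powR_gt0.
have mG := compact_measurable_plane cG.
have usqG z : usq z -> G (from_frame o a b z).
  move=> [/andP[z1 z2] /andP[z3 z4]].
  by apply: (norm_sq nG); apply/andP; split => //; exact: ltW.
have oo : (frame_mu o D usq < +oo)%E := frame_measure_usq D cG usqG.
pose N : gauge q := Lp_gauge q0 (frame_measure_shift o D) oo.
have mpre (A : set (plane R)) : measurable (A : set (mplane R)) ->
    measurable (from_frame o a b @^-1` A : set (mplane R)).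
  by move=> mA; rewrite -[X in measurable X]setTI; exact: measurable_from_frame.
apply: (whitney_const_transfer (N := N) (C0 := C) (o := o)) => //.
- by move=> f x; exact: HC.
- move=> f [mf]; rewrite LpnormE // => /lty_poweRy I.
  have {}I := I (invr_neq0 (lt0r_neq0 q0)).
  exists (fine (\int[leb2]_(z in G) (`|f z| `^ q)%:E)); split.
  + exact: mpre.
  + exact: measurable_comp_from_frame.
  + rewrite Lp_int_frame // fineK // ge0_fin_numE //.
    by apply: integral_ge0 => z _; rewrite lee_fin powR_ge0.
- move=> f h [mf _] H.
  have mA := measurable_diff_domain r h mG; have mfd := measurable_fdiff (r := r) (h := h) mG mf.
  split; [exact: mpre|exact: measurable_comp_from_frame|].
  by rewrite Lp_int_frame // -Lpnorm_le // powR1.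
- move=> f Hf.
  have [_ mf H] : Lp_le (e := q) (frame_mu o D) (from_frame o a b @^-1` G) (f \o from_frame o a b) C := Hf.
  apply/Lpnorm_le; [exact: q0|exact: ltW|].
  rewrite -(Lp_int_frame o D) //.
  have mff : measurable_fun setT (to_frame o a b : mplane R -> mplane R) by exact: measurable_to_frame.
  (* The gauge yields measurability in coordinates; composing with [to_frame] brings it back to
     [G]. *)
  have : measurable_fun (to_frame o a b @^-1` (from_frame o a b @^-1` G) : set (mplane R))
     ((f \o from_frame o a b) \o to_frame o a b : mplane R -> R).
    apply: (measurable_comp (F := from_frame o a b @^-1` G)) => //.
    + exact: mpre.
    + by move=> _ [z /= Az <-].
    + exact: (measurable_funS _ (@subsetT _ _) mff).
  have -> : to_frame o a b @^-1` (from_frame o a b @^-1` G) = G.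
    by rewrite -comp_preimage; apply/seteqP; split => x /=; rewrite to_frameK.
  by apply: eq_measurable_fun => z _ /=; rewrite to_frameK.
Qed.

Lemma whitney_const_le (p : \bar R) r : (0 < p)%E -> (0 < r)%N -> exists2 C : R, 0 < C & forall G o a b,
  compact G -> det2 a b != 0 -> normalized (from_frame o a b @^-1` G) ->
  (whitney_const G p r [set direction a; direction b] <= C%:E)%E.
Proof.
case: p => [q| |] //; first by rewrite lte_fin; exact: whitney_const_fin.
by move=> _; exact: whitney_const_oo.
Qed.

End whitney_transfer.

Theorem theorem6p1 (R : realType) :
  exists C : \bar R -> nat -> R,
    (forall (p : \bar R) (r : nat), (0 < p)%E -> (0 < r)%N -> 0 < C p r) /\
    forall G : set (plane R), convex_body G ->
      exists xi1 xi2 : plane R,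
        [/\ sphere1 xi1, sphere1 xi2, free [:: xi1; xi2] &
          forall (p : \bar R) (r : nat), (0 < p)%E -> (0 < r)%N ->
            (whitney_const G p r [set xi1; xi2] <= (C p r)%:E)%E].
Proof.
(* One constant per pair (p, r), chosen before any body; for other pairs any positive number
   does. *)
have HC (pr : \bar R * nat) : exists C : R, 0 < C /\ ((0 < pr.1)%E -> (0 < pr.2)%N ->
    forall G o a b, compact G -> det2 a b != 0 ->
      normalized (from_frame o a b @^-1` G) ->
      (whitney_const G pr.1 pr.2 [set direction a; direction b] <= C%:E)%E).
  case: (pselect ((0 < pr.1)%E /\ (0 < pr.2)%N)) => [[p0 r0]|H].
    by have [C C0 HC] := whitney_const_le p0 r0; exists C.
  by exists 1; split => // p0 r0; case: H.
have [C {}HC] := choice HC.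
exists (fun p r => C (p, r)); split => [p r _ _|G bG]; first by have [] := HC (p, r).
have [c [a [b [D0 mG]]]] := max_parallelogram_frame bG.
have cG : compact G by case: bG.
have D : det2 a b != 0 by rewrite gt_eqF.
have [a0 b0] := det2_neq0 D.
exists (direction a), (direction b).
split; [exact: enorm_direction|exact: enorm_direction|exact: free_directions|].
move=> p r p0 r0; have [_ HCpr] := HC (p, r); apply: (HCpr p0 r0 G c a b cG D).
apply: max_parallelogram_normalized mG.
rewrite -[X in measurable X]setTI; apply: measurable_from_frame => //.
exact: compact_measurable_plane.
Qed.
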